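(* Let $k\ge 3$ be an integer and let $a\neq 0$ be a constant. Let $\mathcal{Z}$ be the twistor space defined by the patching relations $$\widetilde{Q}=\lambda^{-k}Q,\qquad \tilde{\tau}=\lambda^{k-2}\tau+a\lambda^{-2}Q^2,\qquad \tilde\lambda=\lambda^{-1},$$ and let $(M_{\mathbb{C}},g)$ be the corresponding anti-self-dual (ASD) Ricci-flat manifold, whose points are the holomorphic sections of $\mathcal{Z}\to\mathbb{CP}^1$. Then there exists a curve $\gamma\subset M_{\mathbb{C}}$ such that all points on $\gamma$ correspond to rational curves in $\mathcal{Z}$ where the normal bundle jumps from $\mathcal{O}(1)\oplus\mathcal{O}(1)$ (the normal bundle at generic points) to $\mathcal{O}(k)\oplus\mathcal{O}(2-k)$, and such that $\gamma$ is preserved by a tri-holomorphic Killing vector of $g$.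
   Context: $\mathcal{O}(m)$ denotes the holomorphic line bundle over $\mathbb{CP}^1$ with Chern class $m$. Cover $\mathbb{CP}^1$ by $U$ (affine coordinate $\lambda$) and $\widetilde U$ (affine coordinate $\tilde\lambda=\lambda^{-1}$); $\mathcal{O}(m)$ has patching function $\lambda^{-m}$ (fibre coordinate over $\widetilde U$ equals $\lambda^{-m}$ times fibre coordinate over $U$). $\mathcal{Z}$ is the complex three-fold obtained by gluing $\{(\lambda,Q,\tau)\}$ and $\{(\tilde\lambda,\widetilde Q,\tilde\tau)\}$ over $U\cap\widetilde U$ by the stated relations; it is an affine line bundle over the total space of $\mathcal{O}(k)$, and fibres over $\mathbb{CP}^1$ by $\lambda$. Holomorphic sections: restrict $Q=x_k\lambda^k+\dots+x_1\lambda+x_0$. A (then unique) holomorphic section $L_p\cong\mathbb{CP}^1$ of $\mathcal{Z}\to\mathbb{CP}^1$ with this $Q$ exists iff the coefficients of $\lambda^n$ in $Q^2$ vanish for $3\le n\le k-1$, i.e. $k-3$ quadratic conditions $x_0x_3+x_1x_2=0$, $x_0x_4+x_1x_3+\tfrac12x_2^2=0$, $\dots$ (no conditions if $k=3$). $M_{\mathbb{C}}$ is the space of such sections, a (Zariski) cone in $H^0(\mathbb{CP}^1,\mathcal{O}(k))=\mathbb{C}^{k+1}$; $t=x_0$, $z=x_1$, $y=x_2$, $x=x_k$ are coordinates on an open set of it, with the remaining $x_3,\dots,x_{k-1}$ expressed as functions of $(y,z,t)$. Conformal structure: a vector in $T_pM_{\mathbb{C}}$ is null iff the corresponding section of the normal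 bundle $N(L_p)$ of $L_p\subset\mathcal{Z}$ vanishes at one point, equivalently $\delta\widetilde Q=0$, $\delta\tilde\tau=0$ have a common solution $\lambda$. This gives the ASD conformal class $[g]$ (defined where $N(L_p)\cong\mathcal{O}(1)\oplus\mathcal{O}(1)$; the metric may be singular where the normal bundle jumps). The fibres of $\mathcal{Z}\to\mathbb{CP}^1$ carry the $\mathcal{O}(2)$-valued symplectic form $\Sigma=\lambda^{-2}dQ\wedge d\tau=d\widetilde Q\wedge d\tilde\tau$ (with $\lambda$ held fixed), and restricting to sections, $dQ\wedge d\tau=\Sigma^{11}-2\lambda\Sigma^{01}+\lambda^2\Sigma^{00}$ defines two-forms $\Sigma^{00},\Sigma^{01},\Sigma^{11}$ on $M_{\mathbb{C}}$. $g$ is the Ricci-flat metric in $[g]$ (unique up to constant scale) for which these span $\Lambda^2_+$ and are parallel. A Killing vector $K$ is tri-holomorphic if $\mathcal{L}_K\Sigma^{AB}=0$ for all three forms. *)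

(* Defs.v *)
From HB Require Import structures.
From mathcomp Require Import all_boot all_order all_algebra.
From mathcomp Require Import all_classical all_reals all_analysis.
From mathcomp Require Import complex.
Set Implicit Arguments.
Unset Strict Implicit.
Unset Printing Implicit Defensive.
Import Order.TTheory GRing.Theory Num.Theory.
Import numFieldNormedType.Exports.
Local Open Scope classical_set_scope.
Local Open Scope ring_scope.

(* Vectors are row vectors, so the transition matrix F of a bundle acts on the
   right, and [jacobian f p] has the partial derivatives of f as its rows.
   All derivatives are over the field C, i.e. complex derivatives. *)

(* Packing R[i] as a numClosedFieldType gives it the topology and the normed
   module structure that every numFieldType has. *)
Definition Cx (R : realType) : numClosedFieldType := R[i].

Section Bundles.
Variable R : realType.
Local Notation C := (Cx R).

Definition holo_on (V W : normedModType C) (D : set V) (f : V -> W) : Prop :=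
  forall p, D p -> differentiable f p.

Definition entire (W : normedModType C) (f : C -> W) : Prop :=
  forall z : C, differentiable f z.

Definition row2 (u v : C) : 'rV[C]_2 := \row_(j < 2) (if j == 0 then u else v).

(* A rank-two fibration over CP^1 trivialised over U (coordinate l) and
   U~ (coordinate l^-1), with fibre coordinates related by p~ = psi l p.
   A holomorphic section is a pair of holomorphic maps, one for each chart. *)
Definition holo_section (psi : C -> 'rV[C]_2 -> 'rV[C]_2)
    (s st : C -> 'rV[C]_2) : Prop :=
  [/\ entire s, entire st & forall l, l != 0 -> st l^-1 = psi l (s l)].

(* The normal bundle of a section is the vertical tangent bundle along it, so
   its transition matrix is the fibre derivative of the patching map. *)
Definition normal_patch (psi : C -> 'rV[C]_2 -> 'rV[C]_2)
    (s : C -> 'rV[C]_2) (l : C) : 'M[C]_2 :=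
  jacobian (psi l) (s l).

Definition bundle_section (F : C -> 'M[C]_2) (s st : C -> 'rV[C]_2) : Prop :=
  holo_section (fun l p => p *m F l) s st.

Definition bundle_iso (F G : C -> 'M[C]_2) : Prop :=
  exists H Ht : C -> 'M[C]_2,
    [/\ entire H, entire Ht,
        (forall l, H l \in unitmx) /\ (forall l, Ht l \in unitmx)
      & forall l, l != 0 -> F l *m Ht l^-1 = H l *m G l].

(* O(m) + O(n) *)
Definition Osum (m n : int) (l : C) : 'M[C]_2 :=
  diag_mx (row2 (l ^ (- m)) (l ^ (- n))).

End Bundles.

Section Twistor.
Variable R : realType.
Local Notation C := (Cx R).
Variables (k : nat) (a : C).
Local Notation V := 'rV[C]_k.+1.

(* p = (Q, tau) *)
Definition patch (l : C) (p : 'rV[C]_2) : 'rV[C]_2 :=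
  row2 (l ^- k * p 0 0) (l ^+ (k - 2) * p 0 1 + a * l ^- 2 * p 0 0 ^+ 2).

Definition Qpoly (x : V) (l : C) : C := \sum_(i < k.+1) x 0 i * l ^+ i.

(* A holomorphic section is identified with the coefficient vector of its
   Q-component, as an element of H^0(CP^1, O(k)). *)
Definition curve_at (x : V) (s st : C -> 'rV[C]_2) : Prop :=
  holo_section patch s st /\ forall l, s l 0 0 = Qpoly x l.

Definition MC : set V := [set x | exists s st, curve_at x s st].

Definition normal_type (x : V) (m n : int) : Prop :=
  exists s st, curve_at x s st /\
    bundle_iso (normal_patch patch s) (Osum m n).

Definition Mreg : set V := [set x | normal_type x 1 1].

(* The domain, inside the space of sections, of the coordinates
   t = x_0, z = x_1, y = x_2, x = x_k: where x_0 <> 0 the conditions on Q^2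
   determine x_3, ..., x_(k-1).  For k >= 6 it is not dense in MC, which has
   further components with x_0 = 0 on which the normal bundle is never
   O(1) + O(1). *)
Definition Mcoord : set V := [set x | MC x /\ x 0 0 != 0].

(* The section (d, dt) of the normal bundle of the curve at x whose
   Q-component has coefficient vector v. *)
Definition deformation (x v : V) (d dt : C -> 'rV[C]_2) : Prop :=
  exists s st, [/\ curve_at x s st,
    bundle_section (normal_patch patch s) d dt
  & forall l, d l 0 0 = Qpoly v l].

(* T_x M = H^0(N) *)
Definition TM (x : V) : set V := [set v | exists d dt, deformation x v d dt].

(* A tensor field b of rank two: [b x v w], for v and w tangent at x. *)
Definition tensor2 := V -> V -> V -> C.

(* dQ /\ dtau = Sigma^11 - 2 l Sigma^01 + l^2 Sigma^00 on sections *)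
Definition sigma_forms (S00 S01 S11 : tensor2) : Prop :=
  forall x v w d dt e et,
    deformation x v d dt -> deformation x w e et ->
    forall l, d l 0 0 * e l 0 1 - e l 0 0 * d l 0 1 =
      S11 x v w - 2 * l * S01 x v w + l ^+ 2 * S00 x v w.

Definition null_vector (x v : V) : Prop :=
  exists d dt, deformation x v d dt /\ exists l, d l = 0 \/ dt l = 0.

(* Holomorphic local parametrisations of the four-manifold Mreg. *)
Definition param (U : set 'rV[C]_4) (phi : 'rV[C]_4 -> V) : Prop :=
  [/\ open U, holo_on U phi, forall u, U u -> Mreg (phi u)
    & forall u, U u -> row_free (jacobian phi u)].

Definition pullback (b : tensor2) (phi : 'rV[C]_4 -> V) (u : 'rV[C]_4) :
    'M[C]_4 :=
  \matrix_(i, j) b (phi u) (row i (jacobian phi u)) (row j (jacobian phi u)).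

End Twistor.

Section LocalGeometry.
Variable R : realType.
Local Notation C := (Cx R).
Implicit Types (h b : 'rV[C]_4 -> 'M[C]_4) (u : 'rV[C]_4).

Definition pd (i : 'I_4) (f : 'rV[C]_4 -> C) (u : 'rV[C]_4) : C :=
  'D_(delta_mx 0 i) f u.

(* Gamma^m_{ij} *)
Definition christoffel h (m i j : 'I_4) u : C :=
  2^-1 * \sum_(n < 4) invmx (h u) m n *
    (pd i (fun w => h w n j) u + pd j (fun w => h w n i) u
     - pd n (fun w => h w i j) u).

Definition ricci h u (i j : 'I_4) : C :=
  \sum_(l < 4) (pd l (christoffel h l i j) u - pd j (christoffel h l i l) u)
  + \sum_(l < 4) \sum_(m < 4)
      (christoffel h l l m u * christoffel h m i j u
       - christoffel h l j m u * christoffel h m i l u).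

(* nabla_l b_{ij} *)
Definition covd h b u (l i j : 'I_4) : C :=
  pd l (fun w => b w i j) u
  - \sum_(m < 4) (christoffel h m l i u * b u m j
                  + christoffel h m l j u * b u i m).

Definition lie_derivative (kappa : 'rV[C]_4 -> 'rV[C]_4) b u (i j : 'I_4) : C :=
  \sum_(l < 4) (kappa u 0 l * pd l (fun w => b w i j) u
    + b u l j * pd i (fun w => kappa w 0 l) u
    + b u i l * pd j (fun w => kappa w 0 l) u).

(* The alternating symbol. *)
Definition eps (i j m n : 'I_4) : C :=
  \det (\matrix_(p < 4, q < 4) (q == nth ord0 [:: i; j; m; n] p)%:R).

(* The Hodge star on two-forms for the metric matrix h and the volume form
   nu du^1 /\ ... /\ du^4; the choice of nu with nu^2 = det h is the
   orientation. *)
Definition hodge (h : 'M[C]_4) (nu : C) (w : 'M[C]_4) : 'M[C]_4 :=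
  \matrix_(i, j) (2^-1 * nu * \sum_(m < 4) \sum_(n < 4)
    eps i j m n * (invmx h *m w *m (invmx h)^T) m n).

Definition spans_selfdual (h A B D : 'M[C]_4) : Prop :=
  exists nu, nu ^+ 2 = \det h /\
    forall w : 'M[C]_4, w^T = - w ->
      (hodge h nu w = w <->
       exists c0 c1 c2, w = c0 *: A + c1 *: B + c2 *: D).

End LocalGeometry.

Section Metric.
Variable R : realType.
Local Notation C := (Cx R).
Variables (k : nat) (a : C).
Local Notation V := 'rV[C]_k.+1.

Definition holo_metric (g : tensor2 R k) : Prop :=
  [/\ forall x v w y c, Mreg a x -> TM a x v -> TM a x w -> TM a x y ->
        g x (c *: v + w) y = c * g x v y + g x w y,
      forall x v w, Mreg a x -> TM a x v -> TM a x w -> g x v w = g x w v,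
      forall x v, Mreg a x -> TM a x v ->
        (forall w, TM a x w -> g x v w = 0) -> v = 0
    & forall U phi, param a U phi -> holo_on U (pullback g phi)].

Definition in_conformal_class (g : tensor2 R k) : Prop :=
  forall x v, Mreg a x -> TM a x v -> (g x v v = 0 <-> null_vector a x v).

Definition ricci_flat (g : tensor2 R k) : Prop :=
  forall U phi, param a U phi ->
    forall u, U u -> forall i j, ricci (pullback g phi) u i j = 0.

Definition parallel (g b : tensor2 R k) : Prop :=
  forall U phi, param a U phi ->
    forall u, U u ->
      forall l i j, covd (pullback g phi) (pullback b phi) u l i j = 0.

Definition spans_Lambda_plus (g S00 S01 S11 : tensor2 R k) : Prop :=
  forall U phi, param a U phi -> forall u, U u ->
    spans_selfdual (pullback g phi u) (pullback S00 phi u)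
      (pullback S01 phi u) (pullback S11 phi u).

(* S00, S01, S11 are the forms Sigma^AB and g is the Ricci-flat metric, on the
   locus where the normal bundle is O(1) + O(1), determined by the twistor
   space up to a constant scale. *)
Record twistor_metric (g S00 S01 S11 : tensor2 R k) : Prop := TwistorMetric {
  tm_sigma : sigma_forms a S00 S01 S11;
  tm_holo : holo_metric g;
  tm_conformal : in_conformal_class g;
  tm_ricci_flat : ricci_flat g;
  tm_spans : spans_Lambda_plus g S00 S01 S11;
  tm_parallel : [/\ parallel g S00, parallel g S01 & parallel g S11]
}.

(* Vector fields on MC (which may be singular) are restrictions of holomorphic
   vector fields on the ambient space H^0(CP^1, O(k)). *)
Definition vector_field (K : V -> V) : Prop :=
  holo_on setT K /\ forall x, MC a x -> TM a x (K x).

(* The Lie derivative L_K b vanishes on Mreg; kappa is K in the coordinates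
   given by phi. *)
Definition lie_invariant (K : V -> V) (b : tensor2 R k) : Prop :=
  forall U phi kappa, param a U phi -> holo_on U kappa ->
    (forall u, U u -> kappa u *m jacobian phi u = K (phi u)) ->
    forall u, U u -> forall i j, lie_derivative kappa (pullback b phi) u i j = 0.

Record triholomorphic_killing (g S00 S01 S11 : tensor2 R k) (K : V -> V) :
    Prop := TriholomorphicKilling {
  tk_field : vector_field K;
  tk_neq0 : exists2 x, Mreg a x & K x != 0;
  tk_killing : lie_invariant K g;
  tk_triholo : [/\ lie_invariant K S00, lie_invariant K S01
                 & lie_invariant K S11]
}.

(* A one-dimensional complex curve: the image of a holomorphic injective
   immersion of a connected open subset of the complex plane. *)
Definition holo_curve (gamma : set V) : Prop :=
  exists (D : set C) (c : C -> V),
    [/\ open D, connected D, D !=set0, {in D &, injective c}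
      & (forall z, D z -> differentiable c z /\
                          'D_1 c z != 0) /\
        gamma = c @` D].

(* Every (complex-time) integral curve of K starting on gamma stays on it. *)
Definition preserved_by (K : V -> V) (gamma : set V) : Prop :=
  forall (r : C) (c : C -> V), 0 < r ->
    (forall z, `|z| < r -> is_derive z (1 : C) c (K (c z))) ->
    gamma (c 0) -> forall z, `|z| < r -> gamma (c z).

(* P holds on a relatively open dense subset of S. *)
Definition generically (S P : set V) : Prop :=
  exists O : set V, [/\ open O, S `&` O `<=` P & S `<=` closure (S `&` O)].

End Metric.

(* Main.v *)
Require Import Defs.
From HB Require Import structures.
From mathcomp Require Import all_boot all_order all_algebra.
From mathcomp Require Import all_classical all_reals all_analysis.
From mathcomp Require Import complex ring lra zify fingroup perm.
Set Implicit Arguments.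
Unset Strict Implicit.
Unset Printing Implicit Defensive.
Import Order.TTheory GRing.Theory Num.Theory.
Import numFieldNormedType.Exports.
Local Open Scope classical_set_scope.
Local Open Scope ring_scope.

(** A section is given by the polynomial Q of degree at most k with coefficient
vector x. Comparing powers of l in the patching relation for tau shows that the
section exists exactly when Q^2 has no terms in degrees 3 to k - 1
([curve_ex], [MC_quadrics]; the necessity is Liouville's theorem). The
polarised conditions imply tangency at x ([deformation_ex]), and the normal
bundle has the triangular transition matrix [normal_mx], with diagonal l^-k,
l^(k-2) and off-diagonal entry 2 a l^-2 Q.

Generic curves. Let Q(0) != 0 and let u be the truncation of 1/Q in degrees
below k. If the coefficient of u in degree k - 1 is nonzero, u provides explicit
frames which identify the normal bundle with O(1) + O(1) ([Mreg_inverse]). The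
condition is open, and it is dense where x_0 != 0: any such curve is joined by a
path, polynomial in its parameter, to the curve Q = x_0 (1 + l) + x_k l^k, where
1/Q is a geometric series below degree k ([path_density]).

The jumping curve. On the line gamma of all Q = c l^k the off-diagonal entry is
2 a c l^(k-2), which a constant change of frame removes, so the normal bundle is
O(k) + O(2 - k). The curves Q = e (1 + l) + c l^k with e != 0 are regular and
tend to gamma.

The symmetry. The translations Q + s l^k, tau - a (2 s Q + s^2 l^k) are
symmetries of the twistor space which preserve dQ ^ dtau. On the space of
sections their generator is the constant vector field [ek] in the direction
x_k; it is tangent to gamma, and its integral curves starting on gamma remain
there. In a chart, the Lie derivatives of the three forms along it vanish
because each form is a combination of values of dQ ^ dtau at fixed l, and these
depend on the base point in a translation-invariant way ([lie_sigma]).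

The Killing property needs no formula for the metric. The three forms are
parallel, so the vanishing of their Lie derivatives says that the covariant
derivative X of the field annihilates them algebraically. They span the
self-dual two-forms; in an orthonormal frame these are three quaternion units,
and an endomorphism annihilating the units is skew ([selfdual_annihilator]).
Hence X is skew for the metric, that is, the field is Killing
([metric_killing]).

Three facts of complex analysis are used: Liouville's theorem, for the conditions
on Q and for the bound on the dimension of tangent spaces ([TM_dependent]); the
existence and the symmetry of second derivatives of holomorphic maps, for the
charts; and the constancy of functions with zero derivative. The first two come
from Goursat's theorem for rectangles: transported by the exponential it gives
the mean value property, which applied to difference quotients is Cauchy's
formula for the first derivative. *)

(** * Complex derivatives as estimates *)

Section DerivativeEps.
Variables (K : numFieldType) (V W : normedModType K).

Lemma is_derive_epsP (f : V -> W) a v d :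
  is_derive a v f d <->
  forall e : K, 0 < e -> exists2 r : K, 0 < r & forall h, `|h| < r ->
    `|f (h *: v + a) - f a - h *: d| <= e * `|h|.
Proof.
split.
  case=> fav dE e e0; move: fav; rewrite /derivable => fav.
  have : (fun h => h^-1 *: ((f \o shift a) (h *: v) - f a)) @ 0^' --> d.
    by rewrite -dE /derive; exact: fav.
  move/cvgrPdist_le => /(_ e e0) [/= r r0 H]; exists r => // h hr.
  have [->|h0] := eqVneq h 0.
    by rewrite !scale0r add0r subrr subr0 !normr0 mulr0.
  have := H h; rewrite /ball_/= sub0r normrN => /(_ hr h0) /= H1.
  rewrite -[X in `|X - _|]scale1r -(divff h0) -scalerA -scalerBr normrZ mulrC.
  by rewrite ler_pM2r ?normr_gt0// distrC.
move=> H.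
have cv : (fun h => h^-1 *: ((f \o shift a) (h *: v) - f a)) @ 0^' --> d.
  apply/cvgrPdist_le => e e0; have [r r0 Hr] := H e e0.
  exists r => //= h; rewrite /ball_/= sub0r normrN => hr h0.
  rewrite distrC -[d in X in `|X|]scale1r -(mulVf h0) -scalerA -scalerBr.
  by rewrite normrZ normfV ler_pdivrMl ?normr_gt0// mulrC; exact: Hr.
split; first by apply/cvg_ex; exists d.
exact: cvg_lim.
Qed.

End DerivativeEps.

Section ComplexBasics.
Variable R : realType.
Local Notation C := (Cx R).
Local Notation Re := (@complex.Re R).
Local Notation Im := (@complex.Im R).

(** Real-valued and equivalent to the modulus, which takes its values in the
complex numbers; estimates are made with it so that real linear arithmetic
applies. *)
Definition n1 (z : C) : R := `|Re z| + `|Im z|.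

Lemma ReD (z w : C) : Re (z + w) = Re z + Re w. Proof. by case: z w => ? ? []. Qed.
Lemma ImD (z w : C) : Im (z + w) = Im z + Im w. Proof. by case: z w => ? ? []. Qed.
Lemma ReN (z : C) : Re (- z) = - Re z. Proof. by case: z. Qed.
Lemma ImN (z : C) : Im (- z) = - Im z. Proof. by case: z. Qed.
Lemma ReM (z w : C) : Re (z * w) = Re z * Re w - Im z * Im w.
Proof. by case: z w => ? ? []. Qed.
Lemma ImM (z w : C) : Im (z * w) = Re z * Im w + Im z * Re w.
Proof. by case: z w => ? ? [? ?] /=. Qed.

Definition ReImE := (ReD, ImD, ReN, ImN, ReM, ImM).

Lemma eqC (z w : C) : Re z = Re w -> Im z = Im w -> z = w.
Proof. by case: z w => ? ? [? ?] /= -> ->. Qed.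

Lemma n1_ge0 z : 0 <= n1 z. Proof. exact: addr_ge0. Qed.
Lemma n10 : n1 0 = 0. Proof. by rewrite /n1 /= normr0 addr0. Qed.
Lemma n1_eq0 z : n1 z <= 0 -> z = 0.
Proof.
rewrite /n1 => H; have h1 := normr_ge0 (Re z); have h2 := normr_ge0 (Im z).
by apply: eqC => /=; apply/eqP; rewrite -normr_eq0; apply/eqP; lra.
Qed.
Lemma n1_gt0 z : z != 0 -> 0 < n1 z.
Proof. by move=> z0; rewrite ltNge; apply: contra z0 => /n1_eq0 ->. Qed.
Lemma n1N z : n1 (- z) = n1 z. Proof. by rewrite /n1 !ReImE !normrN. Qed.
Lemma n1D z w : n1 (z + w) <= n1 z + n1 w.
Proof.
rewrite /n1 !ReImE; have := ler_normD (Re z) (Re w); have := ler_normD (Im z) (Im w).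
lra.
Qed.
Lemma n1B z w : n1 (z - w) <= n1 z + n1 w.
Proof. by rewrite -(n1N w); exact: n1D. Qed.
Lemma n1M z w : n1 (z * w) <= n1 z * n1 w.
Proof.
rewrite /n1 !ReImE; have := ler_normB (Re z * Re w) (Im z * Im w).
have := ler_normD (Re z * Im w) (Im z * Re w); rewrite !normrM; lra.
Qed.
Lemma n1_real (x : R) : n1 (x%:C)%C = `|x|.
Proof. by rewrite /n1 /= normr0 addr0. Qed.
Lemma n1_Re z : `|Re z| <= n1 z. Proof. by rewrite /n1 lerDl. Qed.
Lemma n1_Im z : `|Im z| <= n1 z. Proof. by rewrite /n1 lerDr. Qed.
Lemma n1_le z e : `|Re z| <= e -> `|Im z| <= e -> n1 z <= 2 * e.
Proof. rewrite /n1; lra. Qed.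

Lemma normC_n1 (z : C) : `|z| <= ((n1 z)%:C)%C.
Proof.
rewrite normc_def lecR -[leRHS]ger0_norm ?n1_ge0// -sqrtr_sqr ler_wsqrtr//.
rewrite /n1 -(real_normK (num_real (Re z))) -(real_normK (num_real (Im z))).
have := normr_ge0 (Re z); have := normr_ge0 (Im z); nra.
Qed.

Lemma n1_normC (z : C) : ((n1 z)%:C)%C <= 2 * `|z|.
Proof.
rewrite normc_def -[2 : C]/(2%:R : R[i]) -(rmorph_nat (real_complex R)) -rmorphM /= lecR.
rewrite /n1 mulrDl !mul1r; apply: lerD; rewrite -sqrtr_sqr ler_wsqrtr//.
- by rewrite lerDl sqr_ge0.
- by rewrite lerDr sqr_ge0.
Qed.

Lemma posC_real (e : C) : 0 < e -> exists2 e' : R, 0 < e' & e = (e'%:C)%C.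
Proof.
case: e => x y; rewrite ltcE /= => /andP[/eqP -> x0]; by exists x.
Qed.

Lemma realC_pos (e : R) : 0 < e -> 0 < (e%:C)%C :> C.
Proof. by move=> e0; rewrite -[0 : C]/((0:R)%:C)%C ltcR. Qed.

Lemma twice_half (e : R) : 2 * ((e / 2)%:C)%C = (e%:C)%C :> C.
Proof. by apply: eqC; rewrite !ReImE /=; lra. Qed.

Lemma n1_lt_half (z : C) (e : R) : `|z| < ((e / 2)%:C)%C -> n1 z < e.
Proof.
move=> ze; rewrite -ltcR (le_lt_trans (n1_normC _))// -twice_half.
by rewrite ltr_pM2l ?ltr0n.
Qed.

Lemma nbhsC_n1 (z : C) (P : set C) :
  (\forall w \near z, P w) <-> exists2 d : R, 0 < d & forall w, n1 (w - z) < d -> P w.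
Proof.
split.
  move/nbhs_ballP => [e e0 H]; have [d d0 de] := posC_real e0.
  exists d => // w wz; apply: H; rewrite -ball_normE /ball_/= distrC.
  by rewrite de (le_lt_trans (normC_n1 _))// ltcR.
case=> d d0 H; apply/nbhs_ballP; exists ((d / 2)%:C)%C; first by apply: realC_pos; lra.
move=> w; rewrite -ball_normE /ball_/= distrC => wz; apply: H.
exact: n1_lt_half.
Qed.

(** Complex differentiability of f at z with derivative d. *)
Definition cdiff (f : C -> C) (z d : C) : Prop :=
  forall e : R, 0 < e -> exists2 r : R, 0 < r & forall h, n1 h < r ->
    n1 (f (z + h) - f z - h * d) <= e * n1 h.

Lemma is_derive_cdiff (V : normedModType C) (f : V -> C) a v d :
  is_derive a v f d <-> cdiff (fun h => f (h *: v + a)) 0 d.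
Proof.
rewrite is_derive_epsP; split.
  move=> H e e0; have [|r r0 Hr] := H ((e / 2)%:C)%C; first by apply: realC_pos; lra.
  have [d' d0 de] := posC_real r0; exists d' => // h hd; rewrite add0r scale0r add0r.
  have := Hr h; rewrite de (le_lt_trans (normC_n1 _)) ?ltcR// => /(_ isT).
  rewrite -lecR => H1; rewrite (le_trans (n1_normC _))//.
  apply: (@le_trans _ _ (2 * (((e / 2)%:C)%C * `|h|))).
    by rewrite ler_pM2l ?ltr0n.
  by rewrite mulrA twice_half rmorphM /= ler_pM2l ?normC_n1 ?realC_pos.
move=> H e e0; have [e' e'0 ee] := posC_real e0.
have [|r r0 Hr] := H (e' / 2); first lra.
exists ((r / 2)%:C)%C; first by apply: realC_pos; lra.
move=> h hr; have := Hr h; rewrite add0r scale0r add0r.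
have -> : n1 h < r by exact: n1_lt_half.
move=> /(_ isT) H1; rewrite (le_trans (normC_n1 _))//.
move: H1; rewrite -lecR => H1; rewrite (le_trans H1)// ee -twice_half.
by rewrite rmorphM /= mulrAC [leRHS]mulrC ler_pM2l ?realC_pos ?n1_normC; last lra.
Qed.

Lemma is_derive1_cdiff (f : C -> C) (z d : C) : is_derive z (1 : C) f d <-> cdiff f z d.
Proof.
rewrite is_derive_cdiff; split=> H e e0; have [r r0 Hr] := H e e0; exists r => // h hr;
  have := Hr h hr; rewrite add0r scale0r add0r;
  by rewrite (_ : h *: (1 : C) = h) ?[h + z]addrC//; exact: mulr1.
Qed.

Lemma is_deriveR (f : R -> R) (x d : R) :
  is_derive x (1 : R) f d <->
  forall e : R, 0 < e -> exists2 r : R, 0 < r & forall h, `|h| < r ->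
    `|f (x + h) - f x - h * d| <= e * `|h|.
Proof.
rewrite is_derive_epsP; split=> H e e0; have [r r0 Hr] := H e e0; exists r => // h hr;
  have := Hr h hr;
  by rewrite (_ : h *: (1 : R) = h) ?[h + x]addrC//; exact: mulr1.
Qed.

End ComplexBasics.

(** * Antiderivatives of complex curves and repeated quartering *)

Section RealCalculus.
Variable R : realType.
Local Notation C := (Cx R).
Local Notation Re := (@complex.Re R).
Local Notation Im := (@complex.Im R).

(** Integrals enter through antiderivatives only. An integrand that is affine up
to eta has the integral of the affine function up to eta times the length. *)
Lemma mean_value_affine (v phi : R -> R) (a b p q eta : R) : a <= b ->
  (forall t, a <= t <= b -> is_derive t (1 : R) v (phi t)) ->
  (forall t, a <= t <= b -> `|phi t - (p + q * t)| <= eta) ->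
  `|v b - v a - (p * (b - a) + q * ((b ^+ 2 - a ^+ 2) / 2))| <= eta * (b - a).
Proof.
move=> ab dv bd.
pose w t := v t - (p * t + q * (t * t / 2)).
have dw t : a <= t <= b -> is_derive t (1 : R) w (phi t - (p + q * t)).
  move=> tab; have ? := dv _ tab; rewrite /w; apply: is_derive_eq.
  by rewrite /GRing.scale /=; lra.
have [||c cab ec] := @MVT_segment R w (fun t => phi t - (p + q * t)) a b ab.
- by move=> x /itvP xab; apply: dw; rewrite !xab.
- apply: derivable_within_continuous => t; rewrite in_itv /= => tab.
  by have [] := dw _ tab.
have -> : v b - v a - (p * (b - a) + q * ((b ^+ 2 - a ^+ 2) / 2)) = w b - w a.
  by rewrite /w; lra.
rewrite ec normrM (ger0_norm (_ : 0 <= b - a)) ?subr_ge0//.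
by rewrite ler_wpM2r ?subr_ge0// bd.
Qed.

Lemma antiderivative_ex (phi : R -> R) (a : R) : continuous phi ->
  exists F : R -> R, forall x, a < x -> is_derive x (1 : R) F (phi x).
Proof.
move=> cphi.
exists (fun x => \int[@lebesgue_measure R]_(t in [set` `[a, x]]) phi t)%R => x ax.
have xx1 : x < x + 1 by rewrite ltrDl.
have itg : (@lebesgue_measure R).-integrable `[a, (x + 1)] (EFin \o phi).
  apply: continuous_compact_integrable; first exact: segment_compact.
  by apply: continuous_subspaceT => ?; exact: cphi.
have [d e] := continuous_FTC1_closed xx1 itg ax (cphi x).
by split; [exact: d|rewrite -derive1E; exact: e].
Qed.

(** The derivative of a curve in the complex plane, by real and imaginary parts:
the plane is not a normed module over the real parameter here. *)
Definition cderiv (v : R -> C) (t : R) (d : C) : Prop :=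
  is_derive t (1 : R) (Re \o v) (Re d) /\ is_derive t (1 : R) (Im \o v) (Im d).

Lemma cderiv_antiderivative_ex (phi : R -> C) (a : R) :
  continuous (Re \o phi) -> continuous (Im \o phi) ->
  exists F : R -> C, forall x, a < x -> cderiv F x (phi x).
Proof.
move=> /(antiderivative_ex a)[F HF] /(antiderivative_ex a)[G HG].
by exists (fun x => (F x +i* G x)%C) => x ax; split; [exact: HF|exact: HG].
Qed.

Lemma cderiv_mean_value (v phi : R -> C) (a b : R) (p q : C) (eta : R) : a <= b ->
  (forall t, a <= t <= b -> cderiv v t (phi t)) ->
  (forall t, a <= t <= b -> n1 (phi t - (p + q * (t%:C)%C)) <= eta) ->
  n1 (v b - v a - (p * ((b - a)%:C)%C + q * (((b ^+ 2 - a ^+ 2) / 2)%:C)%C))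
    <= 2 * (eta * (b - a)).
Proof.
move=> ab dv bd; apply: n1_le; rewrite !ReImE /= !(mulr0, subr0, add0r, addr0).
- apply: (@mean_value_affine (Re \o v) (Re \o phi)) => // t tab.
    by have [] := dv _ tab.
  apply: le_trans (bd _ tab); apply: le_trans (n1_Re _).
  by rewrite !ReImE /= !(mulr0, subr0).
- apply: (@mean_value_affine (Im \o v) (Im \o phi)) => // t tab.
    by have [] := dv _ tab.
  apply: le_trans (bd _ tab); apply: le_trans (n1_Im _).
  by rewrite !ReImE /= !(mulr0, add0r).
Qed.

Lemma exists_half_pow (L d : R) : 0 < d -> exists n, L / 2 ^+ n < d.
Proof.
move=> d0; have Ld : 0 <= `|L| / d by rewrite divr_ge0// ltW.
exists (Num.truncn (`|L| / d)).+1; set n := _.+1.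
rewrite ltr_pdivrMr ?exprn_gt0//; apply: le_lt_trans (ler_norm _) _.
rewrite mulrC -ltr_pdivrMr//.
have /andP[_ h1] := truncn_itv Ld; apply: (lt_trans h1).
by rewrite -natrX ltr_nat ltn_expl.
Qed.

Lemma div_pow4S (x : R) n : x / 4 ^+ n = 4 * (x / 4 ^+ n.+1).
Proof. by rewrite exprS invfM [4 * _]mulrCA [4 * _]mulrA divff ?pnatr_eq0// mul1r. Qed.

Section Bisection.
Variables (Phi : R -> R -> R -> R -> C) (a b c d : R).
Hypotheses (ab : a <= b) (cd : c <= d).
Hypothesis split_h : forall s m s' t t', Phi s s' t t' = Phi s m t t' + Phi m s' t t'.
Hypothesis split_v : forall s s' t m t', Phi s s' t t' = Phi s s' t m + Phi s s' m t'.
Hypothesis local : forall s0 t0, a <= s0 <= b -> c <= t0 <= d ->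
  forall e, 0 < e -> exists2 r, 0 < r & forall s s' t t',
    a <= s <= s0 -> s0 <= s' <= b -> c <= t <= t0 -> t0 <= t' <= d ->
    (s' - s) + (t' - t) < r ->
    n1 (Phi s s' t t') <= e * ((s' - s) + (t' - t)) ^+ 2.

Let W n := (b - a) / 2 ^+ n.
Let H n := (d - c) / 2 ^+ n.
Let E := n1 (Phi a b c d).
Let good n (p : R * R) := [/\ a <= p.1, p.1 + W n <= b, c <= p.2, p.2 + H n <= d
  & E / 4 ^+ n <= n1 (Phi p.1 (p.1 + W n) p.2 (p.2 + H n))].
Let inside n (p q : R * R) := [/\ p.1 <= q.1, q.1 + W n.+1 <= p.1 + W n,
  p.2 <= q.2 & q.2 + H n.+1 <= p.2 + H n].

Let WS n : W n = W n.+1 + W n.+1.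
Proof.
rewrite /W exprS; have : (2 : R) ^+ n != 0 by rewrite expf_neq0.
by move=> ?; field.
Qed.
Let HS n : H n = H n.+1 + H n.+1.
Proof.
rewrite /H exprS; have : (2 : R) ^+ n != 0 by rewrite expf_neq0.
by move=> ?; field.
Qed.
Let W0 n : 0 <= W n. Proof. by rewrite divr_ge0 ?subr_ge0 ?exprn_ge0. Qed.
Let H0 n : 0 <= H n. Proof. by rewrite divr_ge0 ?subr_ge0 ?exprn_ge0. Qed.

Let quarter n p : exists q, good n p -> good n.+1 q /\ inside n p q.
Proof.
rewrite /good /inside.
have [[h1 h2 h3 h4 h5]|ng] := pselect (good n p); last by exists p.
pose P1 := Phi p.1 (p.1 + W n.+1) p.2 (p.2 + H n.+1).
pose P2 := Phi (p.1 + W n.+1) (p.1 + W n) p.2 (p.2 + H n.+1).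
pose P3 := Phi p.1 (p.1 + W n.+1) (p.2 + H n.+1) (p.2 + H n).
pose P4 := Phi (p.1 + W n.+1) (p.1 + W n) (p.2 + H n.+1) (p.2 + H n).
have eP : Phi p.1 (p.1 + W n) p.2 (p.2 + H n) = (P1 + P2) + (P3 + P4).
  rewrite (split_v _ _ _ (p.2 + H n.+1)) (split_h _ (p.1 + W n.+1)).
  by rewrite (split_h _ (p.1 + W n.+1) _ (p.2 + H n.+1)).
have e4 := div_pow4S E n.
move: (E / 4 ^+ n.+1) e4 h5 => E' -> h5.
have hw := WS n; have hh := HS n; have hw0 := W0 n.+1; have hh0 := H0 n.+1.
have := n1D (P1 + P2) (P3 + P4); have := n1D P1 P2; have := n1D P3 P4.
rewrite -eP => k1 k2 k3.
have [g1|g1] := lerP E' (n1 P1).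
  by exists (p.1, p.2) => _; split; split=> //=; lra.
have [g2|g2] := lerP E' (n1 P2).
  exists (p.1 + W n.+1, p.2) => _; split; split=> //=; rewrite -?addrA -?WS; lra.
have [g3|g3] := lerP E' (n1 P3).
  exists (p.1, p.2 + H n.+1) => _; split; split=> //=; rewrite -?addrA -?HS; lra.
have [g4|g4] := lerP E' (n1 P4).
  exists (p.1 + W n.+1, p.2 + H n.+1) => _; split; split=> //=;
  rewrite -?addrA -?WS -?HS; lra.
exfalso; move: h5; lra.
Qed.

(** Goursat's quartering. If the additive function Phi were nonzero on the
rectangle, one quarter would carry at least a quarter of its size, and so on
forever; around the common point of the nested rectangles this contradicts
the bound by an arbitrarily small multiple of the squared perimeter. *)
Lemma bisection_eq0 : Phi a b c d = 0.
Proof.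
apply: n1_eq0; rewrite leNgt; apply/negP => E0.
pose x := fix x n := if n is m.+1 then sval (cid (quarter m (x m))) else (a, c).
have g n : good n (x n).
  elim: n => [|n IH].
    have eW : a + W 0 = b by rewrite /W expr0 divr1 addrC subrK.
    have eH : c + H 0 = d by rewrite /H expr0 divr1 addrC subrK.
    by rewrite /good /= eW eH expr0 divr1.
  by have [] := svalP (cid (quarter n (x n))) IH.
have ins n : inside n (x n) (x n.+1).
  by have [] := svalP (cid (quarter n (x n))) (g n).
have nest n m : [/\ (x n).1 <= (x (n + m)%N).1,
   (x (n + m)%N).1 + W (n + m)%N <= (x n).1 + W n, (x n).2 <= (x (n + m)%N).2 &
   (x (n + m)%N).2 + H (n + m)%N <= (x n).2 + H n].
  elim: m => [|m [i1 i2 i3 i4]]; first by rewrite addn0; split; exact: lexx.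
  rewrite addnS; have [j1 j2 j3 j4] := ins (n + m)%N; split; lra.
have ub1 n m : (x m).1 <= (x n).1 + W n.
  have [nm|/ltnW mn] := leqP n m.
    have [_ + _ _] := nest n (m - n)%N; rewrite subnKC//; have := W0 m; lra.
  have [+ _ _ _] := nest m (n - m)%N; rewrite subnKC//; have := W0 n; lra.
have ub2 n m : (x m).2 <= (x n).2 + H n.
  have [nm|/ltnW mn] := leqP n m.
    have [_ _ _] := nest n (m - n)%N; rewrite subnKC//; have := H0 m; lra.
  have [_ _ + _] := nest m (n - m)%N; rewrite subnKC//; have := H0 n; lra.
pose S1 := [set (x n).1 | n in [set: nat]]; pose S2 := [set (x n).2 | n in [set: nat]].
have s1 n : (x n).1 <= sup S1 <= (x n).1 + W n.
  apply/andP; split.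
    apply: ub_le_sup; last by exists n.
    by exists ((x 0%N).1 + W 0) => _ [m _ <-].
  by apply: ge_sup => [|_ [m _ <-]]; [exists (x 0%N).1, 0%N | exact: ub1].
have s2 n : (x n).2 <= sup S2 <= (x n).2 + H n.
  apply/andP; split.
    apply: ub_le_sup; last by exists n.
    by exists ((x 0%N).2 + H 0) => _ [m _ <-].
  by apply: ge_sup => [|_ [m _ <-]]; [exists (x 0%N).2, 0%N | exact: ub2].
pose L := (b - a) + (d - c).
have L0 : 0 <= L by rewrite addr_ge0 ?subr_ge0.
pose e := E / (2 * (L ^+ 2 + 1)).
have L2 : 0 < L ^+ 2 + 1 by rewrite ltr_wpDl ?sqr_ge0.
have e0 : 0 < e by rewrite divr_gt0// mulr_gt0.
have sI : a <= sup S1 <= b.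
  have [g1 g2 _ _ _] := g 0%N; have /andP[? ?] := s1 0%N; apply/andP; split; lra.
have tI : c <= sup S2 <= d.
  have [_ _ g1 g2 _] := g 0%N; have /andP[? ?] := s2 0%N; apply/andP; split; lra.
have [r r0 Hr] := local sI tI e0.
have [n hn] := exists_half_pow L r0.
have [g1 g2 g3 g4 g5] := g n; have k1 := s1 n; have k2 := s2 n.
have LE : (x n).1 + W n - (x n).1 + ((x n).2 + H n - (x n).2) = L / 2 ^+ n.
  by rewrite /W /H /L; lra.
have := Hr (x n).1 ((x n).1 + W n) (x n).2 ((x n).2 + H n).
rewrite LE => /(_ _ _ _ _ hn) HH.
have {HH} : E / 4 ^+ n <= e * (L / 2 ^+ n) ^+ 2.
  by case/andP: k1 => ? ?; case/andP: k2 => ? ?; apply: (le_trans g5); apply: HH; apply/andP; split.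
apply/negP; rewrite -ltNge expr_div_n -exprM mulnC exprM (_ : 2 ^+ 2 = 4); last by ring.
rewrite mulrA ltr_pM2r ?invr_gt0 ?exprn_gt0//.
rewrite /e mulrAC ltr_pdivrMr ?mulr_gt0// ltr_pM2l//.
by have := sqr_ge0 L; lra.
Qed.

End Bisection.

End RealCalculus.

(** * Goursat's theorem and circle integrals *)

Section Cauchy.
Variable R : realType.
Local Notation C := (Cx R).
Local Notation Re := (@complex.Re R).
Local Notation Im := (@complex.Im R).
Local Notation "''i'" := (Complex 0 1 : C).

Lemma n1_iM (z : C) : n1 ('i * z) = n1 z.
Proof. by rewrite /n1 !ReImE /= !mul0r !mul1r !add0r normrN addrC. Qed.

(** Cauchy's theorem for a rectangle. The integral of F along a vertical or a
horizontal side is an increment of an antiderivative V s or H t, so the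
boundary integral is additive under subdivision for purely algebraic
reasons. Near each point F is affine up to a small multiple of the size, and
the boundary integral of an affine function is zero: bisection_eq0 applies. *)
Lemma goursat (F : C -> C) (V H : R -> R -> C) (a b c d : R) : a <= b -> c <= d ->
  (forall s t, a <= s <= b -> c <= t <= d -> exists D, cdiff F (s +i* t)%C D) ->
  (forall s t, a <= s <= b -> c <= t <= d -> cderiv (V s) t (F (s +i* t)%C)) ->
  (forall s t, a <= s <= b -> c <= t <= d -> cderiv (H t) s (F (s +i* t)%C)) ->
  'i * (V b d - V b c - (V a d - V a c)) = H d b - H d a - (H c b - H c a).
Proof.
move=> ab cd dF dV dH.
pose Phi s s' t t' := 'i * (V s' t' - V s' t - (V s t' - V s t))
  - (H t' s' - H t' s - (H t s' - H t s)).
suff : Phi a b c d = 0 by rewrite /Phi => /subr0_eq.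
apply: (@bisection_eq0 R Phi a b c d ab cd) => [s m s' t t'|s s' t m t'|].
- by rewrite /Phi; ring.
- by rewrite /Phi; ring.
move=> s0 t0 s0I t0I e e0.
have [D dD] := dF _ _ s0I t0I; set z0 : C := (s0 +i* t0)%C in dD.
have [|r r0 Hr] := dD (e / 4); first lra.
exists r => // s s' t t' sI s'I tI t'I lr.
set l := (s' - s) + (t' - t) in lr *.
have near_affine x y : s <= x <= s' -> t <= y <= t' ->
    n1 (F (x +i* y)%C - (F z0 + ((x +i* y)%C - z0) * D)) <= e / 4 * l.
  move=> xI yI.
  have hl : n1 ((x +i* y)%C - z0) <= l.
    rewrite /n1 /z0 !ReImE /= /l.
    by case: (lerP 0 (x - s0)) => h1; case: (lerP 0 (y - t0)) => h2;
      rewrite ?(ger0_norm h1) ?(ltr0_norm h1) ?(ger0_norm h2) ?(ltr0_norm h2); lra.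
  have := Hr _ (le_lt_trans hl lr); rewrite [z0 + _]addrC subrK => h1.
  rewrite opprD addrA; apply: (le_trans h1); rewrite ler_wpM2l//; lra.
have eV x : s <= x <= s' -> n1 (V x t' - V x t - ((F z0 + ((x +i* 0)%C - z0) * D)
    * ((t' - t)%:C)%C + 'i * D * (((t' ^+ 2 - t ^+ 2) / 2)%:C)%C)) <= 2 * (e / 4 * l * (t' - t)).
  move=> xI; apply: (@cderiv_mean_value R (V x) (fun y => F (x +i* y)%C)); first lra.
    by move=> y yI; apply: dV; lra.
  move=> y yI; have := near_affine x y xI yI; congr (n1 (_ - _) <= _).
  by rewrite (_ : (x +i* y)%C = (x +i* 0)%C + 'i * (y%:C)%C); [ring|
    apply: eqC; rewrite !ReImE /=; ring].
have eH y : t <= y <= t' -> n1 (H y s' - H y s - ((F z0 + ('i * (y%:C)%C - z0) * D)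
    * ((s' - s)%:C)%C + D * (((s' ^+ 2 - s ^+ 2) / 2)%:C)%C)) <= 2 * (e / 4 * l * (s' - s)).
  move=> yI; apply: (@cderiv_mean_value R (H y) (fun x => F (x +i* y)%C)); first lra.
    by move=> x xI; apply: dH; lra.
  move=> x xI; have := near_affine x y xI yI; congr (n1 (_ - _) <= _).
  by rewrite (_ : (x +i* y)%C = (x%:C)%C + 'i * (y%:C)%C); [ring|
    apply: eqC; rewrite !ReImE /=; ring].
have ss' : s <= s' by lra.
have tt' : t <= t' by lra.
have h1 := eV s' (_ : s <= s' <= s'); rewrite ss' lexx in h1; have {}h1 := h1 isT.
have h2 := eV s (_ : s <= s <= s'); rewrite ss' lexx in h2; have {}h2 := h2 isT.
have h3 := eH t' (_ : t <= t' <= t'); rewrite tt' lexx in h3; have {}h3 := h3 isT.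
have h4 := eH t (_ : t <= t <= t'); rewrite tt' lexx in h4; have {}h4 := h4 isT.
move: h1 h2 h3 h4.
(* The four sides, each minus the integral of the affine approximation: these
   errors alone make up Phi. *)
set X1 := (X in n1 X <= _); set X2 := (X in _ -> n1 X <= _ -> _).
set X3 := (X in _ -> _ -> n1 X <= _ -> _); set X4 := (X in _ -> _ -> _ -> n1 X <= _ -> _).
move=> h1 h2 h3 h4.
have -> : Phi s s' t t' = 'i * (X1 - X2) - (X3 - X4).
  rewrite /Phi /X1 /X2 /X3 /X4.
  rewrite (_ : ((s' - s)%:C)%C = (s' +i* 0)%C - (s +i* 0)%C :> C); last first.
    by apply: eqC; rewrite !ReImE /= ?oppr0 ?addr0.
  rewrite (_ : ((t' - t)%:C)%C = (t'%:C)%C - (t%:C)%C :> C); last first.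
    by apply: eqC; rewrite !ReImE /= ?oppr0 ?addr0.
  by ring.
have k1 := n1B ('i * (X1 - X2)) (X3 - X4); have k2 := n1B X1 X2; have k3 := n1B X3 X4.
rewrite n1_iM in k1; apply: (le_trans k1).
have : e * l ^+ 2 = 2 * (2 * (e / 4 * l * (t' - t))) + 2 * (2 * (e / 4 * l * (s' - s))).
  by rewrite /l; field.
lra.
Qed.

Definition cexp (w : C) : C := ((expR (Re w) * cos (Im w)) +i* (expR (Re w) * sin (Im w)))%C.

Lemma cexpD w h : cexp (w + h) = cexp w * cexp h.
Proof.
by apply: eqC; rewrite !ReImE /= !ReImE expRD ?cosD ?sinD; ring.
Qed.

(** The derivative of the exponential at 0, from those of exp, cos and sin at 0. *)
Lemma cexp_at0 (e : R) : 0 < e ->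
  exists2 r : R, 0 < r & forall h, n1 h < r -> n1 (cexp h - 1 - h) <= e * n1 h.
Proof.
move=> e0; have [m [m0 m1 m2]] : exists m : R, [/\ 0 < m, m <= e / 8 & m <= 1].
  (* e / 8 leaves room for the products of the three real estimates, where exp is
     bounded by 3. *)
  exists (Num.min (e / 8) 1); rewrite lt_min ltr01 andbT !ge_min !lexx orbT.
  by split=> //; lra.
have /is_deriveR/(_ _ m0)[r1 r10 H1] : is_derive (0 : R) (1 : R) expR 1.
  by apply: is_derive_eq; rewrite expR0.
have /is_deriveR/(_ _ m0)[r2 r20 H2] : is_derive (0 : R) (1 : R) cos 0.
  by apply: is_derive_eq; rewrite sin0 oppr0.
have /is_deriveR/(_ _ m0)[r3 r30 H3] : is_derive (0 : R) (1 : R) sin 1.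
  by apply: is_derive_eq; rewrite cos0.
exists (Num.min (Num.min r1 r2) (Num.min r3 m)).
  by rewrite !lt_min r10 r20 r30 m0.
move=> h; rewrite !lt_min => /andP[/andP[h1 h2] /andP[h3 h4]].
have := H1 (Re h) (le_lt_trans (n1_Re h) h1).
have := H2 (Im h) (le_lt_trans (n1_Im h) h2).
have := H3 (Im h) (le_lt_trans (n1_Im h) h3).
rewrite !add0r sin0 cos0 expR0 !mulr1 mulr0 !subr0.
have := le_lt_trans (n1_Re h) h4; have := le_lt_trans (n1_Im h) h4.
rewrite /n1 !ReImE /= subr0 => ym xm.
set x := Re h in xm *; set y := Im h in ym *.
set E := expR x; set c := cos y; set s := sin y => k3 k2 k1.
have := normr_ge0 x; have := normr_ge0 y => y0 x0.
have kE : `|E - 1| <= 2 * `|x|.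
  rewrite (_ : E - 1 = (E - 1 - x) + x); last by ring.
  apply: (le_trans (ler_normD _ _)); nra.
have kE3 : `|E| <= 3.
  rewrite (_ : E = (E - 1) + 1); last by ring.
  apply: (le_trans (ler_normD _ _)); rewrite normr1; lra.
have a1 : `|E * c - 1 - x| <= `|E - 1 - x| + `|E| * `|c - 1|.
  by rewrite -normrM (le_trans _ (ler_normD _ _))// le_eqVlt; apply/orP; left;
    apply/eqP; congr (`|_|); ring.
have a2 : `|E * s - y| <= `|E| * `|s - y| + `|E - 1| * `|y|.
  by rewrite -!normrM (le_trans _ (ler_normD _ _))// le_eqVlt; apply/orP; left;
    apply/eqP; congr (`|_|); ring.
have b1 : `|E| * `|c - 1| <= 3 * (m * `|y|) by apply: ler_pM.
have b2 : `|E| * `|s - y| <= 3 * (m * `|y|) by apply: ler_pM.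
have b3 : `|E - 1| * `|y| <= 2 * m * `|y|.
  by apply: ler_wpM2r => //; apply: (le_trans kE); rewrite ler_pM2l// ltW.
have b4 : m * `|y| <= e / 8 * `|y| by apply: ler_wpM2r.
have b5 : m * `|x| <= e / 8 * `|x| by apply: ler_wpM2r.
have b6 := mulr_ge0 (ltW e0) x0.
lra.
Qed.

Lemma cdiff_cexp w : cdiff cexp w (cexp w).
Proof.
move=> e e0; have N0 : 0 < n1 (cexp w) + 1 by rewrite ltr_wpDl ?n1_ge0.
have [|r r0 H] := @cexp_at0 (e / (n1 (cexp w) + 1)); first by rewrite divr_gt0.
exists r => // h /H hr; rewrite cexpD.
rewrite (_ : _ - _ - _ = cexp w * (cexp h - 1 - h)); last by ring.
apply: (le_trans (n1M _ _)); apply: (@le_trans _ _ ((n1 (cexp w) + 1) * n1 (cexp h - 1 - h))).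
  by rewrite ler_wpM2r ?n1_ge0// lerDl.
rewrite mulrC -ler_pdivlMr// (le_trans hr)// mulrAC le_eqVlt; apply/orP; left; apply/eqP.
by [].
Qed.

Definition ccont (phi : R -> C) := forall t e, 0 < e ->
  exists2 r : R, 0 < r & forall u, `|u - t| < r -> n1 (phi u - phi t) <= e.

Lemma ccont_continuous phi : ccont phi ->
  continuous (Re \o phi) /\ continuous (Im \o phi).
Proof.
move=> cp; split=> t; apply/cvgrPdist_le => e e0; have [r r0 H] := cp t e e0;
  apply/nbhs_ballP; exists r => // u; rewrite /ball /= distrC => /H; apply: le_trans.
- by rewrite distrC; apply: le_trans (n1_Re _); rewrite !ReImE.
- by rewrite distrC; apply: le_trans (n1_Im _); rewrite !ReImE.
Qed.

Lemma cdiff_locally_lipschitz f z D : cdiff f z D ->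
  exists2 r : R, 0 < r & forall h, n1 h < r -> n1 (f (z + h) - f z) <= (n1 D + 1) * n1 h.
Proof.
move=> /(_ 1 ltr01)[r r0 H]; exists r => // h hr; have := H h hr; rewrite mul1r => k.
rewrite (_ : f (z + h) - f z = (f (z + h) - f z - h * D) + h * D); last by ring.
apply: (le_trans (n1D _ _)); have := n1M h D; lra.
Qed.

Lemma ccont_comp (f : C -> C) (g : R -> C) :
  ccont g -> (forall t, exists D, cdiff f (g t) D) -> ccont (f \o g).
Proof.
move=> cg df t e e0; have [D /cdiff_locally_lipschitz [r r0 Hr]] := df t.
have D0 : 0 < n1 D + 1 by rewrite ltr_wpDl ?n1_ge0.
have m0 : 0 < Num.min (r / 2) (e / (n1 D + 1)) by rewrite lt_min !divr_gt0.
have [r' r'0 Hr'] := cg t _ m0; exists r' => // u /Hr'; rewrite le_min => /andP[h1 h2].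
have := Hr (g u - g t); rewrite (_ : g t + (g u - g t) = g u); last by ring.
move=> k.
apply: le_trans (k _) _; first by apply: (le_lt_trans h1); lra.
by rewrite mulrC -ler_pdivlMr.
Qed.

Lemma cderiv_sub (v w : R -> C) (t : R) (dv dw : C) : cderiv v t dv -> cderiv w t dw ->
  cderiv (fun u => v u - w u) t (dv - dw).
Proof.
move=> [a1 a2] [b1 b2]; split.
  rewrite (_ : _ \o _ = (Re \o v) - (Re \o w)); last by apply/funext => u; rewrite /= !ReImE.
  by rewrite !ReImE; apply: is_deriveB.
rewrite (_ : _ \o _ = (Im \o v) - (Im \o w)); last by apply/funext => u; rewrite /= !ReImE.
by rewrite !ReImE; apply: is_deriveB.
Qed.

Lemma cderiv_bound (v phi : R -> C) (a b eta : R) : a <= b ->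
  (forall t, a <= t <= b -> cderiv v t (phi t)) ->
  (forall t, a <= t <= b -> n1 (phi t) <= eta) -> n1 (v b - v a) <= 2 * (eta * (b - a)).
Proof.
move=> ab dv bd; have := @cderiv_mean_value R v phi a b 0 0 eta ab dv.
by rewrite !mul0r add0r subr0; apply=> t tI; rewrite mul0r addr0 subr0; exact: bd.
Qed.

Lemma cderiv_uniq (v w phi : R -> C) (a b : R) : a <= b ->
  (forall t, a <= t <= b -> cderiv v t (phi t)) ->
  (forall t, a <= t <= b -> cderiv w t (phi t)) -> v b - v a = w b - w a.
Proof.
move=> ab dv dw; have := @cderiv_bound (fun u => v u - w u) (fun t => phi t - phi t) a b 0 ab.
rewrite mul0r mulr0 => H; have {H} : n1 (v b - w b - (v a - w a)) <= 0.
  by apply: H => t tI; [apply: cderiv_sub; [exact: dv|exact: dw]|rewrite subrr n10].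
by move/n1_eq0 => H; apply/eqP; rewrite -subr_eq0 -[X in _ == X]H; apply/eqP; ring.
Qed.

Lemma ccont_antiderivative (phi : R -> C) (a : R) : ccont phi ->
  exists F, forall x, a < x -> cderiv F x (phi x).
Proof. by move=> /ccont_continuous[]; exact: cderiv_antiderivative_ex. Qed.

Let tau : R := pi *+ 2.
Let tau_gt0 : 0 < tau. Proof. by rewrite pmulrn_lgt0 ?pi_gt0. Qed.

(** The integral over [0, 2 pi]. It is made total so that its linearity can be
used without naming antiderivatives; the antiderivative starts at -1 because
differentiability is needed at the endpoint 0 too. *)
Definition circ (phi : R -> C) : C :=
  if pselect (ccont phi) is left h then
    let F := sval (cid (ccont_antiderivative (- 1) h)) in F tau - F 0
  else 0.

Lemma circE phi F : ccont phi -> (forall t, 0 <= t <= tau -> cderiv F t (phi t)) ->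
  circ phi = F tau - F 0.
Proof.
move=> cp dF; rewrite /circ; case: pselect => // h.
case: cid => G /= dG; apply: (@cderiv_uniq G F phi) => //; first exact: ltW.
move=> t /andP[t0 _]; apply: dG; lra.
Qed.

Lemma circ_ex phi : ccont phi -> exists2 F, (forall t, 0 <= t <= tau -> cderiv F t (phi t)) &
  circ phi = F tau - F 0.
Proof.
move=> cp; have [F dF] := ccont_antiderivative (- 1) cp.
have dF' t : 0 <= t <= tau -> cderiv F t (phi t).
  by move=> /andP[t0 _]; apply: dF; lra.
by exists F => //; exact: circE.
Qed.

Lemma circ_bound phi eta : ccont phi -> (forall t, n1 (phi t) <= eta) ->
  n1 (circ phi) <= 2 * (eta * tau).
Proof.
move=> /circ_ex[F dF ->] b; have := @cderiv_bound F phi 0 tau eta (ltW tau_gt0) dF.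
by rewrite subr0; apply=> t _; exact: b.
Qed.

Lemma ccont_sub phi psi : ccont phi -> ccont psi -> ccont (fun t => phi t - psi t).
Proof.
move=> c1 c2 t e e0; have e2 : 0 < e / 2 by lra.
have [r1 r10 H1] := c1 t _ e2; have [r2 r20 H2] := c2 t _ e2.
exists (Num.min r1 r2); first by rewrite lt_min r10.
move=> u; rewrite lt_min => /andP[/H1 k1 /H2 k2].
rewrite (_ : _ - _ = (phi u - phi t) - (psi u - psi t)); last by ring.
by apply: (le_trans (n1B _ _)); lra.
Qed.

Lemma circ_sub phi psi : ccont phi -> ccont psi ->
  circ (fun t => phi t - psi t) = circ phi - circ psi.
Proof.
move=> c1 c2; have [F dF ->] := circ_ex c1; have [G dG ->] := circ_ex c2.
rewrite (@circE _ (fun u => F u - G u)); [by ring|exact: ccont_sub|].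
by move=> t tI; apply: cderiv_sub; [exact: dF|exact: dG].
Qed.

Lemma ccont_scale (c : C) phi : ccont phi -> ccont (fun t => c * phi t).
Proof.
move=> c1 t e e0; have c0 : 0 < n1 c + 1 by rewrite ltr_wpDl ?n1_ge0.
have [|r1 r10 H1] := c1 t (e / (n1 c + 1)); first by rewrite divr_gt0.
exists r1 => // u /H1; rewrite ler_pdivlMr// => k1; rewrite -mulrBr.
apply: (le_trans (n1M _ _)); apply: le_trans k1; rewrite mulrC ler_wpM2l ?n1_ge0//; lra.
Qed.

Lemma cderiv_scale (c : C) (v : R -> C) (t : R) (dv : C) : cderiv v t dv -> cderiv (fun u => c * v u) t (c * dv).
Proof.
move=> [a1 a2]; split.
  rewrite (_ : _ \o _ = (Re c *: (Re \o v)) - (Im c *: (Im \o v))); last first.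
    by apply/funext => u; rewrite /= !ReImE.
  by rewrite !ReImE; apply: is_deriveB.
rewrite (_ : _ \o _ = (Re c *: (Im \o v)) + (Im c *: (Re \o v))); last first.
  by apply/funext => u; rewrite /= !ReImE.
by rewrite !ReImE; apply: is_deriveD.
Qed.

Lemma circ_scale (c : C) phi : ccont phi -> circ (fun t => c * phi t) = c * circ phi.
Proof.
move=> c1; have [F dF ->] := circ_ex c1.
rewrite (@circE _ (fun u => c * F u)); [by ring|exact: ccont_scale|].
by move=> t tI; apply: cderiv_scale; exact: dF.
Qed.

Lemma ccont_cst (c : C) : ccont (fun=> c).
Proof. by move=> t e e0; exists 1 => // u _; rewrite subrr n10 ltW. Qed.

Lemma circ_cst (c : C) : circ (fun=> c) = c * (tau%:C)%C.
Proof.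
rewrite (@circE _ (fun t => c * (t%:C)%C)); [by rewrite mulr0 subr0|exact: ccont_cst|].
move=> t _; rewrite -[X in cderiv _ _ X]mulr1; apply: cderiv_scale; split=> /=.
  exact: is_derive_id.
exact: is_derive_cst.
Qed.

End Cauchy.

(** * The mean value property and its consequences *)

Section CauchyConsequences.
Variable R : realType.
Local Notation C := (Cx R).
Local Notation Re := (@complex.Re R).
Local Notation Im := (@complex.Im R).
Local Notation tau := (pi *+ 2 : R).
Local Notation tauC := (((pi *+ 2 : R)%:C)%C : C).

Lemma tau_gt0 : 0 < tau. Proof. by rewrite pmulrn_lgt0 ?pi_gt0. Qed.
Lemma tauC_neq0 : tauC != 0.
Proof. by rewrite -[0 : C]/((0:R)%:C)%C; apply/eqP => -[] /eqP; rewrite gt_eqF// tau_gt0. Qed.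

Definition polar (s t : R) : C := cexp (s +i* t)%C.

Lemma cexp0 : cexp (0 : C) = 1.
Proof. by apply: eqC; rewrite /= ?expR0 ?cos0 ?sin0 ?mulr1 ?mulr0. Qed.

Lemma polar_inv s t : polar s t * polar (- s) (- t) = 1.
Proof.
rewrite /polar -cexpD -cexp0; congr cexp.
by apply: eqC; rewrite !ReImE /= subrr.
Qed.

Lemma polar_neq0 s t : polar s t != 0.
Proof.
apply/eqP => h; have := polar_inv s t; rewrite h mul0r => /eqP.
by rewrite eq_sym oner_eq0.
Qed.

Lemma n1_polar s t : n1 (polar s t) <= 2 * expR s.
Proof.
apply: n1_le; rewrite /= normrM (ger0_norm (expR_ge0 s)) ler_piMr ?expR_ge0//.
  exact: cos_max.
exact: sin_max.
Qed.

Lemma n1_polar_ge s t : expR s <= n1 (polar s t).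
Proof.
rewrite /n1 /= !normrM (ger0_norm (expR_ge0 s)) -mulrDr ler_peMr ?expR_ge0//.
have := cos2Dsin2 t; have := cos_max t; have := sin_max t.
rewrite -(real_normK (num_real (cos t))) -(real_normK (num_real (sin t))).
have := normr_ge0 (cos t); have := normr_ge0 (sin t); nra.
Qed.

Lemma ccont_polar s : ccont (polar s).
Proof.
apply: (@ccont_comp R (@cexp R) (fun t => (s +i* t)%C)) => [t e e0|t]; last first.
  by exists (cexp (s +i* t)%C); exact: cdiff_cexp.
exists e => // u ue; rewrite /n1 !ReImE /= subrr normr0 add0r; exact: ltW.
Qed.

Lemma cdiff_ex_derivable (f : C -> C) z :
  (exists D, cdiff f z D) <-> derivable f z (1 : C).
Proof.
split=> [[D /is_derive1_cdiff[]]//|df].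
by exists ('D_(1 : C) f z); apply/is_derive1_cdiff; split.
Qed.

Lemma cdiff_cont (f : C -> C) z D e : cdiff f z D -> 0 < e ->
  exists2 r : R, 0 < r & forall h, n1 h < r -> n1 (f (z + h) - f z) <= e.
Proof.
move=> /cdiff_locally_lipschitz [r r0 Hr] e0.
have D0 : 0 < n1 D + 1 by rewrite ltr_wpDl ?n1_ge0.
exists (Num.min r (e / (n1 D + 1))); first by rewrite lt_min r0 divr_gt0.
move=> h; rewrite lt_min => /andP[h1 h2]; apply: le_trans (Hr _ h1) _.
by rewrite mulrC -ler_pdivlMr// ltW.
Qed.

Lemma cdiff_shift (f : C -> C) a z D : cdiff f (a + z) D -> cdiff (fun w => f (a + w)) z D.
Proof. by move=> df e /df[r r0 H]; exists r => // h /H; rewrite addrA. Qed.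

Lemma cdiff_sub (f g : C -> C) z Df Dg : cdiff f z Df -> cdiff g z Dg ->
  cdiff (fun w => f w - g w) z (Df - Dg).
Proof.
by move=> /is_derive1_cdiff ? /is_derive1_cdiff ?; apply/is_derive1_cdiff.
Qed.

Lemma cdiff_lin (c z : C) : cdiff (fun w => w * c) z c.
Proof.
move=> e e0; exists 1 => // h _; rewrite (_ : _ - _ - _ = 0); last by ring.
by rewrite n10 mulr_ge0 ?n1_ge0 ?ltW.
Qed.

Lemma cdiff_near (f g : C -> C) z D (r : R) : 0 < r ->
  (forall h, n1 h < r -> f (z + h) = g (z + h)) -> cdiff f z D -> cdiff g z D.
Proof.
move=> r0 fg df e /df[r1 r10 H]; exists (Num.min r r1); first by rewrite lt_min r0.
move=> h; rewrite lt_min => /andP[h1 h2].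
have := fg 0; rewrite n10 addr0 => /(_ r0) <-; rewrite -fg//; exact: H.
Qed.

Section MeanValueProperty.
Variables (f : C -> C) (s1 : R).
Hypothesis df : forall s t, s <= s1 -> exists D, cdiff f (polar s t) D.

Let ccont_f s : s <= s1 -> ccont (fun t => f (polar s t)).
Proof. by move=> ss1; apply: ccont_comp (ccont_polar s) _ => t; exact: df. Qed.

Let circ_const s0 : s0 <= s1 ->
  circ (fun t => f (polar s0 t)) = circ (fun t => f (polar s1 t)).
Proof.
move=> s01; pose F (w : C) := f (cexp w).
have dF s t : s <= s1 -> exists D, cdiff F (s +i* t)%C D.
  move=> ss1; have [D dD] := df t ss1; apply/cdiff_ex_derivable/derivable1_diffP.
  apply: differentiable_comp; apply/derivable1_diffP/cdiff_ex_derivable.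
    by exists (cexp (s +i* t)%C); exact: cdiff_cexp.
  by exists D.
have exV s : exists V, s <= s1 -> forall x, -1 < x -> cderiv V x (F (s +i* x)%C).
  have [ss1|ns] := lerP s s1; last by exists (fun=> 0).
  by have [V HV] := ccont_antiderivative (-1) (ccont_f ss1); exists V.
(* The horizontal integrand is frozen beyond s1, where f is unknown, so that an
   antiderivative is available around the endpoint s1. *)
have exH t : exists H, forall x, s0 - 1 < x -> cderiv H x (F ((Num.min x s1) +i* t)%C).
  apply: (@ccont_antiderivative R (fun x => F ((Num.min x s1) +i* t)%C)).
  apply: (@ccont_comp R F (fun x => ((Num.min x s1) +i* t)%C)) => [x e e0|x]; last first.
    by apply: dF; rewrite ge_min lexx orbT.
  exists e => // u ue; rewrite /n1 !ReImE /= subrr normr0 addr0.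
  have {}ue := ltW ue; apply: le_trans ue.
  by case: (lerP u s1) => h1; case: (lerP x s1) => h2;
    rewrite ler_norml; case: (lerP 0 (u - x)) => h3;
    rewrite ?(ger0_norm h3) ?(ltr0_norm h3); apply/andP; split; lra.
pose V s := sval (cid (exV s)); pose H t := sval (cid (exH t)).
have HV s : s <= s1 -> forall x, -1 < x -> cderiv (V s) x (F (s +i* x)%C).
  exact: (svalP (cid (exV s))).
have HH t x : s0 - 1 < x -> cderiv (H t) x (F ((Num.min x s1) +i* t)%C).
  exact: (svalP (cid (exH t))).
have circV s : s <= s1 -> circ (fun t => f (polar s t)) = V s tau - V s 0.
  move=> ss1; apply: circE; first exact: ccont_f.
  by move=> t /andP[t0 _]; apply: HV => //; lra.
rewrite !circV//.
have := @goursat R F V H s0 s1 0 tau s01 (ltW tau_gt0).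
rewrite (@cderiv_uniq R (H tau) (H 0) (fun x => F ((Num.min x s1) +i* 0)%C) s0 s1 s01).
- rewrite subrr => G; have {G} /eqP : ('i%C : C) * (V s1 tau - V s1 0 - (V s0 tau - V s0 0)) = 0.
    apply: G => s t /andP[a1 a2] /andP[b1 b2].
    + exact: dF.
    + by apply: HV => //; lra.
    + have := HH t s; rewrite (min_idPl a2); apply; lra.
  rewrite mulf_eq0 => /orP[/eqP[] /eqP|]; first by rewrite oner_eq0.
  by rewrite subr_eq0 eq_sym => /eqP.
- move=> t /andP[a1 a2]; have := HH tau t; rewrite (_ : F _ = F (Num.min t s1 +i* 0)%C).
    by apply; lra.
  rewrite /F /cexp /=; congr f; rewrite -(add0r tau) cosD2pi sinD2pi.
  by [].
- by move=> t /andP[a1 a2]; apply: HH; lra.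
Qed.

(** In the coordinate w = s + i t with z = exp w, the means over circles are
integrals over vertical segments. By goursat two of them differ by the
integrals over the horizontal sides, which cancel by periodicity; so the mean
does not depend on the radius, and letting s tend to minus infinity leaves
f 0. At the centre only continuity is assumed, since the lemma serves for
difference quotients completed at the centre. *)
Lemma mean_value_property :
  (forall e : R, 0 < e -> exists2 r : R, 0 < r & forall z, n1 z < r -> n1 (f z - f 0) <= e) ->
  circ (fun t => f (polar s1 t)) = f 0 * tauC.
Proof.
move=> cf; apply/eqP; rewrite -subr_eq0; apply/eqP/n1_eq0; rewrite leNgt; apply/negP.
set d := n1 _ => d0.
have T0 := tau_gt0.
pose e := d / (4 * tau); have e0 : 0 < e by rewrite divr_gt0// mulr_gt0.
have [r r0 Hr] := cf e e0.
pose s0 := Num.min s1 (ln (r / 4)).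
have s01 : s0 <= s1 by rewrite ge_min lexx.
have es0 : expR s0 <= r / 4.
  by rewrite -[leRHS]lnK ?posrE ?divr_gt0// ler_expR ge_min lexx orbT.
have : d <= 2 * (e * tau).
  rewrite /d -(circ_const s01) -circ_cst -circ_sub; [|exact: ccont_f|exact: ccont_cst].
  apply: circ_bound; first by apply: ccont_sub; [exact: ccont_f|exact: ccont_cst].
  by move=> t; apply: Hr; apply: (le_lt_trans (n1_polar _ _)); lra.
apply/negP; rewrite -ltNge /e.
rewrite (_ : 2 * _ = d / 2); first lra.
by move: (pi *+ 2 : R) T0 => T T0; field; rewrite gt_eqF.
Qed.

End MeanValueProperty.

(** The bound is 2 and not 1 because n1 may exceed the modulus by sqrt 2. *)
Lemma n1V (h : C) : n1 h * n1 h^-1 <= 2.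
Proof.
case: h => x y; rewrite /n1 /=.
have [e|ne] := eqVneq (x ^+ 2 + y ^+ 2) 0.
  by rewrite e !invr0 !mulr0 oppr0 normr0 addr0 mulr0.
have p : 0 < x ^+ 2 + y ^+ 2 by rewrite lt_neqAle eq_sym ne addr_ge0 ?sqr_ge0.
rewrite !normrM normrN normrM normfV (gtr0_norm p) -mulrDl mulrA ler_pdivrMr//.
rewrite -(real_normK (num_real x)) -(real_normK (num_real y)).
have := sqr_ge0 (`|x| - `|y|); nra.
Qed.

Definition circle_slope (f : C -> C) (z0 : C) (s t : R) : C :=
  (f (z0 + polar s t) - f z0) / polar s t.

(** Cauchy's formula for the derivative: the difference quotient of f at z0,
completed by the derivative, has the mean value property. *)
Lemma derivative_circle (f : C -> C) (z0 D : C) (s : R) :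
  (forall z, n1 (z - z0) <= 2 * expR s -> exists D, cdiff f z D) ->
  cdiff f z0 D -> D * tauC = circ (circle_slope f z0 s).
Proof.
move=> df dz0.
pose g z : C := if z == 0 then D else (f (z0 + z) - f z0) / z.
have -> : circle_slope f z0 s = (fun t => g (polar s t)).
  by apply/funext => t; rewrite /g (negbTE (polar_neq0 _ _)).
have {1}-> : D = g 0 by rewrite /g eqxx.
symmetry; apply: mean_value_property => [s' t ss'|e e0].
  set z := polar s' t; have z0' : z != 0 by exact: polar_neq0.
  have [|D' dD'] := df (z0 + z).
    rewrite addrC addKr (le_trans (n1_polar _ _))// ler_pM2l// ler_expR.
    exact: ss'.
  have [D2 dD2] : exists D, cdiff (fun w => (f (z0 + w) - f z0) * w^-1) z D.
    apply/cdiff_ex_derivable; apply: derivableM.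
      apply: derivableB; last exact: derivable_cst.
      by apply/cdiff_ex_derivable; exists D'; exact: cdiff_shift.
    by apply: derivableV => //; exact: derivable_id.
  exists D2; apply: (cdiff_near (n1_gt0 z0') _ dD2) => h hz.
  rewrite /g; case: eqP => // /eqP; rewrite addr_eq0 => /eqP zh.
  by move: hz; rewrite zh n1N ltxx.
have e2 : 0 < e / 2 by lra.
have [r r0 Hr] := dz0 _ e2; exists r => // z zr; rewrite /g eqxx.
case: eqP => [_|/eqP z_0]; first by rewrite subrr n10 ltW.
rewrite (_ : _ - D = (f (z0 + z) - f z0 - z * D) / z); last by field.
apply: (le_trans (n1M _ _)); apply: (@le_trans _ _ (e / 2 * n1 z * n1 z^-1)).
  by apply: ler_wpM2r; [exact: n1_ge0|exact: Hr].
by rewrite -mulrA; have := n1V z; nra.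
Qed.

Lemma ccont_circle_slope f z0 s :
  ccont (fun t => f (z0 + polar s t)) -> ccont (circle_slope f z0 s).
Proof.
move=> cf; rewrite /circle_slope.
have c2 : ccont (fun t => polar (- s) (- t)).
  apply: (@ccont_comp R (@cexp R) (fun t => ((- s) +i* (- t))%C)) => [t e e0|t]; last first.
    by exists (cexp ((- s) +i* (- t))%C); exact: cdiff_cexp.
  exists e => // u ue; rewrite /n1 !ReImE /= subrr normr0 add0r -opprD normrN.
  exact: ltW.
have c1 := ccont_sub cf (ccont_cst (f z0)).
rewrite (_ : (fun t => _) = (fun t => (f (z0 + polar s t) - f z0) * polar (- s) (- t))); last first.
  apply/funext => u; congr (_ * _); apply: (mulfI (polar_neq0 s u)).
  by rewrite polar_inv divff ?polar_neq0.
move=> t e e0.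
set g := fun t => _ - _ in c1 *; set h := fun t => polar _ _ in c2 *.
have G0 : 0 < n1 (g t) + 1 by rewrite ltr_wpDl ?n1_ge0.
have H0 : 0 < n1 (h t) + 1 by rewrite ltr_wpDl ?n1_ge0.
have [|r1 r10 k1] := c1 t (Num.min 1 (e / 2 / (n1 (h t) + 1))).
  by rewrite lt_min ltr01 !divr_gt0.
have [|r2 r20 k2] := c2 t (Num.min 1 (e / 2 / (n1 (g t) + 1))).
  by rewrite lt_min ltr01 !divr_gt0.
exists (Num.min r1 r2); first by rewrite lt_min r10.
move=> u; rewrite lt_min => /andP[/k1 j1 /k2 j2].
move: j1 j2; rewrite !le_min => /andP[j1 j1'] /andP[j2 j2'].
rewrite -!/(g _) -!/(h _).
rewrite (_ : g u * h u - g t * h t = (g u - g t) * h u + g t * (h u - h t)); last by ring.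
apply: (le_trans (n1D _ _)); have a1 := n1M (g u - g t) (h u).
have a2 := n1M (g t) (h u - h t).
have a3 : n1 (h u) <= n1 (h t) + 1.
  rewrite (_ : h u = h t + (h u - h t)); last by ring.
  by apply: (le_trans (n1D _ _)); rewrite lerD2l.
have b1 : n1 (g u - g t) * n1 (h u) <= e / 2.
  by move: j1'; rewrite ler_pdivlMr//; apply: le_trans; rewrite ler_wpM2l ?n1_ge0.
have b2 : n1 (g t) * n1 (h u - h t) <= e / 2.
  move: j2'; rewrite ler_pdivlMr//; apply: le_trans; rewrite mulrC ler_wpM2l ?n1_ge0//.
  by rewrite lerDl.
lra.
Qed.

Lemma n1_circle_slope f z0 s t M : n1 (f (z0 + polar s t) - f z0) <= M ->
  n1 (circle_slope f z0 s t) <= 2 * M / expR s.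
Proof.
move=> H; have E0 := expR_gt0 s; rewrite ler_pdivlMr//.
apply: (@le_trans _ _ (n1 (circle_slope f z0 s t) * n1 (polar s t))).
  by rewrite ler_wpM2l ?n1_ge0 ?n1_polar_ge.
have := n1M (f (z0 + polar s t) - f z0) (polar s t)^-1.
rewrite -/(circle_slope f z0 s t) => k.
have := n1V (polar s t); have := n1_ge0 (polar s t); have := n1_ge0 (f (z0 + polar s t) - f z0).
nra.
Qed.

Lemma n1_mul_tau (D : C) : n1 (D * tauC) = n1 D * tau.
Proof.
have T0 := ltW tau_gt0.
by rewrite /n1 !ReImE /= !mulr0 subr0 add0r !normrM (ger0_norm T0) mulrDl.
Qed.

Lemma circ_bound_tau phi (A : C) eta : ccont phi -> (forall t, n1 (phi t) <= eta) ->
  A * tauC = circ phi -> n1 A <= 2 * eta.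
Proof.
move=> cp b e; have := circ_bound cp b; rewrite -e n1_mul_tau mulrA.
by rewrite ler_pM2r ?tau_gt0.
Qed.

Lemma ccont_on_circle (f : C -> C) (z0 : C) (s : R) :
  (forall z, n1 (z - z0) <= 2 * expR s -> exists D, cdiff f z D) ->
  ccont (fun t => f (z0 + polar s t)).
Proof.
move=> df; apply: (@ccont_comp R (fun z => f (z0 + z)) (polar s) (ccont_polar s)) => t.
have [|D dD] := df (z0 + polar s t); first by rewrite addrC addKr n1_polar.
by exists D; exact: cdiff_shift.
Qed.

Lemma cauchy_estimate (f : C -> C) (z0 D : C) (s M : R) :
  (forall z, n1 (z - z0) <= 2 * expR s -> exists D, cdiff f z D) ->
  cdiff f z0 D -> (forall t, n1 (f (z0 + polar s t) - f z0) <= M) ->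
  n1 D <= 4 * M / expR s.
Proof.
move=> df dz0 b.
have := circ_bound_tau (ccont_circle_slope (ccont_on_circle df)) _ (derivative_circle df dz0).
move=> /(_ (2 * M / expR s)); rewrite !mulrA (_ : 2 * 2 = 4 :> R); last by ring.
by apply=> t; exact: n1_circle_slope.
Qed.

Lemma segment_mean_value (f : C -> C) (d : R -> C) (z h : C) (M : R) :
  (forall s : R, 0 <= s <= 1 -> cdiff f (z + (s%:C)%C * h) (d s)) ->
  (forall s, 0 <= s <= 1 -> n1 (d s) <= M) -> n1 (f (z + h) - f z) <= 2 * (M * n1 h).
Proof.
move=> df dM.
have dv s : 0 <= s <= 1 -> cderiv (fun s : R => f (z + (s%:C)%C * h)) s (h * d s).
  move=> sI.
  have est e : 0 < e -> exists2 r : R, 0 < r & forall u : R, `|u| < r ->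
      n1 (f (z + ((s + u)%:C)%C * h) - f (z + (s%:C)%C * h) - (u%:C)%C * (h * d s)) <= e * `|u|.
    move=> e0; have H0 : 0 < n1 h + 1 by rewrite ltr_wpDl ?n1_ge0.
    have [|r r0 Hr] := df s sI (e / (n1 h + 1)); first by rewrite divr_gt0.
    exists (r / (n1 h + 1)); first by rewrite divr_gt0.
    move=> u; rewrite ltr_pdivlMr// => ur.
    have uh : n1 ((u%:C)%C * h) <= `|u| * (n1 h + 1).
      apply: (le_trans (n1M _ _)); rewrite n1_real ler_wpM2l// lerDl.
      exact: ler01.
    have := Hr ((u%:C)%C * h) (le_lt_trans uh ur).
    rewrite (_ : ((s + u)%:C)%C * h = (s%:C)%C * h + (u%:C)%C * h); last first.
      by rewrite rmorphD /= mulrDl.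
    rewrite addrA mulrA => k; apply: (le_trans k).
    rewrite -mulrA ler_pM2l// mulrC ler_pdivrMr//.
  by split; apply/is_deriveR => e /est[r r0 Hr]; exists r => // u /Hr; apply: le_trans;
    [apply: le_trans (n1_Re _)|apply: le_trans (n1_Im _)];
    rewrite !ReImE /= !(mul0r, subr0, addr0).
have := @cderiv_bound R _ (fun s => h * d s) 0 1 (n1 h * M) ler01 dv.
rewrite subr0 mulr1 !mul1r mul0r addr0 [n1 h * M]mulrC; apply=> t tI.
apply: (le_trans (n1M _ _)); rewrite [leRHS]mulrC; apply: ler_wpM2l; first exact: n1_ge0.
exact: dM.
Qed.

(** A vanishing derivative along the segment is enough, so the same lemma serves
entire functions and functions on a disc. *)
Lemma cdiff0_const (f : C -> C) (z h : C) :
  (forall s : R, 0 <= s <= 1 -> cdiff f (z + (s%:C)%C * h) 0) -> f (z + h) = f z.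
Proof.
move=> df; have := @segment_mean_value f (fun=> 0) z h 0 df.
rewrite mul0r mulr0 => H; apply/eqP; rewrite -subr_eq0; apply/eqP/n1_eq0/H => s _.
by rewrite n10.
Qed.

(** In this form, for growth slower than linear, it applies directly to sections
of line bundles. Cauchy's estimate on circles of growing radius kills the
derivative. *)
Lemma liouville (f : C -> C) :
  (forall z, exists D, cdiff f z D) ->
  (forall e : R, 0 < e -> exists rho : R, forall z, rho <= n1 z -> n1 (f z) <= e * n1 z) ->
  forall z, f z = f 0.
Proof.
move=> df small z; rewrite -[z]add0r; apply: cdiff0_const => s _.
set z0 := 0 + _; have [D dD] := df z0; suff -> : 0 = D by [].
symmetry; apply: n1_eq0; rewrite leNgt; apply/negP => D0.
(* Cauchy's estimate below gives n1 D <= 16 e: 4 for the estimate itself, 4 for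
   the difference of two values at distance at most 3 X from the origin. *)
pose e := n1 D / 17; have e0 : 0 < e by rewrite divr_gt0.
have [rho Hrho] := small e e0.
pose X := 1 + `|rho| + n1 z0 + n1 (f z0) / e.
have fe : 0 <= n1 (f z0) / e by rewrite divr_ge0 ?n1_ge0 ?ltW.
have X0 : 0 < X by rewrite /X; have := n1_ge0 z0; have := normr_ge0 rho; lra.
have eX : expR (ln X) = X by rewrite lnK ?posrE.
have := @cauchy_estimate f z0 D (ln X) (4 * e * X) (fun z _ => df z) dD.
rewrite eX (_ : 4 * (4 * e * X) / X = 16 * e); last by field; rewrite gt_eqF.
move=> H; have {H} : n1 D <= 16 * e.
  apply: H => t; set c := polar _ _.
  have c1 : n1 c <= 2 * X by rewrite -eX n1_polar.
  have c2 : X <= n1 c by rewrite -{1}eX n1_polar_ge.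
  have k1 : n1 c <= n1 (z0 + c) + n1 z0.
    by have := n1B (z0 + c) z0; rewrite addrAC subrr add0r.
  have zc : rho <= n1 (z0 + c).
    have := ler_norm rho; rewrite /X in c2; lra.
  have k2 := Hrho _ zc; have k3 := n1D z0 c; have k4 := n1B (f (z0 + c)) (f z0).
  apply: (le_trans k4).
  have k5 : n1 (f z0) <= e * X.
    rewrite -ler_pdivrMl// mulrC /X; have := n1_ge0 z0; have := normr_ge0 rho; lra.
  have k6 : n1 z0 <= X.
    rewrite /X; have := normr_ge0 rho; lra.
  have : e * n1 (z0 + c) <= e * (3 * X) by rewrite ler_pM2l//; lra.
  lra.
by rewrite /e; lra.
Qed.

End CauchyConsequences.

(** * Mixed second derivatives *)

Section SecondDerivatives.
Variable R : realType.
Local Notation C := (Cx R).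
Local Notation tauC := (((pi *+ 2 : R)%:C)%C : C).

Section OneVariable.
Variables (g g' : C -> C) (s M : R).
Local Notation r := (expR s).
Hypothesis dg : forall z, n1 z <= 7 * r -> cdiff g z (g' z).
Hypothesis bg : forall z, n1 z <= 7 * r -> n1 (g z) <= M.

Let r0 : 0 < r := expR_gt0 s.

Let cdiff_ball z : n1 z <= 5 * r -> forall w, n1 (w - z) <= 2 * r -> exists D, cdiff g w D.
Proof.
have rp := r0; move=> h w hw; exists (g' w); apply: dg.
by have := n1D (w - z) z; rewrite subrK; lra.
Qed.

(** A circle with parameter s stays within n1-distance 2 r of its centre, so each
use of Cauchy's estimate shrinks the domain by 2 r: from 7 r to 5 r here, and
to 3 r for the Lipschitz bound of the derivative. *)
Lemma n1_deriv_bounded z : n1 z <= 5 * r -> n1 (g' z) <= 8 * M / r.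
Proof.
have rp := r0; move=> hz.
have := @cauchy_estimate R g z (g' z) s (2 * M) (cdiff_ball hz).
rewrite mulrA (_ : 4 * 2 = 8 :> R); last by ring.
apply=> [|t]; first by apply: dg; lra.
have := n1B (g (z + polar s t)) (g z).
have k1 : n1 (g z) <= M by apply: bg; lra.
have k2 : n1 (g (z + polar s t)) <= M.
  by apply: bg; have := n1D z (polar s t); have := n1_polar s t; lra.
lra.
Qed.

Lemma n1_segment (z h : C) (u b : R) : 0 <= u <= 1 -> n1 z <= b -> n1 (z + h) <= b ->
  n1 (z + (u%:C)%C * h) <= b.
Proof.
have rp := r0; move=> /andP[u0 u1] h1 h2.
rewrite (_ : z + _ = ((1 - u)%:C)%C * z + (u%:C)%C * (z + h)); last first.
  by rewrite rmorphB rmorph1; ring.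
apply: (le_trans (n1D _ _)).
have := n1M ((1 - u)%:C)%C z; have := n1M (u%:C)%C (z + h); rewrite !n1_real.
rewrite (ger0_norm u0) (ger0_norm (_ : 0 <= 1 - u)) ?subr_ge0//; nra.
Qed.

Lemma n1_lipschitz z w : n1 z <= 5 * r -> n1 w <= 5 * r ->
  n1 (g w - g z) <= 16 * M / r * n1 (w - z).
Proof.
have rp := r0; move=> hz hw; rewrite -[in g w](subrK z w) [w - z + z]addrC.
have zw : n1 (z + (w - z)) <= 5 * r by rewrite addrC subrK.
have := @segment_mean_value R g (fun u => g' (z + (u%:C)%C * (w - z))) z (w - z) (8 * M / r).
rewrite mulrA (_ : 2 * (8 * M / r) = 16 * M / r); last by field; rewrite gt_eqF.
by apply=> u uI; have := n1_segment uI hz zw => k;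
  [apply: dg; lra|exact: n1_deriv_bounded].
Qed.

Lemma n1_deriv_lipschitz z w : n1 z <= 3 * r -> n1 w <= 3 * r ->
  n1 (g' w - g' z) <= 128 * M / r ^+ 2 * n1 (w - z).
Proof.
have rp := r0; move=> hz hw.
have d1 v : n1 v <= 3 * r -> forall u, n1 (u - 0) <= 2 * r -> cdiff (fun u => g (v + u)) u (g' (v + u)).
  move=> hv u hu; apply: cdiff_shift; apply: dg.
  by rewrite subr0 in hu; have := n1D v u; lra.
have dh u : n1 (u - 0) <= 2 * r ->
    cdiff (fun u => g (w + u) - g (z + u)) u (g' (w + u) - g' (z + u)).
  by move=> hu; apply: cdiff_sub; apply: d1.
have := @cauchy_estimate R (fun u => g (w + u) - g (z + u)) 0 (g' w - g' z) s
  (32 * M / r * n1 (w - z)).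
rewrite (_ : 4 * _ / _ = 128 * M / r ^+ 2 * n1 (w - z)); last by field; rewrite gt_eqF.
apply=> [u hu||t].
- by exists (g' (w + u) - g' (z + u)); exact: dh.
- by have := dh 0; rewrite !addr0 subrr n10; apply; lra.
rewrite add0r !addr0; apply: (le_trans (n1B _ _)).
have p := n1_polar s t.
have k1' : n1 (g (w + polar s t) - g (z + polar s t)) <= 16 * M / r * n1 (w - z).
  have := n1D z (polar s t); have := n1D w (polar s t) => q1 q2.
  have := @n1_lipschitz (z + polar s t) (w + polar s t).
  rewrite (_ : w + _ - _ = w - z); last by ring.
  by apply; lra.
have k2' : n1 (g w - g z) <= 16 * M / r * n1 (w - z) by apply: n1_lipschitz; lra.
rewrite (_ : 32 * M / r * n1 (w - z) = 2 * (16 * M / r * n1 (w - z))); last by field; rewrite gt_eqF.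
lra.
Qed.

(** Taylor's formula of order two, uniform in M and r only; this uniformity is
what allows differentiation under the integral sign. *)
Lemma n1_second_order h : n1 h <= 3 * r ->
  n1 (g h - g 0 - h * g' 0) <= 256 * M / r ^+ 2 * n1 h ^+ 2.
Proof.
have rp := r0; move=> hh.
have z3 : n1 (0 : C) <= 3 * r by rewrite n10; lra.
have h3 : n1 (0 + h) <= 3 * r by rewrite add0r.
have := @segment_mean_value R (fun u => g u - u * g' 0)
  (fun u => g' (0 + (u%:C)%C * h) - g' 0) 0 h (128 * M / r ^+ 2 * n1 h).
rewrite (_ : 2 * _ = 256 * M / r ^+ 2 * n1 h ^+ 2); last by field; rewrite gt_eqF.
rewrite add0r mul0r subr0 (_ : g h - g 0 - _ = g h - h * g' 0 - g 0); last by ring.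
apply=> u uI; have k := n1_segment uI z3 h3.
  by apply: cdiff_sub; [apply: dg; lra|exact: cdiff_lin].
apply: (le_trans (n1_deriv_lipschitz z3 k)).
have M0 : 0 <= M by apply: le_trans (bg (z := 0) _); rewrite ?n1_ge0 ?n10//; lra.
apply: ler_wpM2l; first by rewrite divr_ge0 ?mulr_ge0 ?exprn_ge0// ltW.
rewrite add0r subr0; apply: (le_trans (n1M _ _)); rewrite n1_real.
case/andP: uI => u0 u1; rewrite (ger0_norm u0) ler_piMl ?n1_ge0//.
Qed.

End OneVariable.

Section HalfMixed.
Variables (f p q : C -> C -> C) (s M : R).
Local Notation r := (expR s).
Hypothesis dz : forall z w, n1 z <= 7 * r -> n1 w <= 7 * r -> cdiff (f^~ w) z (p z w).
Hypothesis dw : forall z w, n1 z <= 7 * r -> n1 w <= 7 * r -> cdiff (f z) w (q z w).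
Hypothesis bf : forall z w, n1 z <= 7 * r -> n1 w <= 7 * r -> n1 (f z w) <= M.

Let r0 : 0 < r := expR_gt0 s.

Let M0 : 0 <= M.
Proof. have rp := r0. by apply: le_trans (bf (z := 0) (w := 0) _ _); rewrite ?n1_ge0 ?n10//; lra. Qed.

Let q_lipschitz z z' : n1 z <= 5 * r -> n1 z' <= 5 * r ->
  n1 (q z' 0 - q z 0) <= 128 * M / r ^+ 2 * n1 (z' - z).
Proof.
have rp := r0; move=> hz hz'.
have dh w : n1 (w - 0) <= 2 * r -> cdiff (fun w => f z' w - f z w) w (q z' w - q z w).
  by rewrite subr0 => hw; apply: cdiff_sub; apply: dw => //; lra.
have := @cauchy_estimate R (fun w => f z' w - f z w) 0 (q z' 0 - q z 0) s
  (32 * M / r * n1 (z' - z)).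
rewrite (_ : 4 * _ / _ = 128 * M / r ^+ 2 * n1 (z' - z)); last by field; rewrite gt_eqF.
have l w : n1 w <= 7 * r -> n1 (f z' w - f z w) <= 16 * M / r * n1 (z' - z).
  by move=> hw; apply: (@n1_lipschitz (f^~ w) (p^~ w) s M) => // v hv; [exact: dz|exact: bf].
apply=> [w hw||t].
- by exists (q z' w - q z w); exact: dh.
- by apply: dh; rewrite subrr n10; lra.
rewrite add0r; apply: (le_trans (n1B _ _)).
rewrite (_ : 32 * M / r * _ = 2 * (16 * M / r * n1 (z' - z))); last by field; rewrite gt_eqF.
rewrite mulrDl mul1r; apply: lerD; apply: l; last by rewrite n10; lra.
by have := n1_polar s t; lra.
Qed.

Lemma ccont_half_mixed : ccont (circle_slope (q^~ 0) 0 s).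
Proof.
have rp := r0; apply: ccont_circle_slope => t e e0.
pose K := 128 * M / r ^+ 2.
have K0 : 0 <= K by rewrite divr_ge0 ?mulr_ge0 ?exprn_ge0 ?M0// ltW.
have [|d d0 Hd] := ccont_polar s t (e := e / (K + 1)); first by rewrite divr_gt0// ltr_wpDl.
exists d => // u /Hd; rewrite ler_pdivlMr ?ltr_wpDl// => k.
rewrite !add0r; apply: (le_trans (q_lipschitz _ _)).
- by have := n1_polar s t; lra.
- by have := n1_polar s u; lra.
apply: le_trans k; rewrite mulrC ler_wpM2l ?n1_ge0// -/K; lra.
Qed.

(** The derivative p 0 w in z is a circle integral of slopes of f (-, w), by
derivative_circle. Differentiating in w under the integral replaces f by q;
the error is quadratic in w, uniformly on the circle, by n1_second_order. *)
Lemma half_mixed : exists A, cdiff (p 0) 0 A /\ A * tauC = circ (circle_slope (q^~ 0) 0 s).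
Proof.
have rp := r0.
have tn := tauC_neq0 R.
exists (circ (circle_slope (q^~ 0) 0 s) / tauC); split; last by rewrite divfK.
set A := _ / _ => e e0.
pose K2 := 256 * M / r ^+ 2.
have K20 : 0 <= K2 by rewrite divr_ge0 ?mulr_ge0 ?ler0n ?M0 ?exprn_ge0// ltW.
pose K := 8 * K2 / r.
have K0 : 0 < K + 1 by exact: (ltr_wpDl (divr_ge0 (mulr_ge0 (ler0n _ 8) K20) (ltW rp)) ltr01).
exists (Num.min r (e / (K + 1))).
  by rewrite lt_min rp divr_gt0.
move=> w; rewrite lt_min => /andP[wr we]; rewrite add0r.
have df v : n1 v <= 2 * r -> forall z, n1 (z - 0) <= 2 * r -> exists D, cdiff (f^~ v) z D.
  by move=> hv z; rewrite subr0 => hz; exists (p z v); apply: dz; lra.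
have w2 : n1 w <= 2 * r by lra.
have z2 : n1 (0 : C) <= 2 * r by rewrite n10; lra.
have cw := ccont_circle_slope (ccont_on_circle (df w w2)).
have c0 := ccont_circle_slope (ccont_on_circle (df 0 z2)).
have cq := ccont_scale w ccont_half_mixed.
have e1 : p 0 w * tauC = circ (circle_slope (f^~ w) 0 s).
  by apply: derivative_circle; [exact: df|apply: dz; lra].
have e2 : p 0 0 * tauC = circ (circle_slope (f^~ 0) 0 s).
  by apply: derivative_circle; [exact: df|apply: dz; lra].
have e3 : (p 0 w - p 0 0 - w * A) * tauC = circ (fun t => (circle_slope (f^~ w) 0 s t
    - circle_slope (f^~ 0) 0 s t) - w * circle_slope (q^~ 0) 0 s t).
  rewrite circ_sub ?circ_sub ?circ_scale//; [|exact: ccont_half_mixed|exact: ccont_sub].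
  by rewrite -e1 -e2 !mulrBl -[w * A * _]mulrA /A divfK.
have second z : n1 z <= 2 * r ->
    n1 (f z w - f z 0 - w * q z 0) <= K2 * n1 w ^+ 2.
  move=> hz; apply: (@n1_second_order (f z) (q z) s M).
  - by move=> v hv; apply: dw => //; lra.
  - by move=> v hv; apply: bf => //; lra.
  - lra.
have := circ_bound_tau (ccont_sub (ccont_sub cw c0) cq) _ e3.
move=> /(_ (2 * (2 * (K2 * n1 w ^+ 2)) / r)) H.
have {H} : n1 (p 0 w - p 0 0 - w * A) <= 2 * (2 * (2 * (K2 * n1 w ^+ 2)) / r).
  apply: H => t.
  rewrite (_ : _ - _ = circle_slope (fun z => f z w - f z 0 - w * q z 0) 0 s t); last first.
    by rewrite /circle_slope; ring.
  apply: n1_circle_slope; apply: (le_trans (n1B _ _)).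
  rewrite mulrDl mul1r; apply: lerD; apply: second; rewrite ?n10; last lra.
  by rewrite add0r n1_polar.
move=> H; apply: (le_trans H).
rewrite (_ : 2 * _ = K * n1 w * n1 w); last by rewrite /K; field; rewrite gt_eqF.
apply: ler_wpM2r; first exact: n1_ge0.
move: we; rewrite ltr_pdivlMr// mulrC => we.
apply: le_trans (ltW we); apply: ler_wpM2r; first exact: n1_ge0.
by rewrite lerDl.
Qed.

End HalfMixed.

(** By half_mixed the derivative in w of p is a circle integral of slopes of q.
The same lemma with the variables exchanged, at nearby base points, shows that
q is differentiable in z; Cauchy's formula then gives its derivative as the
same integral. The radius 10 leaves room for moving the base point by 2. *)
Lemma mixed_derivatives (f p q : C -> C -> C) (s M : R) :
  (forall z w, n1 z <= 10 * expR s -> n1 w <= 10 * expR s -> cdiff (f^~ w) z (p z w)) ->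
  (forall z w, n1 z <= 10 * expR s -> n1 w <= 10 * expR s -> cdiff (f z) w (q z w)) ->
  (forall z w, n1 z <= 10 * expR s -> n1 w <= 10 * expR s -> n1 (f z w) <= M) ->
  exists A, cdiff (p 0) 0 A /\ cdiff (q^~ 0) 0 A.
Proof.
move=> dz dw bf; have rp := expR_gt0 s.
have [A [dA eA]] : exists A, cdiff (p 0) 0 A /\ A * tauC = circ (circle_slope (q^~ 0) 0 s).
  by apply: (@half_mixed f p q s M) => z w hz hw; [apply: dz|apply: dw|apply: bf]; lra.
have dq z : n1 z <= 2 * expR s -> exists B, cdiff (q^~ 0) z B.
  move=> hz.
  have [|||B [dB _]] := @half_mixed (fun w v => f (z + v) w) (fun w v => q (z + v) w)
    (fun w v => p (z + v) w) s M.
  - by move=> w v hw hv; apply: dw; have := n1D z v; lra.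
  - by move=> w v hw hv; apply: (@cdiff_shift R (f^~ w)); apply: dz; have := n1D z v; lra.
  - by move=> w v hw hv; apply: bf; have := n1D z v; lra.
  exists B => e /dB[r r0 H]; exists r => // h /H.
  by rewrite add0r addr0.
have [|B dB] := dq 0; first by rewrite n10; lra.
exists A; split=> //; suff -> : A = B by [].
apply: (mulIf (tauC_neq0 R)); rewrite eA; symmetry; apply: derivative_circle dB.
by move=> z; rewrite subr0; exact: dq.
Qed.

End SecondDerivatives.

(** * Holomorphic maps of several variables *)

Section SeveralVariables.
Variable R : realType.
Local Notation C := (Cx R).
Local Notation Re := (@complex.Re R).

Lemma normC_entry m n (A : 'M[C]_(m, n)) i j : `|A i j| <= `|A|.
Proof.
have -> : `|A| = mx_norm A by [].
rewrite mx_normE; apply: (@le_trans _ _ (`|A i j|%:nng%:num)) => //.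
by rewrite num_le; apply/bigmax_geP; right; exists (i, j).
Qed.

Lemma is_derive_entry (V : normedModType C) m n (f : V -> 'M[C]_(m, n)) a v D i j :
  is_derive a v f D -> is_derive a v (fun x => f x i j) (D i j).
Proof.
move=> H; have {}H := (is_derive_epsP f a v D).1 H.
rewrite is_derive_epsP => e e0; have [r r0 Hr] := H e e0.
exists r => // h hr; apply: le_trans (Hr h hr); apply: le_trans (normC_entry _ i j).
by rewrite !mxE.
Qed.

Lemma differentiable_is_derive (V W : normedModType C) (f : V -> W) a v :
  differentiable f a -> is_derive a v f ('d f a v).
Proof.
by move=> df; split; [exact: diff_derivable|exact: deriveE].
Qed.

Lemma jacobian_entry m n (f : 'rV[C]_m -> 'rV[C]_n) u i j : differentiable f u ->
  is_derive u (delta_mx 0 i) (fun x => f x 0 j) (jacobian f u i j).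
Proof.
move=> /(differentiable_is_derive (delta_mx 0 i)) /(is_derive_entry 0 j).
by rewrite /jacobian /lin1_mx mxE.
Qed.

Lemma differentiable_entry (V : normedModType C) m n (f : V -> 'M[C]_(m, n)) a i j :
  differentiable f a -> differentiable (fun x => f x i j) a.
Proof.
move=> df; apply: (@differentiable_comp C V _ _ f (fun M : 'M[C]_(m, n) => M i j)) => //.
exact: differentiable_coord.
Qed.

Lemma differentiable_mx (V : normedModType C) m n (f : V -> 'M[C]_(m, n)) a :
  (forall i j, differentiable (fun x => f x i j) a) -> differentiable f a.
Proof.
move=> df.
rewrite (_ : f = \sum_(i < m) \sum_(j < n) (fun x => f x i j *: delta_mx i j)); last first.
  apply/funext => x; rewrite [LHS]matrix_sum_delta fct_sumE; apply: eq_bigr => i _.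
  by rewrite fct_sumE.
apply: differentiable_sum => i; apply: differentiable_sum => j.
exact: differentiableZl.
Qed.

(** The function of two variables f (u + z v1 + w v2) is separately holomorphic and
bounded near the origin, which is what mixed_derivatives asks for. *)
Lemma derive_comm n (U : set 'rV[C]_n) (f : 'rV[C]_n -> C) u v1 v2 :
  open U -> (forall x, U x -> differentiable f x) -> U u ->
  exists A, is_derive u v2 (fun x => 'D_v1 f x) A /\ is_derive u v1 (fun x => 'D_v2 f x) A.
Proof.
move=> oU dU Uu.
pose M := n1 (f u) + 1.
have nb : \forall x \near u, U x /\ n1 (f x) <= M.
  have N1 : \forall x \near u, U x by exact: open_nbhs_nbhs.
  have cf : {for u, continuous f} by apply: differentiable_continuous; exact: dU.
  have N2 : \forall x \near u, n1 (f x) <= M.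
    have : \forall y \near f u, n1 y <= M.
      apply/nbhsC_n1; exists 1 => // y hy.
      rewrite -[y](subrK (f u)) /M addrC; apply: (le_trans (n1D _ _)).
      by rewrite lerD2l ltW.
    exact: cf.
  by near=> x; split; near: x.
have [e e0 He] : exists2 e : R, 0 < e & forall x, `|x - u| < (e%:C)%C -> U x /\ n1 (f x) <= M.
  move/nbhs_ballP : nb => [e e0 H]; have [d d0 de] := posC_real e0.
  by exists d => // x hx; apply: H; rewrite de -ball_normE /ball_/= distrC.
have [N N0 HN] : exists2 N : R, 0 <= N & `|v1| + `|v2| <= (N%:C)%C.
  exists (Re (`|v1| + `|v2|)); last by rewrite RRe_real// ger0_real// addr_ge0.
  by rewrite -ler0c RRe_real ?ger0_real ?addr_ge0.
(* With this radius, u + z v1 + w v2 stays within e / 2 of u for all z and w of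
   n1-size at most 10 d. *)
pose d := e / (20 * (N + 1)).
have d0 : 0 < d by rewrite divr_gt0// mulr_gt0// ltr_wpDl.
pose s := ln d; have es : expR s = d by rewrite lnK ?posrE.
pose pt (z w : C) := z *: v1 + w *: v2 + u.
have ptU z w : n1 z <= 10 * expR s -> n1 w <= 10 * expR s -> U (pt z w) /\ n1 (f (pt z w)) <= M.
  rewrite es => hz hw; apply: He; rewrite /pt addrK.
  apply: (@le_lt_trans _ _ (((10 * d)%:C)%C * (`|v1| + `|v2|))).
    rewrite mulrDr; apply: le_trans (ler_normD _ _) _; rewrite !normrZ.
    by apply: lerD; apply: ler_wpM2r => //; apply: (le_trans (normC_n1 _)); rewrite lecR.
  apply: (@le_lt_trans _ _ (((10 * d)%:C)%C * (N%:C)%C)).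
    by apply: ler_wpM2l => //; rewrite ler0c mulr_ge0// ltW.
  rewrite -rmorphM /= ltcR /d.
  rewrite (_ : 10 * _ * N = e / 2 * (N / (N + 1))); last by field; rewrite gt_eqF// ltr_wpDl.
  apply: (@le_lt_trans _ _ (e / 2)); last by lra.
  by rewrite ler_piMr ?divr_ge0 ?(ltW e0)// ler_pdivrMr ?ltr_wpDl// mul1r lerDl.
have [|||A [dA1 dA2]] := @mixed_derivatives R (fun z w => f (pt z w))
  (fun z w => 'D_v1 f (pt z w)) (fun z w => 'D_v2 f (pt z w)) s M.
- move=> z w hz hw; have [/dU df _] := ptU z w hz hw.
  have /is_derive_cdiff H : is_derive (pt z w) v1 f ('D_v1 f (pt z w)).
    by split=> //; exact: diff_derivable.
  move=> eta /H[r r0 Hr]; exists r => // h /Hr; rewrite add0r scale0r add0r.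
  by rewrite /pt scalerDl addrA [h *: v1 + _]addrCA !addrA.
- move=> z w hz hw; have [/dU df _] := ptU z w hz hw.
  have /is_derive_cdiff H : is_derive (pt z w) v2 f ('D_v2 f (pt z w)).
    by split=> //; exact: diff_derivable.
  move=> eta /H[r r0 Hr]; exists r => // h /Hr; rewrite add0r scale0r add0r.
  rewrite (_ : h *: v2 + pt z w = pt z (w + h))//.
  by rewrite /pt scalerDl !addrA; congr (_ + u); rewrite -!addrA addrC -!addrA.
- by move=> z w hz hw; have [] := ptU z w hz hw.
have pt0l w : pt 0 w = w *: v2 + u by rewrite /pt scale0r (add0r (w *: v2)).
have pt0r z : pt z 0 = z *: v1 + u by rewrite /pt scale0r (addr0 (z *: v1)).
exists A; split; apply/is_derive_cdiff.
  have -> : (fun w : C => 'D_v1 f (w *: v2 + u)) = (fun w => 'D_v1 f (pt 0 w)).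
    by apply/funext => w; rewrite pt0l.
  exact: dA1.
have -> : (fun z : C => 'D_v2 f (z *: v1 + u)) = (fun z => 'D_v2 f (pt z 0)).
  by apply/funext => z; rewrite pt0r.
exact: dA2.
Unshelve. all: by end_near. Qed.

End SeveralVariables.

(** * Symmetric congruence over an algebraically closed field *)

Section SymCongr.
Variable F : numClosedFieldType.

Lemma corner_congruence n (a : 'M[F]_1) (b : 'rV[F]_n) (D : 'M[F]_n) j x :
  (a + x *: delta_mx 0 j *m b^T + b *m (x *: delta_mx 0 j)^T
      + x *: delta_mx 0 j *m D *m (x *: delta_mx 0 j)^T) 0 0
  = a 0 0 + 2 * x * b 0 j + x ^+ 2 * D j j.
Proof.
rewrite [(x *: _)^T]linearZ /= -!scalemxAl -!scalemxAr trmx_delta -!rowE -colE -?row_mul -colE.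
by rewrite !mxE; ring.
Qed.

(** Gauss's reduction, with square roots: once the top left entry is nonzero, its
Schur complement is again symmetric and invertible. *)
Lemma symmetric_congruence n (h : 'M[F]_n) : h^T = h -> h \in unitmx ->
  exists2 P : 'M[F]_n, P \in unitmx & h = P *m P^T.
Proof.
elim: n h => [|n IH] h hS hU.
  by exists 1%:M; rewrite ?unitmx1// [LHS]flatmx0 [RHS]flatmx0.
rewrite -[n.+1]/(1 + n)%N in h hS hU *.
(* A congruence making the top left entry nonzero. If the entry is zero, the first
   row has some b 0 j != 0, and adding 1 or -1 times row j to the first row changes
   the entry to D j j + 2 b 0 j or D j j - 2 b 0 j; both cannot vanish. *)
have [T TU T0] : exists2 T : 'M[F]_(1 + n), T \in unitmx & ulsubmx (T *m h *m T^T) 0 0 != 0.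
  have hE := submxK h; set a := ulsubmx h in hE; set b := ursubmx h in hE.
  set c := dlsubmx h in hE; set D := drsubmx h in hE.
  have cE : c = b^T by rewrite /b trmx_ursub hS.
  have ulE (w : 'rV[F]_n) : ulsubmx (block_mx 1%:M w 0 1%:M *m h *m (block_mx 1%:M w 0 1%:M)^T)
      = a + w *m b^T + b *m w^T + w *m D *m w^T.
    rewrite -hE tr_block_mx !mulmx_block block_mxKul !trmx1 !(mul1mx, mulmx1) cE mulmxDl.
    by rewrite !addrA.
  have TU (w : 'rV[F]_n) : block_mx 1%:M w 0 1%:M \in unitmx.
    by rewrite unitmxE det_ublock !det1 mulr1 unitr1.
  have [a0|a0] := eqVneq (a 0 0) 0; last first.
    by exists 1%:M; rewrite ?unitmx1// mul1mx trmx1 mulmx1.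
  have [j bj] : exists j, b 0 j != 0.
    case: (boolP [exists x, b 0 x != 0]) => [/existsP//|/existsPn bz]; exfalso.
    have b0 : b = 0 by apply/rowP => i; have := bz i; rewrite negbK => /eqP ->; rewrite mxE.
    have : (row_mx 1%:M 0 : 'rV[F]_(1 + n)) *m h = 0.
      rewrite -hE mul_row_block !mul1mx !mul0mx !addr0 b0 [a]mx11_scalar a0.
      by rewrite raddf0 row_mx0.
    move/(congr1 (mulmxr (invmx h))); rewrite /= mulmxK// mul0mx => /(congr1 lsubmx).
    rewrite row_mxKl => /matrixP/(_ 0 0)/eqP; rewrite !mxE/= oner_eq0.
    by [].
  have [q1|q1] := eqVneq (2 * b 0 j + D j j) 0.
    exists (block_mx 1%:M ((-1) *: delta_mx 0 j) 0 1%:M); rewrite ?TU// ulE corner_congruence a0.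
    rewrite (_ : _ + _ = 2 * b 0 j + D j j - 4 * b 0 j); last by ring.
    by rewrite q1 add0r oppr_eq0 mulf_neq0// pnatr_eq0.
  exists (block_mx 1%:M (1 *: delta_mx 0 j) 0 1%:M); rewrite ?TU// ulE corner_congruence a0.
  by rewrite add0r mulr1 expr1n mul1r.
pose k := T *m h *m T^T.
have kS : k^T = k by rewrite /k !trmx_mul trmxK hS mulmxA.
have kU : k \in unitmx by rewrite !unitmx_mul unitmx_tr TU hU.
have kE := submxK k; set a := ulsubmx k in kE T0; set b := ursubmx k in kE.
set c := dlsubmx k in kE; set D := drsubmx k in kE.
have cE : c = b^T by rewrite /b trmx_ursub kS.
have DS : D^T = D by rewrite /D trmx_drsub kS.
rewrite -/k -/a in T0; set x := a 0 0 in T0.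
have aE : a = x%:M by rewrite [LHS]mx11_scalar.
pose S := D - x^-1 *: (c *m b).
pose L := block_mx 1%:M 0 (x^-1 *: c) 1%:M : 'M[F]_(1 + n).
have LU : L \in unitmx by rewrite unitmxE det_lblock !det1 mulr1 unitr1.
have kL : k = L *m block_mx x%:M 0 0 S *m L^T.
  rewrite /L tr_block_mx !mulmx_block !trmx1 !trmx0.
  rewrite !(mul1mx, mulmx1, mul0mx, mulmx0, addr0, add0r) -kE aE.
  rewrite linearZ /= cE trmxK mul_scalar_mx scalerA divff// scale1r.
  rewrite mul_mx_scalar scalerA divff// scale1r -scalemxAr /S cE.
  by rewrite addrC subrK.
have SS : S^T = S by rewrite /S linearB linearZ /= DS trmx_mul cE trmxK.
have SU : S \in unitmx.
  move: kU; rewrite kL !unitmx_mul => /andP[/andP[_ +] _].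
  by rewrite !unitmxE det_ublock unitrM => /andP[].
have [P' P'U SE] := IH S SS SU.
exists (invmx T *m (L *m block_mx (sqrtC x)%:M 0 0 P')).
  rewrite !unitmx_mul unitmx_inv TU LU /= unitmxE det_ublock unitrM.
  by rewrite det_scalar1 unitfE sqrtC_eq0 T0 -unitmxE.
rewrite !trmx_mul tr_block_mx !trmx0 tr_scalar_mx trmx_inv !mulmxA.
have -> : h = invmx T *m k *m invmx T^T.
  by rewrite /k !mulmxA mulVmx// mul1mx mulmxK// unitmx_tr.
congr (_ *m _); rewrite kL -!mulmxA; congr (_ *m (_ *m _)); rewrite !mulmxA; congr (_ *m _).
rewrite mulmx_block !(mul0mx, mulmx0, addr0, add0r) -scalar_mxM -expr2 sqrtCK.
by rewrite SE.
Qed.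
End SymCongr.

(** * Two-forms in dimension four *)

(** Laplace expansion on functions of natural numbers, which reduces to a value on
concrete integer entries; the determinant of a matrix does not. *)
Fixpoint laplace (K : pzRingType) n (f : nat -> nat -> K) : K :=
  if n is m.+1 then
    foldr (fun j x => f 0%N j * (let y := laplace m (fun p q => f p.+1 (bump j q)) in
      if odd j then - y else y) + x) 0 (iota 0 m.+1)
  else 1.

Lemma det_laplace (K : comNzRingType) n (f : nat -> nat -> K) :
  \det (\matrix_(i < n, j < n) f i j) = laplace n f.
Proof.
elim: n f => [|n IH] f; first by rewrite det_mx00.
rewrite (expand_det_row _ 0) [RHS]/=.
pose G j := f 0%N j * (let y := laplace n (fun p q => f p.+1 (bump j q)) in
      if odd j then - y else y).
transitivity (\sum_(j < n.+1) G j).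
  apply: eq_bigr => j _; rewrite mxE /cofactor add0n /G; congr (_ * _).
  rewrite -IH -signr_odd mulr_sign /=.
  suff -> : row' 0 (col' j (\matrix_(i, j) f i j)) = \matrix_(p < n, q < n) f p.+1 (bump j q).
    by [].
  by apply/matrixP => p q; rewrite !mxE /= /bump leq0n add1n.
by rewrite -(big_mkord xpredT G) unlock /index_iota subn0.
Qed.

Lemma laplace_intr (K : comNzRingType) n (f : nat -> nat -> int) :
  laplace n (fun i j => (f i j)%:~R : K) = (laplace n f)%:~R.
Proof.
rewrite -!det_laplace -[RHS](det_map_mx intr); congr (\det _).
by apply/matrixP => i j; rewrite !mxE.
Qed.

Definition eps_int (i j m n : nat) : int :=
  laplace 4 (fun p q => (q == nth 0%N [:: i; j; m; n] p)%:R).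
Definition sum4 (f : nat -> int) : int := foldr (fun j x => f j + x) 0 [:: 0; 1; 2; 3]%N.
Definition mul4 (f g : nat -> nat -> int) i j := sum4 (fun k => f i k * g k j).
Definition dual4 (f : nat -> nat -> int) i j :=
  sum4 (fun m => sum4 (fun n => eps_int i j m n * f m n)).
Definition eq4 (f g : nat -> nat -> int) :=
  all (fun i => all (fun j => f i j == g i j) [:: 0; 1; 2; 3]%N) [:: 0; 1; 2; 3]%N.

Definition wedge_int (m n i j : nat) : int :=
  ((i == m) && (j == n))%:R - ((i == n) && (j == m))%:R.

(** The standard basis dx0^dx1 + sg dx2^dx3, dx0^dx2 - sg dx1^dx3,
dx0^dx3 + sg dx1^dx2 of the self-dual (sg = 1) or anti-self-dual (sg = -1) forms.
As matrices these are quaternion units. *)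
Definition quat (sg : int) (r : nat) (i j : nat) : int :=
  match r with
  | 0 => wedge_int 0 1 i j + sg * wedge_int 2 3 i j
  | 1 => wedge_int 0 2 i j - sg * wedge_int 1 3 i j
  | _ => wedge_int 0 3 i j + sg * wedge_int 1 2 i j
  end.

(** In turn: duality (the sum over ordered pairs counts each twice), skewness,
and the two quaternion relations that skew_of_quaternions takes as hypotheses. *)
Definition quat_ok sg :=
  [&& all (fun r => eq4 (dual4 (quat sg r)) (fun i j => 2 * sg * quat sg r i j)) [:: 0; 1; 2]%N,
      all (fun r => eq4 (fun i j => quat sg r j i) (fun i j => - 1 * quat sg r i j)) [:: 0; 1; 2]%N,
      eq4 (mul4 (quat sg 2) (quat sg 2)) (fun i j => - 1 * (i == j)%:R)
    & eq4 (mul4 (mul4 (quat sg 0) (quat sg 2)) (quat sg 1)) (fun i j => - sg * (i == j)%:R)].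
Lemma quat_table : quat_ok 1 && quat_ok (-1).
Proof. by vm_compute. Qed.

Section SelfDual.
Variable R : realType.
Local Notation C := (Cx R).

(** Twice the Hodge star of the standard flat metric. *)
Definition dualm (Y : 'M[C]_4) : 'M[C]_4 :=
  \matrix_(i, j) \sum_(m < 4) \sum_(n < 4) eps R i j m n * Y m n.

Definition imx (f : nat -> nat -> int) : 'M[C]_4 := \matrix_(i < 4, j < 4) (f i j)%:~R.

Lemma sum4E (f : nat -> int) : \sum_(i < 4) ((f i)%:~R : C) = (sum4 f)%:~R.
Proof. by rewrite !big_ord_recl big_ord0 /= /sum4 /= !rmorphD. Qed.

Lemma epsE (i j m n : 'I_4) : eps R i j m n = (eps_int i j m n)%:~R.
Proof.
rewrite /eps_int -laplace_intr -det_laplace; congr (\det _); apply/matrixP => p q.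
rewrite !mxE rmorph_nat; congr (nat_of_bool _)%:R; rewrite -val_eqE /=.
by case: p => [[|[|[|[|]]]]].
Qed.

Lemma mul_imx f g : imx f *m imx g = imx (mul4 f g).
Proof.
apply/matrixP => i j; rewrite !mxE -sum4E; apply: eq_bigr => k _.
by rewrite !mxE rmorphM.
Qed.

Lemma dualm_imx f : dualm (imx f) = imx (dual4 f).
Proof.
apply/matrixP => i j; rewrite !mxE -sum4E; apply: eq_bigr => m _.
rewrite -sum4E; apply: eq_bigr => n _.
by rewrite !mxE rmorphM epsE.
Qed.

Lemma eq4_imx f g : eq4 f g -> imx f = imx g.
Proof.
move=> /allP H; apply/matrixP => i j; rewrite !mxE; congr (_%:~R).
have m4 (p : 'I_4) : (p : nat) \in [:: 0; 1; 2; 3]%N by case: p => [[|[|[|[|]]]]].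
by have /allP/(_ _ (m4 j))/eqP := H _ (m4 i).
Qed.

Lemma eps_leibniz (i j m n : 'I_4) : eps R i j m n = \sum_(s : 'S_4) (-1) ^+ s *
  ((i == s 0)%:R * ((j == s (lift ord0 0))%:R * ((m == s (lift ord0 (lift ord0 0)))%:R
   * (n == s (lift ord0 (lift ord0 (lift ord0 0))))%:R))).
Proof.
apply: eq_bigr => s _; congr (_ * _).
by rewrite !big_ord_recl big_ord0 !mxE /= mulr1 ![s _ == _]eq_sym.
Qed.

Lemma sum_pick (I : finType) (x : I) (f : I -> C) : \sum_i (i == x)%:R * f i = f x.
Proof.
rewrite (bigD1 x)//= eqxx mul1r big1 ?addr0// => i /negbTE ->; exact: mul0r.
Qed.

Lemma sum4_exchange (I : finType) (T : 'I_4 -> 'I_4 -> 'I_4 -> 'I_4 -> I -> C) :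
  \sum_i \sum_j \sum_m \sum_n \sum_s T i j m n s = \sum_s \sum_i \sum_j \sum_m \sum_n T i j m n s.
Proof.
under eq_bigr => i _.
  under eq_bigr => j _.
    under eq_bigr => m _ do rewrite exchange_big /=.
    rewrite exchange_big /=; over.
  rewrite exchange_big /=; over.
exact: exchange_big.
Qed.

Lemma mulr_pair4 (x1 x2 x3 x4 y1 y2 y3 y4 : C) :
  x1 * (x2 * (x3 * (x4 * (y1 * (y2 * (y3 * y4)))))) =
  x1 * (y1 * (x2 * (y2 * (x3 * (y3 * (x4 * y4)))))).
Proof. by ring. Qed.

Lemma sum2_prod (c : C) (f g : 'I_4 -> C) :
  \sum_i \sum_j c * (f i * g j) = c * ((\sum_i f i) * \sum_j g j).
Proof.
by rewrite big_distrlr /= mulr_sumr; apply: eq_bigr => i _; rewrite mulr_sumr.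
Qed.

Lemma sum4_prod (c : C) (f g h k : 'I_4 -> C) :
  \sum_i \sum_j \sum_m \sum_n c * (f i * (g j * (h m * k n))) =
  c * ((\sum_i f i) * ((\sum_j g j) * ((\sum_m h m) * \sum_n k n))).
Proof.
transitivity (\sum_i \sum_j (c * ((\sum_m h m) * \sum_n k n)) * (f i * g j)).
  apply: eq_bigr => i _; apply: eq_bigr => j _; rewrite -mulrA [_ * (f i * g j)]mulrC mulrA.
  rewrite -sum2_prod; apply: eq_bigr => m _; apply: eq_bigr => n _.
  by rewrite !mulrA.
by rewrite sum2_prod -mulrA; congr (_ * _); rewrite mulrC !mulrA.
Qed.

(** Leibniz's formula turns the sum into the determinant of a product of matrices. *)
Lemma eps_det (M : 'M[C]_4) (p q a b : 'I_4) :
  \sum_i \sum_j \sum_m \sum_n eps R i j m n * (M i p * (M j q * (M m a * M n b)))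
  = \det M * eps R p q a b.
Proof.
rewrite mulrC -(det_tr M) -det_mulmx.
transitivity (\sum_i \sum_j \sum_m \sum_n \sum_(s : 'S_4) (-1) ^+ s *
  (((i == s 0)%:R * M i p) * (((j == s (lift ord0 0))%:R * M j q) *
  (((m == s (lift ord0 (lift ord0 0)))%:R * M m a)
   * ((n == s (lift ord0 (lift ord0 (lift ord0 0))))%:R * M n b))))).
  apply: eq_bigr => i _; apply: eq_bigr => j _; apply: eq_bigr => m _; apply: eq_bigr => n _.
  rewrite eps_leibniz mulr_suml; apply: eq_bigr => s _; rewrite -!mulrA; congr (_ * _).
  exact: mulr_pair4.
rewrite sum4_exchange; apply: eq_bigr => s _; rewrite sum4_prod !sum_pick.
congr (_ * _); rewrite !big_ord_recl big_ord0 !mxE /= mulr1.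
have pick (x : 'I_4) (y : 'I_4) : \sum_k (\matrix_(p0 < 4, q0 < 4)
   (q0 == nth ord0 [:: p; q; a; b] p0)%:R : 'M[C]_4) y k * M^T k x = M x (nth ord0 [:: p; q; a; b] y).
  rewrite -(sum_pick _ (fun k => M x k)); apply: eq_bigr => k _.
  by rewrite !mxE.
by rewrite !pick.
Qed.

(** The dual of a bivector is a form, so the two sides transform by transposed
matrices; the volume form contributes the determinant. *)
Lemma dualm_congr (M Y : 'M[C]_4) :
  M^T *m dualm (M *m Y *m M^T) *m M = \det M *: dualm Y.
Proof.
apply/matrixP => p q; rewrite !mxE mulr_sumr.
transitivity (\sum_a \sum_b (\sum_i \sum_j \sum_m \sum_n
   eps R i j m n * (M i p * (M j q * (M m a * M n b)))) * Y a b); last first.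
  apply: eq_bigr => a _; rewrite mulr_sumr; apply: eq_bigr => b _.
  by rewrite eps_det mulrA.
transitivity (\sum_j \sum_i \sum_m \sum_n \sum_a \sum_b
   eps R i j m n * (M i p * (M j q * (M m a * M n b))) * Y a b).
  apply: eq_bigr => j _; rewrite mxE mulr_suml; apply: eq_bigr => i _.
  rewrite !mxE mulr_sumr mulr_suml; apply: eq_bigr => m _.
  rewrite mulr_sumr mulr_suml; apply: eq_bigr => n _.
  rewrite !mxE.
  transitivity (\sum_b \sum_a eps R i j m n * (M i p * (M j q * (M m a * M n b))) * Y a b).
    rewrite mulr_sumr mulr_sumr mulr_suml; apply: eq_bigr => b _.
    rewrite mxE mulr_suml mulr_sumr mulr_sumr mulr_suml; apply: eq_bigr => a _.
    by rewrite !mxE; ring.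
  exact: exchange_big.
rewrite exchange_big /= sum4_exchange; apply: eq_bigr => a _.
rewrite sum4_exchange; apply: eq_bigr => b _.
rewrite mulr_suml; apply: eq_bigr => i _.
rewrite mulr_suml; apply: eq_bigr => j _.
rewrite mulr_suml; apply: eq_bigr => m _.
by rewrite mulr_suml.
Qed.

Lemma hodge_dualm (h w : 'M[C]_4) nu :
  hodge h nu w = (2^-1 * nu) *: dualm (invmx h *m w *m (invmx h)^T).
Proof. by apply/matrixP => i j; rewrite mxE [RHS]mxE [in RHS]mxE. Qed.

(** The change of frame P reduces the star to the flat one by dualm_congr. When
nu^2 is the determinant of the metric, nu / det P is 1 or -1, according to the
orientation. *)
Lemma hodgeE (P Y : 'M[C]_4) nu : P \in unitmx ->
  hodge (P *m P^T) nu (P *m Y *m P^T) = (2^-1 * (nu / \det P)) *: (P *m dualm Y *m P^T).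
Proof.
move=> PU; have PTU : P^T \in unitmx by rewrite unitmx_tr.
pose M := invmx P^T.
have MT : M^T = invmx P by rewrite /M trmx_inv trmxK.
have invP : invmx (P *m P^T) = M *m invmx P.
  have PPU : P *m P^T \in unitmx by rewrite unitmx_mul PU.
  apply: (can_inj (mulKmx PPU)); rewrite (mulmxV PPU) -mulmxA [P^T *m _]mulmxA.
  by rewrite (mulmxV PTU) mul1mx (mulmxV PU).
have hE : invmx (P *m P^T) *m (P *m Y *m P^T) *m (invmx (P *m P^T))^T = M *m Y *m M^T.
  rewrite invP trmx_mul !mulmxA (mulmxKV PU) -[_ *m P^T *m _]mulmxA.
  by rewrite -trmx_mul (mulVmx PU) trmx1 mulmx1.
have := dualm_congr M Y; rewrite {1}MT => /(congr1 (fun Z => P *m Z *m P^T)).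
rewrite !mulmxA (mulmxV PU) mul1mx -[_ *m M *m _]mulmxA (mulVmx PTU) mulmx1 => dE.
have dM : \det M = (\det P)^-1 by rewrite /M det_inv det_tr.
by rewrite hodge_dualm hE dE dM -scalemxAr -scalemxAl scalerA !mulrA.
Qed.

Lemma imx_scale x f : imx (fun i j => x * f i j) = x%:~R *: imx f.
Proof. by apply/matrixP => i j; rewrite !mxE rmorphM. Qed.

Lemma imx_id : imx (fun i j => (i == j)%:R) = 1%:M.
Proof. by apply/matrixP => i j; rewrite !mxE rmorph_nat. Qed.

Lemma quat_matrices (sg : int) : sg = 1 \/ sg = -1 ->
  [/\ (forall r, (r < 3)%N -> dualm (imx (quat sg r)) = (2 * sg)%:~R *: imx (quat sg r)),
    (forall r, (r < 3)%N -> (imx (quat sg r))^T = - imx (quat sg r)),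
    imx (quat sg 2) *m imx (quat sg 2) = - 1%:M
  & imx (quat sg 0) *m imx (quat sg 2) *m imx (quat sg 1) = (- sg)%:~R *: 1%:M].
Proof.
have /andP[ok1 ok2] := quat_table.
move=> sg1; have {ok1 ok2 sg1} : quat_ok sg by case: sg1 => ->.
case/and4P => /allP q0 /allP q1 q2 q3.
have lt3 r : (r < 3)%N -> r \in [:: 0; 1; 2]%N by case: r => [|[|[|]]].
split.
- by move=> r /lt3 /q0 /eq4_imx; rewrite dualm_imx imx_scale.
- move=> r /lt3 /q1 /eq4_imx; rewrite imx_scale rmorphN1 scaleN1r => <-.
  by apply/matrixP => i j; rewrite [LHS]mxE [LHS]mxE [RHS]mxE.
- by rewrite mul_imx (eq4_imx q2) imx_scale imx_id rmorphN1 scaleN1r.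
- by rewrite !mul_imx (eq4_imx q3) imx_scale imx_id.
Qed.

(** Moving Y^T to the left across a unit gives - Y, and as E2 squares to -1, moving Y
across E2 gives - Y^T. Across the product E0 E2 E1, which is a scalar, Y^T
therefore becomes - Y. *)
Lemma skew_of_quaternions n (E0 E1 E2 Y : 'M[C]_n) (c : C) : c != 0 ->
  E2 *m E2 = - 1%:M -> E0 *m E2 *m E1 = c *: 1%:M ->
  E0 *m Y^T = - (Y *m E0) -> E1 *m Y^T = - (Y *m E1) -> E2 *m Y^T = - (Y *m E2) ->
  Y + Y^T = 0.
Proof.
move=> c0 E22 E021 Y0 Y1 Y2.
have Y2' : E2 *m Y = - (Y^T *m E2).
  have : E2 *m (E2 *m Y^T) *m E2 = E2 *m (- (Y *m E2)) *m E2 by rewrite Y2.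
  rewrite mulmxA E22 mulNmx mul1mx mulNmx => ->.
  by rewrite mulmxN mulNmx -!mulmxA E22 !mulmxN mulmx1 opprK.
have : E0 *m E2 *m E1 *m Y^T = - (Y *m (E0 *m E2 *m E1)).
  rewrite -mulmxA Y1 mulmxN -!mulmxA [E2 *m (Y *m E1)]mulmxA Y2' mulNmx mulmxN opprK.
  by rewrite !mulmxA Y0 !mulNmx.
rewrite E021 -scalemxAl -scalemxAr mul1mx mulmx1 -scalerN => /(scalerI c0) ->.
exact: subrr.
Qed.

Lemma congruence_skew n (P Y : 'M[C]_n) : P \in unitmx -> Y + Y^T = 0 ->
  (P *m Y *m invmx P) *m (P *m P^T) + (P *m P^T) *m (P *m Y *m invmx P)^T = 0.
Proof.
move=> PU YY; have PTU : P^T \in unitmx by rewrite unitmx_tr.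
rewrite !trmx_mul trmx_inv !mulmxA (mulmxKV PU) (mulmxK PTU) -mulmxDl -mulmxDr YY.
by rewrite mulmx0 mul0mx.
Qed.

(** An endomorphism acting trivially on the self-dual forms lies in the
anti-self-dual half of so(4), and in particular is skew for the metric. In an
orthonormal frame the three forms may be replaced by the quaternion units,
which span the same space, and skew_of_quaternions applies. *)
Lemma selfdual_annihilator (h B0 B1 B2 X : 'M[C]_4) : h^T = h -> h \in unitmx ->
  spans_selfdual h B0 B1 B2 ->
  X *m B0 + B0 *m X^T = 0 -> X *m B1 + B1 *m X^T = 0 -> X *m B2 + B2 *m X^T = 0 ->
  X *m h + h *m X^T = 0.
Proof.
move=> hS hU [nu [nu2 span]] X0 X1 X2.
have [P PU hP] := symmetric_congruence hS hU.
have dP : \det P != 0 by rewrite -unitfE -unitmxE.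
have [sg sg1 nuE] : exists2 sg : int, sg = 1 \/ sg = -1 & nu / \det P = sg%:~R.
  move/eqP: nu2; rewrite hP det_mulmx det_tr -expr2 eqf_sqr => /orP[]/eqP ->.
    by exists 1; [left|rewrite divff].
  by exists (-1); [right|rewrite mulNr divff// rmorphN].
have [dq qT q33 q021] := quat_matrices sg1.
pose W r := P *m imx (quat sg r) *m P^T.
have sg2 : (sg%:~R : C) * sg%:~R = 1 by case: sg1 => ->; rewrite ?rmorphN ?mulrNN mulr1.
have WX r : (r < 3)%N -> X *m W r + W r *m X^T = 0.
  move=> r3; have Wskew : (W r)^T = - W r.
    by rewrite /W !trmx_mul trmxK qT// mulNmx mulmxN mulmxA.
  have Wself : hodge h nu (W r) = W r.
    rewrite hP hodgeE// dq// -scalemxAr -scalemxAl scalerA nuE.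
    rewrite rmorphM /= mulrACA mulVf ?pnatr_eq0// mul1r sg2 scale1r.
    by [].
  have [c0 [c1 [c2 ->]]] := (span _ Wskew).1 Wself.
  rewrite !mulmxDr !mulmxDl -!scalemxAr -!scalemxAl.
  rewrite addrACA [_ + (c0 *: _ + _)]addrACA -!scalerDr X0 X1 X2 !scaler0 !addr0.
  by [].
pose Y := invmx P *m X *m P.
have XE : X = P *m Y *m invmx P by rewrite /Y !mulmxA mulmxV// mul1mx mulmxK.
have XTE : X^T = invmx P^T *m Y^T *m P^T.
  by rewrite XE !trmx_mul trmx_inv mulmxA.
clearbody Y; have PTU : P^T \in unitmx by rewrite unitmx_tr.
have YQ r : (r < 3)%N -> imx (quat sg r) *m Y^T = - (Y *m imx (quat sg r)).
  move=> r3; have := WX r r3; rewrite /W XTE {1}XE.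
  rewrite !mulmxA (mulmxK PTU) (mulmxKV PU) -mulmxDl -!mulmxA -mulmxDr.
  move/(congr1 (fun Z => invmx P *m Z *m invmx P^T)).
  rewrite !mulmxA (mulVmx PU) mul1mx (mulmxK PTU) mulmx0 mul0mx => /eqP; rewrite addrC addr_eq0 => /eqP.
  by [].
have c0 : (- sg)%:~R != 0 :> C by case: sg1 => ->; rewrite ?opprK ?rmorphN1 ?oppr_eq0 oner_eq0.
have YY := skew_of_quaternions c0 q33 q021 (YQ 0%N isT) (YQ 1%N isT) (YQ 2%N isT).
by rewrite hP XE; exact: congruence_skew.
Qed.

End SelfDual.

(** * Explicit sections and their deformations *)

Section Sections.
Variable R : realType.
Local Notation C := (Cx R).

Lemma is_derive_unique (V W : normedModType C) (f : V -> W) a v D1 D2 :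
  is_derive a v f D1 -> is_derive a v f D2 -> D1 = D2.
Proof. by move=> [_ <-] [_ <-]. Qed.

Lemma row20 (u v : C) : row2 u v 0 0 = u. Proof. by rewrite mxE. Qed.
Lemma row21 (u v : C) : row2 u v 0 1 = v. Proof. by rewrite mxE. Qed.
Definition row2E := (row20, row21).

Lemma ord2P (j : 'I_2) : j = 0 \/ j = 1.
Proof. by case: j => [[|[|]]] // p; [left|right]; apply/val_inj. Qed.

Lemma eq_row2 (p q : 'rV[C]_2) : p 0 0 = q 0 0 -> p 0 1 = q 0 1 -> p = q.
Proof. by move=> h0 h1; apply/rowP => j; have [->|->] := ord2P j. Qed.

Lemma entire_horner (p : {poly C}) : entire (horner p).
Proof.
elim/poly_ind: p => [|p c IH] z.
  rewrite (_ : horner 0 = cst 0); first exact: differentiable_cst.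
  by apply/funext => l; rewrite horner0.
rewrite (_ : horner _ = (fun l => p.[l] * l + c)); last first.
  by apply/funext => l; rewrite hornerMXaddC.
apply: differentiableD; last exact: differentiable_cst.
by apply: differentiableM; first exact: IH.
Qed.

Lemma entire_row2 (f g : C -> C) : entire f -> entire g -> entire (fun l => row2 (f l) (g l)).
Proof.
move=> ef eg z; apply: differentiable_mx => i j; rewrite ord1.
have [->|->] := ord2P j.
  by rewrite (_ : (fun x => _) = f); [exact: ef|apply/funext => x; rewrite row2E].
by rewrite (_ : (fun x => _) = g); [exact: eg|apply/funext => x; rewrite row2E].
Qed.

Lemma entire_entry (f : C -> 'rV[C]_2) j : entire f -> entire (fun l => f l 0 j).
Proof. by move=> ef z; apply: differentiable_entry; exact: ef. Qed.

Lemma entire_cdiff (f : C -> C) : entire f -> forall z, exists D, cdiff f z D.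
Proof. by move=> ef z; apply/cdiff_ex_derivable/derivable1_diffP; exact: ef. Qed.

(** The polynomial l^N p(1/l), which is p in the chart at infinity of O(N). *)
Definition revp N (p : {poly C}) : {poly C} := \poly_(i < N.+1) p`_(N - i).

Lemma horner_revp N (p : {poly C}) (l : C) : l != 0 -> (size p <= N.+1)%N ->
  (revp N p).[l^-1] = l ^- N * p.[l].
Proof.
move=> l0 sp; rewrite horner_poly (horner_coef_wide _ sp) mulr_sumr.
rewrite (reindex_inj rev_ord_inj) /=; apply: eq_bigr => i _.
rewrite subSS subKn -1?ltnS// [in RHS]mulrCA; congr (_ * _).
have : (i <= N)%N by rewrite -ltnS.
move: (nat_of_ord i) => m mN.
by rewrite -{2}(subnK mN) exprD invfM -mulrA mulVf ?expf_neq0// mulr1 exprVn.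
Qed.

Lemma horner_take_drop n (p : {poly C}) l :
  p.[l] = (take_poly n p).[l] + (drop_poly n p).[l] * l ^+ n.
Proof. by rewrite -{1}(poly_take_drop n p) hornerD hornerM hornerXn. Qed.

Variables (k : nat) (a : C).
Hypothesis hk : (3 <= k)%N.
Local Notation V := 'rV[C]_k.+1.

(** The Q-component of the section with coefficient vector x. *)
Definition qp (x : V) : {poly C} := \poly_(i < k.+1) x 0 (inord i).

Lemma size_qp x : (size (qp x) <= k.+1)%N. Proof. exact: size_poly. Qed.

Lemma QpolyE x l : Qpoly x l = (qp x).[l].
Proof. by rewrite horner_poly; apply: eq_bigr => i _; rewrite inord_val. Qed.

Lemma qpD c x y : qp (c *: x + y) = c *: qp x + qp y.
Proof.
apply/polyP => i; rewrite !coefE; case: ifP => _; first by rewrite !mxE.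
by rewrite mulr0 addr0.
Qed.

Lemma poly_eq0_horner (p : {poly C}) : (forall l, p.[l] = 0) -> p = 0.
Proof.
move=> h; apply/eqP/negPn/negP => p0.
have := max_poly_roots p0 (rs := [seq (i%:R : C) | i <- iota 0 (size p)]).
rewrite size_map size_iota ltnn => H; suff : false by [].
apply: H; first by apply/allP => z _; apply/eqP.
by rewrite map_inj_uniq ?iota_uniq// => i j /eqP; rewrite eqr_nat => /eqP.
Qed.

Lemma qp_inj x : (forall l, (qp x).[l] = 0) -> x = 0.
Proof.
move=> /poly_eq0_horner h; apply/rowP => i; move/(congr1 (fun p : {poly C} => p`_i)) : h.
by rewrite coef_poly ltn_ord inord_val coef0 mxE.
Qed.

(** The polarisation of the quadratic conditions: for v = x these say that the curve
exists, and in general that v is tangent to the conditions at x. *)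
Definition quadrics (x v : V) := forall n, (3 <= n < k)%N -> (qp x * qp v)`_n = 0.

Lemma quadricsD x c v w : quadrics x v -> quadrics x w -> quadrics x (c *: v + w).
Proof.
move=> bv bw n hn; rewrite qpD mulrDr -scalerAr coefD coefZ bv// bw//.
by rewrite mulr0 addr0.
Qed.

Lemma quadrics0 x : quadrics x 0.
Proof.
by move=> n _; rewrite (_ : qp 0 = 0) ?mulr0 ?coef0//; apply: poly_eq0_horner => l;
  rewrite -QpolyE /Qpoly big1// => i _; rewrite mxE mul0r.
Qed.

Lemma quadrics_sum x n (c : 'I_n -> C) (v : 'I_n -> V) :
  (forall i, quadrics x (v i)) -> quadrics x (\sum_i c i *: v i).
Proof.
by move=> bv; elim/big_rec: _ => [|i w _ bw]; [exact: quadrics0|exact: quadricsD].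
Qed.

(** The transition matrix of the normal bundle, an extension of O(2 - k) and O(k)
whose class is represented by 2 a l^-2 Q. *)
Definition normal_mx (x : V) (l : C) : 'M[C]_2 :=
  \matrix_(i, j) (if i == 0 then (if j == 0 then l ^- k else 2 * a * l ^- 2 * (qp x).[l])
    else (if j == 0 then 0 else l ^+ (k - 2))).

Lemma mul_normal_mx x l (d : 'rV[C]_2) : d *m normal_mx x l =
  row2 (l ^- k * d 0 0) (2 * a * l ^- 2 * (qp x).[l] * d 0 0 + l ^+ (k - 2) * d 0 1).
Proof.
apply: eq_row2; rewrite !mxE /= !big_ord_recl big_ord0 !mxE /=.
  by rewrite mulr0 !addr0 mulrC.
by rewrite addr0 (_ : lift ord0 ord0 = 1); [rewrite mulrC [d 0 1 * _]mulrC|exact/val_inj].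
Qed.

Lemma patch_entry_diff l p j : differentiable (fun q => Defs.patch k a l q 0 j) p.
Proof.
have c0 : differentiable (fun q : 'rV[C]_2 => q 0 0) p by exact: differentiable_coord.
have c1 : differentiable (fun q : 'rV[C]_2 => q 0 1) p by exact: differentiable_coord.
have [->|->] := ord2P j.
  rewrite (_ : (fun q => _) = (fun q : 'rV[C]_2 => l ^- k * q 0 0)); last first.
    by apply/funext => q; rewrite row2E.
  by apply: differentiableM => //; exact: differentiable_cst.
rewrite (_ : (fun q => _) =
  (fun q : 'rV[C]_2 => l ^+ (k - 2) * q 0 1 + a * l ^- 2 * (q 0 0 * q 0 0))); last first.
  by apply/funext => q; rewrite row2E.
apply: differentiableD; apply: differentiableM => //; try exact: differentiable_cst.
exact: differentiableM.
Qed.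

Lemma normal_patchE (x : V) (s : C -> 'rV[C]_2) l : s l 0 0 = Qpoly x l ->
  normal_patch (Defs.patch k a) s l = normal_mx x l.
Proof.
move=> s0; apply/matrixP => i j; rewrite /normal_patch.
have dp : differentiable (Defs.patch k a l) (s l).
  by apply: differentiable_mx => i' j'; rewrite ord1; exact: patch_entry_diff.
apply: (is_derive_unique (jacobian_entry i j dp)).
have D j' : is_derive (s l) (delta_mx 0 i) (fun q : 'rV[C]_2 => q 0 j') ((0 == 0 :> 'I_1) && (j' == i))%:R.
  have := is_derive_entry 0 j' (is_derive_id (s l) (delta_mx 0 i)).
  by rewrite mxE.
have D0 := D 0; have D1 := D 1.
have [->|->] := ord2P j.
  rewrite (_ : (fun q => _) = (fun q : 'rV[C]_2 => l ^- k *: q 0 0)); last first.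
    by apply/funext => q; rewrite row2E.
  apply: is_derive_eq; rewrite mxE /=.
  by have [->|->] := ord2P i; rewrite /= ?scaler0 // [_ *: _]mulr1.
rewrite (_ : (fun q => _) =
  (fun q : 'rV[C]_2 => l ^+ (k - 2) *: q 0 1 + (a * l ^- 2) *: (q 0 0 * q 0 0))); last first.
  by apply/funext => q; rewrite row2E.
apply: (is_derive_eq (is_deriveD (is_deriveZ _ D1) (is_deriveZ _ (is_deriveM D0 D0)))).
rewrite mxE /= s0 QpolyE.
have [->|->] := ord2P i; rewrite /= /GRing.scale /=; ring.
Qed.

(** The tau-component of the deformation in the direction v. In the other chart
l^(k-2) tau + 2 a l^-2 Q_x Q_v must have no positive powers of l: the part of
Q_x Q_v in degrees up to 2 is harmless, that in degrees from k on is cancelled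
by tau, and nothing can cancel the degrees between. *)
Definition deform_tau (x v : V) : {poly C} := - (2 * a) *: drop_poly k (qp x * qp v).
Definition deform (x v : V) (l : C) : 'rV[C]_2 := row2 (qp v).[l] (deform_tau x v).[l].
Definition deform_inf (x v : V) (l : C) : 'rV[C]_2 :=
  row2 (revp k (qp v)).[l] ((2 * a) * (revp 2 (take_poly 3 (qp x * qp v))).[l]).

Lemma quadrics_patching x v l : quadrics x v -> l != 0 ->
  (revp 2 (take_poly 3 (qp x * qp v))).[l^-1] =
  l ^- 2 * ((qp x).[l] * (qp v).[l]) - l ^+ (k - 2) * (drop_poly k (qp x * qp v)).[l].
Proof.
move=> b l0; rewrite horner_revp ?size_take_poly// -hornerM.
rewrite (horner_take_drop k (qp x * qp v)) mulrDr.
have -> : take_poly k (qp x * qp v) = take_poly 3 (qp x * qp v).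
  apply/polyP => i; rewrite !coef_take_poly; case: ltnP => ik; case: ltnP => i3 //.
    by apply: b; rewrite i3.
  by move: (leq_trans (leq_trans i3 hk) ik); rewrite ltnn.
rewrite -addrA -[LHS]addr0; congr (_ + _); apply/eqP; rewrite eq_sym subr_eq0; apply/eqP.
rewrite mulrC -mulrA mulrC; congr (_ * _).
by rewrite -{1}(subnK (leq_trans (leqnSn 2) hk)) exprD -mulrA divff ?expf_neq0// mulr1.
Qed.

(** The quadratic conditions are sufficient: tau = - a drop_k (Q^2) works. *)
Lemma curve_ex x : quadrics x x -> exists s st, curve_at a x s st.
Proof.
move=> b; pose s l := row2 (qp x).[l] (- a * (drop_poly k (qp x * qp x)).[l]).
pose st l := row2 (revp k (qp x)).[l] (a * (revp 2 (take_poly 3 (qp x * qp x))).[l]).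
exists s, st; split; last by move=> l; rewrite /s row2E QpolyE.
split.
- apply: entire_row2; first exact: entire_horner.
  by rewrite (_ : (fun l => _) = horner (- a *: drop_poly k (qp x * qp x))); [exact: entire_horner|apply/funext=> l; rewrite hornerZ].
- apply: entire_row2; first exact: entire_horner.
  by rewrite (_ : (fun l => _) = horner (a *: (revp 2 (take_poly 3 (qp x * qp x))))); [exact: entire_horner|apply/funext=> l; rewrite hornerZ].
move=> l l0; rewrite /st /s /Defs.patch !row2E horner_revp// ?size_qp// quadrics_patching//.
by congr row2; ring.
Qed.

Lemma deformation_ex x v : MC a x -> quadrics x v -> deformation a x v (deform x v) (deform_inf x v).
Proof.
move=> [s [st cu]] b; exists s, st; split=> //; last by move=> l; rewrite row2E QpolyE.
case: cu => _ s0; split.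
- by apply: entire_row2; exact: entire_horner.
- apply: entire_row2; first exact: entire_horner.
  rewrite (_ : (fun l => _) = horner ((2 * a) *: revp 2 (take_poly 3 (qp x * qp v)))).
    exact: entire_horner.
  by apply/funext => l; rewrite hornerZ.
move=> l l0; rewrite (normal_patchE (s0 l)) mul_normal_mx /deform /deform_inf !row2E.
rewrite horner_revp ?size_qp// quadrics_patching// /deform_tau hornerZ.
by congr row2; ring.
Qed.

(** A section of O(-1) vanishes. *)
Lemma liouville_at_infinity (E F : C -> C) : entire E -> entire F ->
  (forall l, l != 0 -> E l = l^-1 * F l^-1) -> E 0 = 0.
Proof.
move=> eE eF EF.
have [D dF] := entire_cdiff eF 0; have [r r0 Hr] := cdiff_cont dF ltr01.
pose B := n1 (F 0) + 1.
have B0 : 0 < B by rewrite ltr_wpDl ?n1_ge0.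
have small e : 0 < e -> forall z, 1 + 4 / r + 4 * B / e <= n1 z -> n1 (E z) <= e.
  move=> e0 z hz.
  have q1 : 0 < 4 / r by rewrite divr_gt0.
  have q2 : 0 < 4 * B / e by rewrite divr_gt0// mulr_gt0.
  have z0 : z != 0 by apply/eqP => z0; move: hz; rewrite z0 n10; lra.
  have nz := n1_gt0 z0; have kV := n1V z.
  have zV : n1 z^-1 <= 2 / n1 z by rewrite ler_pdivlMr// mulrC.
  have zVr : n1 z^-1 < r.
    apply: (le_lt_trans zV); rewrite ltr_pdivrMr// mulrC -ltr_pdivrMr//.
    have : 2 / r <= 4 / r by rewrite ler_pM2r ?invr_gt0// ler_nat.
    lra.
  have FB : n1 (F z^-1) <= B.
    have := Hr z^-1 zVr; rewrite add0r => h.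
    by have := n1D (F z^-1 - F 0) (F 0); rewrite subrK /B; lra.
  rewrite EF//; apply: (le_trans (n1M _ _)).
  apply: (@le_trans _ _ (2 / n1 z * B)); first by rewrite ler_pM ?n1_ge0.
  rewrite mulrAC ler_pdivrMr// [e * _]mulrC -ler_pdivrMr//.
  have : 2 * B / e <= 4 * B / e by rewrite ler_pM2r ?invr_gt0// ler_pM2r// ler_nat.
  lra.
have const z : E z = E 0.
  apply: liouville z; first exact: entire_cdiff.
  move=> e e0; exists (1 + 4 / r + 4 * B / e) => z hz; apply: (le_trans (small e e0 z hz)).
  have q1 : 0 < 4 / r by rewrite divr_gt0.
  have q2 : 0 < 4 * B / e by rewrite divr_gt0// mulr_gt0.
  by rewrite ler_peMr ?(ltW e0)//; lra.
apply: n1_eq0; rewrite leNgt; apply/negP => h.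
have h2 : 0 < n1 (E 0) / 2 by rewrite divr_gt0.
pose X := 1 + 4 / r + 4 * B / (n1 (E 0) / 2).
have := small _ h2 ((`|X|%:C)%C); rewrite n1_real normr_id ler_norm const => /(_ isT).
lra.
Qed.

(** The quadratic conditions are necessary. For 3 <= n < k, the part of Q^2 in
degrees from n on and the tau-component combine to an entire function E with
value a [Q^2]_n at 0; the patching relation makes it a section of O(-1). *)
Lemma MC_quadrics x : a != 0 -> MC a x -> quadrics x x.
Proof.
move=> a0 [s [st [[es est ps] s0]]] n /andP[n3 nk].
set P := qp x * qp x.
pose E l := l ^+ (k - n) * s l 0 1 + a * (drop_poly n P).[l].
pose F w := w ^+ (n - 3) * st w 0 1 - a * (revp n.-1 (take_poly n P)).[w].
have eX m : entire (fun z : C => z ^+ m).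
  have -> : (fun z : C => z ^+ m) = horner ('X^m).
    by apply/funext => z; rewrite hornerXn.
  exact: entire_horner.
have eE : entire E.
  move=> z; apply: differentiableD; apply: differentiableM.
  - exact: eX.
  - exact: entire_entry.
  - exact: differentiable_cst.
  - exact: entire_horner.
have eF : entire F.
  move=> z; apply: differentiableB; apply: differentiableM.
  - exact: eX.
  - exact: entire_entry.
  - exact: differentiable_cst.
  - exact: entire_horner.
have := @liouville_at_infinity E F eE eF; rewrite /E expr0n subn_eq0 leqNgt nk mul0r add0r.
rewrite horner_coef0 coef_drop_poly add0n => H; have {H} : a * P`_n = 0.
  apply: H => l l0.
  have n0 : (0 < n)%N by exact: leq_trans n3.
  rewrite /F horner_revp ?prednK ?size_take_poly// ps// /Defs.patch row2E s0 QpolyE.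
  rewrite [(qp x).[l] ^+ 2]expr2 -hornerM -/P (horner_take_drop n P l).
  have -> : n.-1 = ((n - 3) + 2)%N by lia.
  have -> : (k - 2 = (n - 3) + 1 + (k - n))%N by lia.
  have -> : l ^+ n = l ^+ ((n - 3) + 3) by rewrite subnK.
  rewrite !exprD exprVn; move: (l ^+ (n - 3)) (expf_neq0 (n - 3) l0) => L L0.
  move: (l ^+ (k - n)) (s l 0 1) (drop_poly n P).[l] (take_poly n P).[l] => li t d u.
  by field; rewrite l0 L0.
by move/eqP; rewrite mulf_eq0 (negbTE a0) => /eqP.
Qed.

End Sections.

(** * Reciprocal and square recursions for coefficient sequences *)

Section CourseOfValues.

(** Course-of-values recursion, where the step reads the list of all earlier terms.
Both recursions below consist of ring operations, so covn_morph transports them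
along ring morphisms, in particular along evaluation of polynomials. *)
Fixpoint cov (K : Type) (step : nat -> seq K -> K) n : seq K :=
  if n is m.+1 then rcons (cov step m) (step m (cov step m)) else [::].
Definition covn (K : Type) (step : nat -> seq K -> K) n : K := step n (cov step n).

Lemma size_cov (K : Type) step n : size (@cov K step n) = n.
Proof. by elim: n => //= n IH; rewrite size_rcons IH. Qed.

Lemma nth_cov (K : Type) (x0 : K) step n i : (i < n)%N -> nth x0 (cov step n) i = covn step i.
Proof.
elim: n => // n IH; rewrite ltnS leq_eqVlt /= nth_rcons size_cov => /orP[/eqP->|ni].
  by rewrite ltnn eqxx.
by rewrite ni IH.
Qed.

Lemma covn_morph (K K' : Type) (f : K -> K') step step' :
  (forall m s, f (step m s) = step' m (map f s)) -> forall n, f (covn step n) = covn step' n.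
Proof.
move=> h n; rewrite /covn h; congr step'.
by elim: n => //= n IH; rewrite map_rcons IH h IH.
Qed.

Variable K : comNzRingType.

Definition inv_step (y : nat -> K) m (s : seq K) : K :=
  if m is m'.+1 then - \sum_(i < m) y i.+1 * y 0%N ^+ i * s`_(m' - i) else 1.

(** The coefficients of 1/y for the power series y, the n-th one multiplied by
(y 0)^(n+1): without denominators it is a polynomial in the coefficients of y. *)
Definition inv_coef y := covn (inv_step y).

Lemma inv_coef0 y : inv_coef y 0 = 1. Proof. by []. Qed.
Lemma inv_coefS y n : inv_coef y n.+1 =
  - \sum_(i < n.+1) y i.+1 * y 0%N ^+ i * inv_coef y (n - i).
Proof.
rewrite /inv_coef {1}/covn /inv_step; congr (- _); apply: eq_bigr => i _.
by rewrite nth_cov// ltnS leq_subr.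
Qed.

Lemma inv_coef_eq y y' n : (forall i, (i <= n)%N -> y i = y' i) -> inv_coef y n = inv_coef y' n.
Proof.
elim/ltn_ind: n => -[|n] IH h; first by rewrite !inv_coef0.
rewrite !inv_coefS; congr (- _); apply: eq_bigr => i _.
rewrite !h// ?IH ?ltnS ?leq_subr// => j hj; apply: h.
by rewrite (leq_trans hj)// (leq_trans (leq_subr _ _)).
Qed.

(** The case of y 0 + y 1 X, a geometric series. *)
Lemma inv_coef_two y n : (forall i, (2 <= i <= n)%N -> y i = 0) -> inv_coef y n = (- y 1%N) ^+ n.
Proof.
elim: n => [|n IH] h; first by rewrite inv_coef0 expr0.
rewrite inv_coefS big_ord_recl big1 ?addr0 => [|i _]; last first.
  by rewrite h ?mul0r//= /bump /= add1n !ltnS.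
rewrite expr0 mulr1 subn0 IH ?exprS ?mulNr// => i /andP[i2 il].
by apply: h; rewrite i2 leqW.
Qed.

Definition sqr_step (c y0 y1 y2 : K) m (s : seq K) : K :=
  match m with 0 => y0 | 1 => y1 | 2 => y2
  | m'.+1 => - c * \sum_(i < m') s`_i.+1 * s`_(m' - i) end.

(** The series with first terms y0, y1, y2 whose square has no terms in degrees from
3 on, where c is the inverse of 2 y0: each condition on the square determines
the next coefficient. *)
Definition sqr_coef c y0 y1 y2 := covn (sqr_step c y0 y1 y2).

Lemma sqr_coefS c y0 y1 y2 n : (2 <= n)%N -> sqr_coef c y0 y1 y2 n.+1 =
  - c * \sum_(i < n) sqr_coef c y0 y1 y2 i.+1 * sqr_coef c y0 y1 y2 (n - i).
Proof.
case: n => [|[|n]]// _; rewrite {1}/sqr_coef {1}/covn /sqr_step; congr (_ * _).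
by apply: eq_bigr => i _; rewrite !nth_cov// ltnS ?ltn_ord// leq_subr.
Qed.

End CourseOfValues.

Arguments covn : simpl never.
Arguments sqr_coef : simpl never.
Arguments inv_coef : simpl never.

Lemma inv_coef_morph (K K' : comNzRingType) (f : {rmorphism K -> K'}) y n :
  f (inv_coef y n) = inv_coef (f \o y) n.
Proof.
apply: (@covn_morph _ _ f) => -[|m] s; first by rewrite rmorph1.
rewrite /inv_step rmorphN rmorph_sum; congr (- _); apply: eq_bigr => i _.
rewrite !rmorphM rmorphXn /=; congr (_ * _).
have [im|im] := ltnP (m - i) (size s); first by rewrite (nth_map 0).
by rewrite !nth_default ?size_map// rmorph0.
Qed.

Lemma sqr_coef_morph (K K' : comNzRingType) (f : {rmorphism K -> K'}) c y0 y1 y2 n :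
  f (sqr_coef c y0 y1 y2 n) = sqr_coef (f c) (f y0) (f y1) (f y2) n.
Proof.
apply: (@covn_morph _ _ f) => -[|[|[|m]]] s //.
rewrite /sqr_step rmorphM rmorphN rmorph_sum; congr (_ * _); apply: eq_bigr => i _.
have nthf j : f s`_j = [seq f i | i <- s]`_j.
  have [jm|jm] := ltnP j (size s); first by rewrite (nth_map 0).
  by rewrite !nth_default ?size_map// rmorph0.
by rewrite rmorphM !nthf.
Qed.

(** * Density of the regular curves *)

Section Regular.
Variable R : realType.
Local Notation C := (Cx R).

Definition mx2 (p q r s : C) : 'M[C]_2 :=
  \matrix_(i, j) (if i == 0 then (if j == 0 then p else q) else (if j == 0 then r else s)).

Lemma mx2_mul p q r s p' q' r' s' : mx2 p q r s *m mx2 p' q' r' s' =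
  mx2 (p * p' + q * r') (p * q' + q * s') (r * p' + s * r') (r * q' + s * s').
Proof.
apply/matrixP => i j; rewrite !mxE !big_ord_recl big_ord0 !mxE /= addr0.
by have [->|->] := ord2P i; have [->|->] := ord2P j.
Qed.

Lemma mx2_det p q r s : \det (mx2 p q r s) = p * s - q * r.
Proof.
rewrite (expand_det_row _ 0) !big_ord_recl big_ord0 addr0 /cofactor !mxE /=.
by rewrite !det_mx11 !mxE /= expr0 expr1 mul1r mulN1r mulrN.
Qed.

Lemma entire_mx2 (f g h e : C -> C) : entire f -> entire g -> entire h -> entire e ->
  entire (fun l => mx2 (f l) (g l) (h l) (e l)).
Proof.
move=> ef eg eh ee z; apply: differentiable_mx => i j.
have [->|->] := ord2P i; have [->|->] := ord2P j.
- by rewrite (_ : (fun x => _) = f); [exact: ef|apply/funext => x; rewrite mxE].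
- by rewrite (_ : (fun x => _) = g); [exact: eg|apply/funext => x; rewrite mxE].
- by rewrite (_ : (fun x => _) = h); [exact: eh|apply/funext => x; rewrite mxE].
- by rewrite (_ : (fun x => _) = e); [exact: ee|apply/funext => x; rewrite mxE].
Qed.

Lemma OsumE m n (l : C) : Osum m n l = mx2 (l ^ (- m)) 0 0 (l ^ (- n)).
Proof.
apply/matrixP => i j; rewrite !mxE.
by have [->|->] := ord2P i; have [->|->] := ord2P j.
Qed.

Lemma entire_poly (p : {poly C}) (f : C -> C) : f =1 horner p -> entire f.
Proof. by move=> /funext ->; exact: entire_horner. Qed.

Variables (k : nat) (a : C).
Hypothesis hk : (3 <= k)%N.
Hypothesis a0 : a != 0.
Local Notation V := 'rV[C]_k.+1.

Lemma normal_mxE (x : V) l : normal_mx a x l = mx2 (l ^- k) (2 * a * l ^- 2 * (qp x).[l]) 0 (l ^+ (k - 2)).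
Proof. by []. Qed.

Lemma normal_typeP (x : V) m n : quadrics x x ->
  (exists H Ht : C -> 'M[C]_2, [/\ entire H, entire Ht,
        (forall l, H l \in unitmx) /\ (forall l, Ht l \in unitmx)
      & forall l, l != 0 -> normal_mx a x l *m Ht l^-1 = H l *m Osum m n l]) ->
  normal_type a x m n.
Proof.
move=> b [H [Ht [h1 h2 h3 h4]]]; have [s [st cu]] := curve_ex a hk b.
exists s, st; split=> //; exists H, Ht; split=> // l l0.
by rewrite (normal_patchE a (cu.2 l)); exact: h4.
Qed.

(** Explicit frames identifying the normal bundle with O(1) + O(1). Write
Q u = 1 + l^k A. The columns (2 a A, u) and (2 a (l A - c Q), l u - c l^k), with
c the top coefficient of u, are chosen so that l^-1 times the inverse of the
transition matrix turns them into polynomials in l^-1; subtracting c l^k is what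
lowers the degree of l u. Both frames have determinant 2 a c, which is nonzero. *)
Lemma Mreg_inverse (x : V) (u A : {poly C}) : quadrics x x -> (size u <= k)%N ->
  qp x * u = 1 + 'X^k * A -> u`_k.-1 != 0 -> Mreg a x.
Proof.
move=> b su uA; set c := u`_k.-1 => c0.
have k0 : (0 < k)%N by exact: leq_trans hk.
pose b2 := 'X * u - c *: 'X^k.
have sb2 : (size b2 <= k.-1.+1)%N.
  apply/leq_sizeP => j; rewrite prednK// => jk; rewrite coefB coefXM coefZ coefXn.
  have -> : (j == 0%N) = false by apply/negbTE; rewrite -lt0n (leq_trans k0).
  have [ejk|jk'] := eqVneq j k; first by rewrite ejk mulr1 subrr.
  rewrite mulr0 subr0 nth_default// (leq_trans su)// -ltnS prednK ?(leq_trans k0)//.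
  by rewrite ltn_neqAle eq_sym jk' jk.
have su' : (size u <= k.-1.+1)%N by rewrite prednK.
apply: normal_typeP => //.
exists (fun l => mx2 (2 * a * A.[l]) (2 * a * (l * A.[l] - c * (qp x).[l])) u.[l] b2.[l]).
exists (fun m => mx2 (- (2 * a) * m) (- (2 * a)) (revp k.-1 u).[m] (revp k.-1 b2).[m]).
have h l : (qp x).[l] * u.[l] = 1 + l ^+ k * A.[l].
  by rewrite -hornerM uA !hornerE.
have b2E l : b2.[l] = l * u.[l] - c * l ^+ k.
  by rewrite /b2 hornerD hornerN hornerZ hornerM hornerX hornerXn.
have a2 : 2 * a != 0 by rewrite mulf_neq0// pnatr_eq0.
split.
- apply: entire_mx2; try exact: entire_horner.
  + by apply: (@entire_poly ((2 * a) *: A)) => l; rewrite !hornerE.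
  + by apply: (@entire_poly ((2 * a) *: ('X * A - c *: qp x))) => l; rewrite !hornerE.
- apply: entire_mx2; try exact: entire_horner.
  + by apply: (@entire_poly (- (2 * a) *: 'X)) => l; rewrite !hornerE.
  + by move=> z; exact: differentiable_cst.
- split=> l; rewrite unitmxE mx2_det unitfE.
    rewrite (_ : _ - _ = 2 * a * c); first by rewrite mulf_neq0.
    rewrite b2E (_ : _ - _ = 2 * a * c * ((qp x).[l] * u.[l] - l ^+ k * A.[l])); last by ring.
    by rewrite h addrK mulr1.
  rewrite (_ : _ - _ = 2 * a * c); first by rewrite mulf_neq0.
  suff e : (revp k.-1 u).[l] = c + l * (revp k.-1 b2).[l] by rewrite e; ring.
  have [->|l0] := eqVneq l 0.
    by rewrite mul0r addr0 horner_coef0 coef_poly /= subn0.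
  rewrite -[l]invrK !horner_revp ?invr_eq0// b2E.
  have lk : l^-1 ^+ k = l^-1 ^+ k.-1 * l^-1 by rewrite -exprSr prednK.
  rewrite lk; move: (l^-1 ^+ k.-1) (expf_neq0 k.-1 (invr_neq0 l0)) => L L0.
  by field; rewrite l0 L0.
move=> l l0; rewrite normal_mxE OsumE !mx2_mul !horner_revp// b2E.
have lk : l ^+ k = l ^+ k.-1 * l by rewrite -exprSr prednK.
have lk2 : l ^+ k.-1 = l ^+ (k - 2) * l by rewrite -exprSr; congr (_ ^+ _); lia.
have hl := h l; rewrite -![l ^ _]/(l^-1).
rewrite !(mulr0, mul0r, addr0, add0r).
move: (l ^+ (k - 2)) (expf_neq0 (k - 2) l0) lk2 => L L0 lk2.
rewrite lk lk2 in hl *; move: (qp x).[l] u.[l] A.[l] hl => q v w hl.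
have hq : q * v - 1 = L * l * l * w by rewrite hl; ring.
congr mx2.
- rewrite [LHS](_ : _ = 2 * a / (L * l * l * l) * (q * v - 1)); last by field; rewrite l0.
  by rewrite hq; field; rewrite l0.
- rewrite [LHS](_ : _ = 2 * a / (L * l * l) * (q * v - 1 - c * L * l * l * q / l)); last first.
    by field; rewrite l0.
  by rewrite hq; field; rewrite l0.
- by field; rewrite l0.
- by field; rewrite l0.
Qed.

Lemma nz_k : (0 < k)%N. Proof. exact: leq_trans hk. Qed.

Definition coefQ (x : V) i : C := (qp x)`_i.

(** Mreg_inverse applied to the truncation of 1/Q in degrees below k, the condition
being that the coefficient of 1/Q in degree k - 1 is nonzero. *)
Lemma Mreg_inv_coef (x : V) : quadrics x x -> coefQ x 0 != 0 -> inv_coef (coefQ x) k.-1 != 0 -> Mreg a x.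
Proof.
move=> b x0 U0; pose y := coefQ x; have k0 := nz_k.
pose u : {poly C} := \poly_(i < k) (inv_coef y i / y 0%N ^+ i.+1).
have uE i : (i < k)%N -> u`_i = inv_coef y i / y 0%N ^+ i.+1.
  by move=> ik; rewrite coef_poly ik.
pose A := drop_poly k (qp x * u - 1).
have uA : qp x * u = 1 + 'X^k * A.
  suff e : take_poly k (qp x * u - 1) = 0.
    by rewrite -[LHS](subrK 1) -{1}(poly_take_drop k (qp x * u - 1)) e add0r addrC mulrC.
  apply/polyP => n; rewrite coef_take_poly coef0.
  case: ltnP => // nk; rewrite coefB coef1 coefM.
  case: n nk => [|n] nk.
    by rewrite big_ord1 subn0 uE// inv_coef0 expr1 mul1r divff ?subrr.
  rewrite subr0 big_ord_recl subn0 uE// inv_coefS.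
  have -> : \sum_(i < n.+1) (qp x)`_(lift ord0 i) * u`_(n.+1 - lift ord0 i) =
      (\sum_(i < n.+1) y i.+1 * y 0%N ^+ i * inv_coef y (n - i)) / y 0%N ^+ n.+1.
    rewrite mulr_suml; apply: eq_bigr => i _; rewrite /= /bump /= add1n subSS uE; last first.
      exact: leq_ltn_trans (leq_subr _ _) (ltn_trans (ltnSn n) nk).
    rewrite -/(coefQ x i.+1) -/y.
    have ni : (i <= n)%N by rewrite -ltnS.
    have -> : y 0%N ^+ n.+1 = y 0%N ^+ (n - i).+1 * y 0%N ^+ i.
      by rewrite -exprD addSn subnK.
    move: (y 0%N ^+ i) (expf_neq0 i x0) => e e0.
    move: (y 0%N ^+ (n - i).+1) (expf_neq0 (n - i).+1 x0) => e' e'0.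
    by field; rewrite e0 e'0.
  rewrite -/(coefQ x 0) -/y exprS; move: (\sum_(i < _) _) => S.
  move: (y 0%N ^+ n.+1) (expf_neq0 n.+1 x0) => e e0.
  by field; rewrite e0.
apply: (@Mreg_inverse x u A) => //; first exact: size_poly.
by rewrite coef_poly prednK// leqnn mulf_neq0// invr_eq0 expf_neq0.
Qed.

Lemma quadrics_two (x : V) : (forall i, (2 <= i < k)%N -> coefQ x i = 0) -> quadrics x x.
Proof.
move=> h n /andP[n3 nk]; rewrite coefM big1// => i _; rewrite -/(coefQ x i) -/(coefQ x (n - i)).
have [i2|i2] := ltnP 1 i; first by rewrite h ?mul0r// i2 (leq_ltn_trans _ nk)// -ltnS.
by rewrite (h (n - i)%N) ?mulr0//; clear a0; lia.
Qed.

Lemma coefQ_diff i (x : V) : differentiable (fun x => coefQ x i) x.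
Proof.
have [ik|ik] := ltnP i k.+1.
  rewrite (_ : (fun x => _) = (fun x : V => x 0 (inord i))); last first.
    by apply/funext => y; rewrite /coefQ coef_poly ik.
  exact: differentiable_coord.
rewrite (_ : (fun x => _) = cst 0); first exact: differentiable_cst.
by apply/funext => y; rewrite /coefQ coef_poly ltnNge ik.
Qed.

Lemma inv_coef_diff n (x : V) : differentiable (fun x => inv_coef (coefQ x) n) x.
Proof.
elim/ltn_ind: n => -[|n] IH; first exact: differentiable_cst.
rewrite (_ : (fun x => _) = - \sum_(i < n.+1) (fun x => coefQ x i.+1 * coefQ x 0%N ^+ i
    * inv_coef (coefQ x) (n - i))); last first.
  by apply/funext => y; rewrite inv_coefS fct_sumE.
apply: differentiableN; apply: differentiable_sum => i.
apply: differentiableM; last by apply: IH; rewrite ltnS leq_subr.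
apply: differentiableM; first exact: coefQ_diff.
elim: {IH} (nat_of_ord i) => [|m IH]; first exact: differentiable_cst.
rewrite (_ : (fun x => _) = (fun x => coefQ x 0%N * coefQ x 0%N ^+ m)); last first.
  by apply/funext => y; rewrite exprS.
by apply: differentiableM; first exact: coefQ_diff.
Qed.

(** Curves with Q(0) != 0 for which 1/Q has a nonzero coefficient in degree k - 1;
the condition of Mreg_inv_coef without denominators. *)
Definition regset : set V := [set x | coefQ x 0 * inv_coef (coefQ x) k.-1 != 0].

Lemma regset_open : open regset.
Proof.
have -> : regset = (fun x : V => coefQ x 0 * inv_coef (coefQ x) k.-1) @^-1` (~` [set 0]).
  by apply/seteqP; split=> x h; [move/eqP: h => h; exact: h|apply/eqP; exact: h].
apply: open_comp => [x _|]; last first.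
  rewrite openC; apply: accessible_closed_set1; apply: hausdorff_accessible.
  exact: norm_hausdorff.
apply: differentiable_continuous; apply: differentiableM; first exact: coefQ_diff.
exact: inv_coef_diff.
Qed.

Lemma regset_Mreg (x : V) : MC a x -> regset x -> Mreg a x.
Proof.
move=> /(MC_quadrics hk a0) b; rewrite /regset /= mulf_eq0 negb_or => /andP[x0 U0].
exact: Mreg_inv_coef.
Qed.

Section Path.
Variable x : V.
Hypotheses (bx : quadrics x x) (x0 : coefQ x 0 != 0).

(** The coefficients of Q, in degrees below k, along a path from the given curve at
s = 0 to Q = x_0 (1 + l) + x_k l^k at s = 1. The coefficients in degrees 1 and 2
move linearly, those from 3 on follow from the quadratic conditions, and all of
them are polynomials in s. *)
Definition path_coef (n : nat) : {poly C} :=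
  sqr_coef ((2 * coefQ x 0)^-1)%:P (coefQ x 0)%:P ((coefQ x 1)%:P + (coefQ x 0 - coefQ x 1) *: 'X)
    ((coefQ x 2)%:P - coefQ x 2 *: 'X) n.

Definition path_pt (s : C) : V :=
  \row_(i < k.+1) (if (i < k)%N then (path_coef i).[s] else coefQ x k).

Lemma coefQ_path_pt s i : (i < k)%N -> coefQ (path_pt s) i = (path_coef i).[s].
Proof. by move=> ik; rewrite /coefQ coef_poly ltnS (ltnW ik) mxE inordK ?ik// ltnS ltnW. Qed.

Lemma path_coefE s n : (path_coef n).[s] = sqr_coef (2 * coefQ x 0)^-1 (coefQ x 0)
  (coefQ x 1 + (coefQ x 0 - coefQ x 1) * s) (coefQ x 2 - coefQ x 2 * s) n.
Proof.
rewrite -[LHS]/(horner_eval s (path_coef n)) sqr_coef_morph.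
by congr (sqr_coef _ _ _ _ n); rewrite -[LHS]/(_.[s]) !hornerE.
Qed.

(** The coefficient of degree n + 1 of a square vanishes iff the coefficient y (n + 1)
is the one prescribed by sqr_coef. *)
Lemma sqr_recursion (y : nat -> C) c n : y 0%N != 0 -> c = (2 * y 0%N)^-1 ->
  \sum_(i < n.+2) y i * y (n.+1 - i)%N =
  2 * y 0%N * (y n.+1 - - c * \sum_(i < n) y i.+1 * y (n - i)%N).
Proof.
move=> y0 ->; rewrite big_ord_recl big_ord_recr /= subn0 /bump /= add1n subnn.
under eq_bigr => i _ do rewrite add1n subSS.
move: (\sum_(i < n) _) => S.
by field; rewrite y0.
Qed.

Lemma path_quadrics s : quadrics (path_pt s) (path_pt s).
Proof.
move=> [//|n] /andP[n3 nk]; rewrite coefM.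
have c0 : coefQ (path_pt s) 0 = coefQ x 0 by rewrite coefQ_path_pt ?nz_k// path_coefE.
rewrite (@sqr_recursion (coefQ (path_pt s)) (2 * coefQ x 0)^-1) ?c0//.
rewrite coefQ_path_pt// path_coefE sqr_coefS//.
rewrite [X in _ * X](_ : _ = 0) ?mulr0//; apply/eqP; rewrite subr_eq0; apply/eqP.
congr (_ * _); apply: eq_bigr => i _.
rewrite !coefQ_path_pt ?path_coefE//; first exact: leq_ltn_trans (leq_subr _ _) (ltnW nk).
exact: leq_ltn_trans (ltn_ord i) (ltnW nk).
Qed.

Lemma path_start : path_pt 0 = x.
Proof.
have h n : (n < k)%N -> (path_coef n).[0] = coefQ x n.
  elim/ltn_ind: n => n IH nk; rewrite path_coefE !mulr0 addr0 subr0.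
  case: n IH nk => [|[|[|n]]]// IH nk; rewrite sqr_coefS//.
  have := bx (n := n.+3); rewrite nk => /(_ isT); rewrite coefM.
  rewrite (@sqr_recursion (coefQ x) (2 * coefQ x 0)^-1)// => /eqP.
  rewrite mulf_eq0 mulf_eq0 pnatr_eq0 (negbTE x0) /= subr_eq0 => /eqP ->.
  congr (_ * _); apply: eq_bigr => i _.
  have e m : (m < n.+3)%N -> sqr_coef (2 * coefQ x 0)^-1 (coefQ x 0) (coefQ x 1) (coefQ x 2) m = coefQ x m.
    move=> mn; have := IH m mn (ltn_trans mn nk).
    by rewrite path_coefE !mulr0 addr0 subr0.
  by rewrite !e//; have := ltn_ord i; lia.
apply/rowP => i; rewrite mxE; case: ltnP => ik; first by rewrite h// /coefQ coef_poly ltn_ord inord_val.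
have -> : i = inord k by apply/val_inj; rewrite /= inordK//; apply/eqP; rewrite eqn_leq ik -ltnS ltn_ord.
by rewrite /coefQ coef_poly ltnS leqnn.
Qed.

(** As a polynomial in s, the coefficient of 1/Q in degree k - 1, without
denominators. Being nonzero at s = 1, where 1/Q is a geometric series below
degree k, it has finitely many zeros, so regular curves accumulate at s = 0. *)
Definition path_det : {poly C} := inv_coef path_coef k.-1.

Lemma path_detE s : path_det.[s] = inv_coef (coefQ (path_pt s)) k.-1.
Proof.
have -> : path_det.[s] = horner_eval s path_det by [].
rewrite /path_det inv_coef_morph; apply: inv_coef_eq => i hi.
by rewrite coefQ_path_pt//= -(prednK nz_k) ltnS.
Qed.

Lemma path_det_neq0 : path_det != 0.
Proof.
have endE m : (path_coef m).[1] = sqr_coef (2 * coefQ x 0)^-1 (coefQ x 0) (coefQ x 0) 0 m.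
  by rewrite path_coefE !mulr1 subrr addrC subrK.
have end0 m : (2 <= m)%N -> sqr_coef (2 * coefQ x 0)^-1 (coefQ x 0) (coefQ x 0) 0 m = 0.
  elim/ltn_ind: m => -[|[|[|m]]]// IH _; rewrite sqr_coefS// big1 ?mulr0// => -[[|i] hi] _ /=.
    by rewrite subn0 (IH m.+2) ?mulr0.
  by rewrite (IH i.+2) ?mul0r.
apply/eqP => h; have := path_detE 1; rewrite h horner0 inv_coef_two => [|i /andP[i2 ik]].
  rewrite coefQ_path_pt ?endE; last exact: leq_trans hk.
  by move=> /esym/eqP; rewrite expf_eq0 oppr_eq0 (negbTE x0) andbF.
by rewrite coefQ_path_pt ?endE ?end0// -(prednK nz_k) ltnS.
Qed.

Lemma path_density : closure (@Mcoord R k a `&` regset) x.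
Proof.
move=> B nB.
have cont : {for (0 : C), continuous path_pt}.
  apply: differentiable_continuous; apply: differentiable_mx => i j; rewrite ord1.
  have [jk|jk] := ltnP j k.
    rewrite (_ : (fun s => _) = horner (path_coef j)); first exact: entire_horner.
    by apply/funext => s; rewrite mxE jk.
  rewrite (_ : (fun s => _) = cst (coefQ x k)); first exact: differentiable_cst.
  by apply/funext => s; rewrite mxE ltnNge jk.
have : \forall s \near (0 : C), B (path_pt s).
  by apply: cont; rewrite path_start.
move/nbhsC_n1 => [r r0 Hr].
have [s sr ps] : exists2 s, n1 s < r & path_det.[s] != 0.
  apply: contrapT => H.
  (* Among the small real numbers r / (i + 2) there are more points than roots. *)
  have := max_poly_roots path_det_neq0 (rs := [seq ((r / (i.+2)%:R)%:C)%C | i <- iota 0 (size path_det)]).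
  rewrite size_map size_iota ltnn => G; suff : false by [].
  apply: G.
    apply/allP => z /mapP[i _ ->]; apply/negPn/negP => nz.
    apply: H; exists ((r / (i.+2)%:R)%:C)%C => //.
    rewrite n1_real ger0_norm ?divr_ge0 ?(ltW r0)// ltr_pdivrMr ?ltr0n//.
    by rewrite ltr_pMr// ltr1n.
  rewrite map_inj_uniq ?iota_uniq// => i j [] /(mulfI (lt0r_neq0 r0)) /invr_inj /eqP.
  by rewrite eqr_nat => /eqP [].
exists (path_pt s); split; last by apply: Hr; rewrite subr0.
have c0 : coefQ (path_pt s) 0 = coefQ x 0 by rewrite coefQ_path_pt ?nz_k// path_coefE.
split; last by rewrite /regset /= c0 -path_detE mulf_neq0.
split; first exact: (curve_ex a hk (path_quadrics s)).
have : coefQ (path_pt s) 0 != 0 by rewrite c0.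
rewrite /coefQ coef_poly /=; congr (path_pt s 0 _ != 0).
by apply/val_inj; rewrite /= inordK.
Qed.

End Path.

Lemma generic_regular : generically (@Mcoord R k a) (Mreg a).
Proof.
exists regset; split; first exact: regset_open.
  by move=> x [[mx _] rx]; exact: regset_Mreg.
move=> x [mx xn]; apply: path_density; first exact: MC_quadrics mx.
move: xn; rewrite /coefQ coef_poly /=; congr (x 0 _ != 0).
by apply/val_inj; rewrite /= inordK.
Qed.

End Regular.

(** * The line of jumping curves *)

Section JumpingCurve.
Variable R : realType.
Local Notation C := (Cx R).
Variables (k : nat) (a : C).
Hypothesis hk : (3 <= k)%N.
Hypothesis a0 : a != 0.
Local Notation V := 'rV[C]_k.+1.

(** The coefficient vector of Q = l^k. The constant vector field ek generates the
symmetries Q + s l^k, tau - a (2 s Q + s^2 l^k), which fix the fibre coordinate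
tau of the chart at infinity and translate the other one. *)
Definition ek : V := delta_mx 0 ord_max.

Lemma ek_neq0 : ek != 0.
Proof. by apply/eqP => /rowP/(_ ord_max)/eqP; rewrite !mxE !eqxx oner_eq0. Qed.

Lemma qp_ek : qp ek = 'X^k.
Proof.
apply/polyP => i; rewrite coef_poly coefXn; case: ltnP => ik.
  by rewrite mxE eqxx /= -val_eqE /= inordK.
by have [e|//] := eqVneq i k; move: ik; rewrite e ltnn.
Qed.

Lemma quadrics_ek (x : V) : quadrics x ek.
Proof. by move=> n /andP[_ nk]; rewrite qp_ek coefMXn nk. Qed.

(** Q = e (1 + l) + c l^k: for e = 0 a point of the jumping curve, for e != 0 a
regular curve, and a curve of the twistor space for every e because Q^2 has no
terms in degrees 3 to k - 1. *)
Definition two_pt (e c : C) : V :=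
  \row_(i < k.+1) (if (i < 2)%N then e else if i == k :> nat then c else 0).

Lemma coefQ_two_pt e c i : (i < k.+1)%N ->
  coefQ (two_pt e c) i = if (i < 2)%N then e else if i == k then c else 0.
Proof. by move=> ik; rewrite /coefQ coef_poly ik mxE inordK. Qed.

Lemma quadrics_two_pt e c : quadrics (two_pt e c) (two_pt e c).
Proof.
apply: (quadrics_two hk) => i /andP[i2 ik]; rewrite coefQ_two_pt; last exact: ltnW.
by rewrite ltnNge i2 /= ltn_eqF.
Qed.

Lemma Mreg_two_pt e c : e != 0 -> Mreg a (two_pt e c).
Proof.
move=> e0; apply: Mreg_inv_coef => //; first exact: quadrics_two_pt.
  by rewrite coefQ_two_pt.
have k0 : (0 < k)%N by lia.
have k1 : (1 < k.+1)%N by lia.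
rewrite inv_coef_two; first by rewrite coefQ_two_pt// expf_neq0 ?oppr_eq0.
move=> i /andP[i2 ik]; have ik' : (i < k)%N by rewrite -(prednK k0) ltnS.
by rewrite coefQ_two_pt; [rewrite ltnNge i2 /= ltn_eqF|exact: ltnW].
Qed.

Lemma two_pt0 c : two_pt 0 c = c *: ek.
Proof.
apply/rowP => i; rewrite !mxE eqxx /= -val_eqE /=.
case: ifP => [i2|_].
  have -> : (i == k :> nat) = false by apply/negbTE; rewrite neq_ltn (leq_trans i2)// ltnW.
  by rewrite mulr0.
by case: ifP => _; rewrite ?mulr1 ?mulr0.
Qed.

Definition gamma : set V := [set c *: ek | c in [set: C]].

Lemma gamma_MC x : gamma x -> MC a x.
Proof. by case=> c _ <-; apply: curve_ex => //; rewrite -two_pt0; exact: quadrics_two_pt. Qed.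

Lemma gamma_closure x : gamma x -> closure (Mreg a) x.
Proof.
case=> c _ <- B nB.
have cont : {for (0 : C), continuous (two_pt^~ c)}.
  apply: differentiable_continuous; apply: differentiable_mx => i j; rewrite ord1.
  have [j2|j2] := ltnP j 2.
    rewrite (_ : (fun e => _) = id) //; apply/funext => e; rewrite mxE j2.
    by [].
  rewrite (_ : (fun e => _) = cst (if j == k :> nat then c else 0)); first exact: differentiable_cst.
  by apply/funext => e; rewrite mxE ltnNge j2.
have : \forall e \near (0 : C), B (two_pt e c) by apply: cont; rewrite two_pt0.
move/nbhsC_n1 => [r r0 Hr].
have r2 : r / 2 < r by lra.
exists (two_pt ((r / 2)%:C)%C c); split.
  by apply: Mreg_two_pt; rewrite gt_eqF// realC_pos// divr_gt0.
by apply: Hr; rewrite subr0 n1_real ger0_norm// divr_ge0// ltW.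
Qed.

(** For Q = c l^k the off-diagonal term 2 a l^-2 Q = 2 a c l^(k-2) of the transition
matrix is a constant multiple of the diagonal entry below it, so a constant
change of frame over one chart splits the bundle. *)
Lemma gamma_normal_type x : gamma x -> normal_type a x k%:Z (2 - k%:Z).
Proof.
case=> c _ <-; apply: normal_typeP => //; first by rewrite -two_pt0; exact: quadrics_two_pt.
exists (fun=> mx2 1 (2 * a * c) 0 1), (fun=> 1%:M); split.
- by move=> z; exact: differentiable_cst.
- by move=> z; exact: differentiable_cst.
- split=> l; rewrite ?unitmx1// unitmxE mx2_det mulr1 mulr0 subr0.
  exact: unitr1.
move=> l l0; rewrite mulmx1 normal_mxE OsumE mx2_mul !(mulr0, mul0r, addr0, add0r, mul1r).
have -> : qp (c *: ek) = c *: 'X^k.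
  by have := qpD c ek 0; rewrite !addr0 qp_ek => ->; rewrite (_ : qp 0 = 0) ?addr0//;
     apply/polyP => i; rewrite coef_poly mxE coef0 if_same.
have -> : l ^ (- k%:Z) = l ^- k by rewrite -exprnN.
have -> : l ^ (- (2 - k%:Z)) = l ^+ (k - 2).
  by rewrite opprB exprnP -subzn// (leq_trans _ hk).
rewrite hornerZ hornerXn; congr mx2.
have -> : l ^+ k = l ^+ (k - 2) * l ^+ 2 by rewrite -exprD subnK// (leq_trans _ hk).
by field; rewrite l0.
Qed.

Lemma curve_is_derive (z : C) : is_derive z (1 : C) (fun z : C => z *: ek) ek.
Proof.
rewrite is_derive_epsP => e e0; exists 1 => // h _.
rewrite (_ : (h *: (1 : C) + z) *: ek - z *: ek - h *: ek = 0).
  by rewrite normr0 mulr_ge0// ltW.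
rewrite scalerDl (_ : h *: (1 : C) = h); last exact: mulr1.
by rewrite addrK subrr.
Qed.

(** The plane is a union of real lines through 0. *)
Lemma connected_C : connected [set: C].
Proof.
have -> : [set: C] = \bigcup_(z in [set: C]) [set ((t : R)%:C)%C * z | t in [set: R]].
  apply/seteqP; split=> // z _; exists z => //; exists 1 => //.
  by rewrite mul1r.
apply: bigcup_connected.
  by exists 0 => z _; exists 0 => //; rewrite mul0r.
move=> z _; apply: connected_continuous_connected.
  by apply/connected_intervalP.
apply: continuous_subspaceT => t B /nbhsC_n1[r r0 Hr].
have Z0 : 0 < n1 z + 1 by rewrite ltr_wpDl ?n1_ge0.
apply/nbhs_ballP; exists (r / (n1 z + 1)) => /=; first by rewrite divr_gt0.
move=> u; rewrite /ball /= ltr_pdivlMr// => ut; apply: Hr.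
rewrite -mulrBl -rmorphB /=; apply: (le_lt_trans (n1M _ _)); rewrite n1_real distrC.
by apply: le_lt_trans ut; rewrite ler_wpM2l// lerDl.
Qed.

Lemma gamma_holo_curve : holo_curve gamma.
Proof.
exists [set: C], (fun z => z *: ek); split=> //.
- exact: openT.
- exact: connected_C.
- by exists 0.
- move=> z w _ _ /eqP; rewrite -subr_eq0 -scalerBl scaler_eq0 (negbTE ek_neq0) orbF subr_eq0.
  by move=> /eqP.
split=> // z _; have d := curve_is_derive z; split.
  by apply/derivable1_diffP; case: d.
by have [_ ->] := d; exact: ek_neq0.
Qed.

Lemma gammaP (x : V) : (forall i : 'I_k.+1, (i < k)%N -> x 0 i = 0) -> gamma x.
Proof.
move=> h; exists (x 0 ord_max) => //; apply/rowP => i; rewrite !mxE eqxx /= -val_eqE /=.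
have [ik|ik] := eqVneq (i : nat) k.
  by rewrite mulr1; congr (x 0 _); apply/val_inj.
by rewrite mulr0 h// ltn_neqAle ik -ltnS ltn_ord.
Qed.

(** Along an integral curve the coordinates x_0, ..., x_(k-1) have derivative zero. *)
Lemma gamma_preserved : preserved_by (fun=> ek) gamma.
Proof.
move=> r c r0 dc [w _ cw] z zr; apply: gammaP => i ik.
pose f u := c u 0 i.
have df u : `|u| < r -> cdiff f u 0.
  move=> ur; apply/is_derive1_cdiff; have := is_derive_entry 0 i (dc u ur).
  by rewrite mxE eqxx /= -val_eqE /= ltn_eqF.
have -> : c z 0 i = f (0 + z) by rewrite add0r.
rewrite cdiff0_const => [|s /andP[s0 s1]].
  by rewrite /f -cw !mxE eqxx /= -val_eqE /= ltn_eqF// mulr0.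
apply: df; rewrite add0r normrM (le_lt_trans _ zr)// ler_piMl//.
by rewrite normc_def /= expr0n addr0 sqrtr_sqr ger0_norm// -[1]/((1%:C)%C) lecR.
Qed.

Lemma vector_field_ek : vector_field a (fun=> ek).
Proof.
split; first by move=> x _; exact: differentiable_cst.
move=> x mx; exists (deform a x ek), (deform_inf a x ek).
by apply: deformation_ex => //; exact: quadrics_ek.
Qed.

Lemma ek_regular : exists2 x : V, Mreg a x & ek != 0.
Proof. by exists (two_pt 1 0); [apply: Mreg_two_pt; exact: oner_neq0|exact: ek_neq0]. Qed.

End JumpingCurve.

(** * Tangent spaces at regular curves *)

Section TangentDimension.
Variable R : realType.
Local Notation C := (Cx R).
Variables (k : nat) (a : C).
Local Notation V := 'rV[C]_k.+1.

Lemma entire_mulmx (f : C -> 'rV[C]_2) (H : C -> 'M[C]_2) : entire f -> entire H ->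
  forall j, entire (fun l => (f l *m H l) 0 j).
Proof.
move=> ef eH j z.
rewrite (_ : (fun l => _) = (fun l => f l 0 0 * H l 0 j) + (fun l => f l 0 1 * H l 1 j)).
  by apply: differentiableD; apply: differentiableM; apply: differentiable_entry;
    (exact: ef || exact: eH).
apply/funext => l; rewrite mxE !big_ord_recl big_ord0 addr0.
by rewrite (_ : lift ord0 ord0 = 1)//; exact/val_inj.
Qed.

(** A section of O(1) that vanishes at infinity grows slower than linearly, so it is
constant by liouville. *)
Lemma section_O1_eq0 (e et : C -> C) : entire e -> entire et ->
  (forall l, l != 0 -> et l^-1 = l^-1 * e l) -> e 0 = 0 -> et 0 = 0 -> forall l, e l = 0.
Proof.
move=> ee eet pat e0 et0 l; rewrite -e0; apply: liouville; first exact: entire_cdiff.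
move=> eps eps0; have [D dD] := entire_cdiff eet 0; have [r r0 Hr] := cdiff_cont dD eps0.
exists (1 + 4 / r) => z hz.
have q : 0 < 4 / r by rewrite divr_gt0.
have z0 : z != 0 by apply/eqP => z0; move: hz; rewrite z0 n10; lra.
have nz := n1_gt0 z0; have kV := n1V z.
have zV : n1 z^-1 <= 2 / n1 z by rewrite ler_pdivlMr// mulrC.
have zVr : n1 z^-1 < r.
  apply: (le_lt_trans zV); rewrite ltr_pdivrMr// mulrC -ltr_pdivrMr//.
  have : 2 / r <= 4 / r by rewrite ler_pM2r ?invr_gt0// ler_nat.
  lra.
have := Hr _ zVr; rewrite add0r et0 subr0 pat// => h.
rewrite -[e z]mul1r -(divff z0) -mulrA; apply: (le_trans (n1M _ _)).
by rewrite mulrC ler_wpM2r ?n1_ge0.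
Qed.

(** The tangent space at a regular curve has dimension at most 4. In a frame where
the normal bundle is O(1) + O(1), five deformations have dependent values at 0
and infinity, a vector in C^2 x C^2; the combination vanishing at both points is
zero by section_O1_eq0. *)
Lemma TM_dependent (x : V) (v : 'I_5 -> V) : Mreg a x -> (forall i, TM a x (v i)) ->
  exists2 y : 'rV[C]_5, y != 0 & \sum_i y 0 i *: v i = 0.
Proof.
move=> [s [st [cu [H [Ht [eH eHt [uH uHt] HG]]]]]] tv.
have dv i : exists d dt : C -> 'rV[C]_2, [/\ entire d, entire dt,
    forall l, l != 0 -> dt l^-1 = d l *m normal_mx a x l & forall l, d l 0 0 = Qpoly (v i) l].
  have [d [dt [s' [st' [cu' [ed edt ddt] d0]]]]] := tv i.
  by exists d, dt; split=> // l l0; rewrite ddt// (normal_patchE a (cu'.2 l)).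
pose d i := sval (cid (dv i)); pose dt i := sval (cid (svalP (cid (dv i)))).
have dP i : [/\ entire (d i), entire (dt i),
    forall l, l != 0 -> dt i l^-1 = d i l *m normal_mx a x l & forall l, d i l 0 0 = Qpoly (v i) l].
  exact: svalP (cid (svalP (cid (dv i)))).
clearbody d dt; pose M : 'M[C]_(5, 2 + 2) := \matrix_i row_mx (d i 0 *m H 0) (dt i 0 *m Ht 0).
have [y y0 yM] : exists2 y : 'rV[C]_5, y != 0 & y *m M = 0.
  have kn0 : kermx M != 0.
    by rewrite -mxrank_eq0 mxrank_ker -lt0n subn_gt0; exact: leq_ltn_trans (rank_leq_col M) _.
  exists (nz_row (kermx M)); first by rewrite nz_row_eq0.
  by apply/sub_kermxP; exact: nz_row_sub.
exists y => //.
pose D l := \sum_i y 0 i *: d i l; pose Dt l := \sum_i y 0 i *: dt i l.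
have entire_comb (f : 'I_5 -> C -> 'rV[C]_2) : (forall i, entire (f i)) ->
    entire (fun l => \sum_i y 0 i *: f i l).
  move=> ef z; rewrite (_ : (fun l => _) = \sum_i (y 0 i \*: f i)).
    by apply: differentiable_sum => i; apply: differentiableZ; exact: ef.
  by apply/funext => l; rewrite fct_sumE.
have eD : entire D by apply: entire_comb => i; have [] := dP i.
have eDt : entire Dt by apply: entire_comb => i; have [] := dP i.
have DDt l : l != 0 -> Dt l^-1 *m Ht l^-1 = l^-1 *: (D l *m H l).
  move=> l0; have -> : Dt l^-1 = D l *m normal_mx a x l.
    rewrite /Dt /D mulmx_suml; apply: eq_bigr => i _; have [_ _ -> //] := dP i.
    by rewrite scalemxAl.
  rewrite -mulmxA -(normal_patchE a (cu.2 l)) HG// mulmxA OsumE.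
  by rewrite (_ : mx2 _ 0 0 _ = (l^-1)%:M) ?mul_mx_scalar//; apply/matrixP => i j;
    rewrite !mxE; have [->|->] := ord2P i; have [->|->] := ord2P j.
have yD : D 0 *m H 0 = 0.
  apply/rowP => j; move/matrixP: (yM) => /(_ 0 (lshift 2 j)).
  rewrite mxE [RHS]mxE => e; rewrite [RHS]mxE -[RHS]e.
  rewrite mulmx_suml summxE; apply: eq_bigr => i _.
  rewrite -scalemxAl mxE; congr (_ * _); rewrite /M [RHS]mxE.
  by rewrite row_mxEl.
have yDt : Dt 0 *m Ht 0 = 0.
  apply/rowP => j; move/matrixP: (yM) => /(_ 0 (rshift 2 j)).
  rewrite mxE [RHS]mxE => e; rewrite [RHS]mxE -[RHS]e.
  rewrite mulmx_suml summxE; apply: eq_bigr => i _.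
  rewrite -scalemxAl mxE; congr (_ * _); rewrite /M [RHS]mxE.
  by rewrite row_mxEr.
have DH l : D l *m H l = 0.
  apply/rowP => j; rewrite [RHS]mxE; move: l.
  apply: (@section_O1_eq0 (fun l => (D l *m H l) 0 j) (fun l => (Dt l *m Ht l) 0 j)).
  - exact: entire_mulmx.
  - exact: entire_mulmx.
  - by move=> l l0; rewrite DDt// [LHS]mxE.
  - by rewrite yD mxE.
  - by rewrite yDt mxE.
have D0 l : D l = 0.
  by have := congr1 (mulmxr (invmx (H l))) (DH l); rewrite /= mulmxK// mul0mx.
apply: qp_inj => l; rewrite -QpolyE.
have -> : Qpoly (\sum_i y 0 i *: v i) l = D l 0 0.
  rewrite /D summxE /Qpoly; under eq_bigr => j _ do rewrite summxE mulr_suml.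
  rewrite exchange_big /=; apply: eq_bigr => i _; have [_ _ _ d0] := dP i.
  by rewrite mxE d0 /Qpoly mulr_sumr; apply: eq_bigr => j _; rewrite mxE mulrA.
by rewrite D0 mxE.
Qed.

(** A holomorphic chart of the regular locus has rank 4, so by TM_dependent its
partial derivatives span the tangent space. *)
Lemma TM_rowspace (x w : V) (J : 'M[C]_(4, k.+1)) : Mreg a x -> row_free J ->
  (forall i, TM a x (row i J)) -> TM a x w -> exists z, w = z *m J.
Proof.
move=> rx fJ tJ tw; pose K := col_mx J w : 'M[C]_(4 + 1, k.+1).
have tK (i : 'I_(4 + 1)) : TM a x (row i K).
  have [j ->|j ->] := @split_ordP 4 1 i; first by rewrite /K rowKu.
  by rewrite /K rowKd ord1 row_id.
have [y y0 yK] := TM_dependent rx tK.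
have {}yK : lsubmx (y : 'rV[C]_(4 + 1)) *m J + rsubmx (y : 'rV[C]_(4 + 1)) *m w = 0.
  by rewrite -mul_row_col hsubmxK -yK mulmx_sum_row.
set y1 := lsubmx _ in yK; set y2 := rsubmx _ in yK.
have [e|ne] := eqVneq (y2 0 0) 0.
  have y20 : y2 = 0 by rewrite [y2]mx11_scalar e raddf0.
  have y10 : y1 = 0.
    by apply: (row_free_inj fJ); rewrite mul0mx -yK y20 mul0mx addr0.
  by move: y0; rewrite -[y](@hsubmxK _ 1 4 1) -/y1 -/y2 y10 y20 row_mx0 eqxx.
exists (- (y2 0 0)^-1 *: y1); rewrite -scalemxAl.
have : y1 *m J = - (y2 0 0 *: w).
  have y2w : y2 *m w = y2 0 0 *: w by rewrite {1}[y2]mx11_scalar mul_scalar_mx.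
  by apply/eqP; rewrite -addr_eq0 -y2w yK.
by move=> ->; rewrite scalerN scaleNr opprK scalerA mulVf// scale1r.
Qed.

End TangentDimension.

(** * Invariance of the forms under the translation *)

Section Trilinear.
Variable R : realType.
Local Notation C := (Cx R).
Variable n : nat.
Local Notation V := 'rV[C]_n.

Definition trilinear (T : V -> V -> V -> C) : Prop :=
  [/\ forall c x y v w, T (c *: x + y) v w = c * T x v w + T y v w,
      forall c x v y w, T x (c *: v + y) w = c * T x v w + T x y w
    & forall c x v w y, T x v (c *: w + y) = c * T x v w + T x v y].

Lemma lin_sum (L : V -> C) (I : finType) (c : I -> C) (v : I -> V) :
  (forall b x y, L (b *: x + y) = b * L x + L y) ->
  L (\sum_i c i *: v i) = \sum_i c i * L (v i).
Proof.
move=> hL; have L0 : L 0 = 0.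
  by have := hL 1 0 0; rewrite scale1r addr0 mul1r => /eqP; rewrite eq_sym -subr_eq0 addrK => /eqP.
elim/big_rec2 : _ => // i y1 y2 _ <-; exact: hL.
Qed.

(** The expansion in coordinates, which reduces differentiation to products. *)
Lemma trilinear_expand T x v w : trilinear T -> T x v w = \sum_p \sum_q \sum_r
  x 0 p * (v 0 q * (w 0 r * T (delta_mx 0 p) (delta_mx 0 q) (delta_mx 0 r))).
Proof.
move=> [T1 T2 T3]; rewrite {1}[x]row_sum_delta.
rewrite (@lin_sum (fun x => T x v w))//; apply: eq_bigr => p _.
rewrite {1}[v]row_sum_delta (@lin_sum (fun v => T _ v w))// mulr_sumr; apply: eq_bigr => q _.
rewrite {1}[w]row_sum_delta (@lin_sum (fun w => T _ _ w))// !mulr_sumr; apply: eq_bigr => r _.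
by [].
Qed.

Lemma is_derive_sum_pt (W : normedModType C) m (f : 'I_m -> W -> C) (df : 'I_m -> C) a d :
  (forall i, is_derive a d (f i) (df i)) ->
  is_derive a d (fun x => \sum_i f i x) (\sum_i df i).
Proof.
move=> h; rewrite (_ : (fun x => _) = \sum_i f i); last first.
  by apply/funext => x; rewrite fct_sumE.
exact: is_derive_sum.
Qed.

Lemma is_deriveM_pt (W : normedModType C) (f g : W -> C) (df dg : C) a d :
  is_derive a d f df -> is_derive a d g dg ->
  is_derive a d (fun x => f x * g x) (df * g a + f a * dg).
Proof.
move=> h1 h2; apply: (is_derive_eq (is_deriveM h1 h2)).
by rewrite addrC /GRing.scale /= [g a * df]mulrC.
Qed.

Lemma is_derive_trilinear (W : normedModType C) (T : V -> V -> V -> C)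
    (f g h : W -> V) (df dg dh : V) a d : trilinear T ->
  (forall p, is_derive a d (fun x => f x 0 p) (df 0 p)) ->
  (forall p, is_derive a d (fun x => g x 0 p) (dg 0 p)) ->
  (forall p, is_derive a d (fun x => h x 0 p) (dh 0 p)) ->
  is_derive a d (fun x => T (f x) (g x) (h x))
    (T df (g a) (h a) + T (f a) dg (h a) + T (f a) (g a) dh).
Proof.
move=> tT hf hg hh; set t := fun p q r => T (delta_mx 0 p) (delta_mx 0 q) (delta_mx 0 r).
rewrite (_ : (fun x => _) = (fun x => \sum_p \sum_q \sum_r
  f x 0 p * (g x 0 q * (h x 0 r * t p q r)))); last first.
  by apply/funext => x; rewrite (trilinear_expand _ _ _ tT).
have d3 p q r := is_deriveM_pt (hf p) (is_deriveM_pt (hg q)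
  (is_deriveM_pt (hh r) (is_derive_cst (t p q r) a d))).
have := is_derive_sum_pt (fun p => is_derive_sum_pt (fun q => is_derive_sum_pt (fun r => d3 p q r))).
move=> H; apply: (is_derive_eq H); rewrite !(trilinear_expand _ _ _ tT) -!big_split.
apply: eq_bigr => p _; rewrite -!big_split; apply: eq_bigr => q _.
rewrite -!big_split; apply: eq_bigr => r _ /=.
rewrite -/(t p q r); move: (t p q r) => c; ring.
Qed.

End Trilinear.

Section LieForms.
Variable R : realType.
Local Notation C := (Cx R).
Variables (k : nat) (a : C).
Hypothesis hk : (3 <= k)%N.
Hypothesis a0 : a != 0.
Local Notation V := 'rV[C]_k.+1.

(** The quadratic conditions hold along the chart; the vanishing of their
derivatives is twice the polarised condition. *)
Lemma rows_quadrics U (phi : 'rV[C]_4 -> V) u i : param a U phi -> U u ->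
  quadrics (phi u) (row i (jacobian phi u)).
Proof.
move=> [oU hU rU _] Uu n hn.
have dphi : differentiable phi u by exact: hU.
have dcf j : is_derive u (delta_mx 0 i) (fun w => coefQ (phi w) j) (coefQ (row i (jacobian phi u)) j).
  have [jk|jk] := ltnP j k.+1.
    have -> : (fun w => coefQ (phi w) j) = (fun w => phi w 0 (inord j)).
      by apply/funext => w; rewrite /coefQ coef_poly jk.
    by rewrite /coefQ coef_poly jk mxE; exact: jacobian_entry.
  have cf0 (y : V) : coefQ y j = 0 by rewrite /coefQ coef_poly ltnNge jk.
  rewrite cf0 (_ : (fun w => _) = cst 0); first exact: is_derive_cst.
  by apply/funext => w; rewrite cf0.
have d1 := is_derive_sum_pt (fun j : 'I_n.+1 => is_deriveM_pt (dcf j) (dcf (n - j)%N)).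
have d0 : is_derive u (delta_mx 0 i) (fun w => \sum_(j < n.+1) coefQ (phi w) j * coefQ (phi w) (n - j)) 0.
  apply: (near_eq_is_derive (f := cst 0)).
  have : \forall w \near u, U w by exact: open_nbhs_nbhs.
  apply: filterS => w Uw; have [s [st [cu _]]] := rU w Uw.
  have := MC_quadrics hk a0 (ex_intro _ s (ex_intro _ st cu)) hn.
  by rewrite coefM.
have e := is_derive_unique d1 d0.
set S := (qp (phi u) * qp (row i (jacobian phi u)))`_n.
suff : S + S = 0 by move/eqP; rewrite -mulr2n mulrn_eq0 => /eqP.
rewrite -[RHS]e big_split /= /S {1}mulrC !coefM.
by [].
Qed.

(** The two-form dQ ^ dtau at the parameter l, on tangent vectors v and w at x,
extended by the explicit formula for tau to a trilinear function of arbitrary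
vectors, so that it can be differentiated in the ambient space. *)
Definition beta (l : C) (x v w : V) : C :=
  (qp v).[l] * (deform_tau a x w).[l] - (qp w).[l] * (deform_tau a x v).[l].

Lemma deform_tauE (x v : V) l : (deform_tau a x v).[l] = - (2 * a) * (drop_poly k (qp x * qp v)).[l].
Proof. by rewrite /deform_tau hornerZ. Qed.

Lemma drop_polyD n c (p q : {poly C}) : drop_poly n (c *: p + q) = c *: drop_poly n p + drop_poly n q.
Proof. by rewrite linearP. Qed.

Lemma deform_tau_linl c (x y v : V) l : (deform_tau a (c *: x + y) v).[l] = c * (deform_tau a x v).[l] + (deform_tau a y v).[l].
Proof. by rewrite !deform_tauE qpD [_ * qp v]mulrDl -scalerAl drop_polyD hornerD hornerZ; ring. Qed.

Lemma deform_tau_linr c (x v w : V) l : (deform_tau a x (c *: v + w)).[l] = c * (deform_tau a x v).[l] + (deform_tau a x w).[l].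
Proof. by rewrite !deform_tauE qpD mulrDr -scalerAr drop_polyD hornerD hornerZ; ring. Qed.

Lemma horner_qpD c (x y : V) l : (qp (c *: x + y)).[l] = c * (qp x).[l] + (qp y).[l].
Proof. by rewrite qpD hornerD hornerZ. Qed.

Lemma beta_trilinear l : trilinear (beta l).
Proof.
split=> *; rewrite /beta.
- by rewrite !deform_tau_linl; ring.
- by rewrite deform_tau_linr horner_qpD; ring.
- by rewrite deform_tau_linr horner_qpD; ring.
Qed.

(** The derivative of beta in the base point, in the direction ek, vanishes: the
tau-component becomes a multiple of the Q-component. This is the invariance of
dQ ^ dtau under the translation by l^k. *)
Lemma beta_ek l v w : beta l (ek R k) v w = 0.
Proof.
have e x : (deform_tau a (ek R k) x).[l] = - (2 * a) * (qp x).[l].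
  by rewrite deform_tauE qp_ek ['X^k * _]mulrC drop_polyMXn_id.
by rewrite /beta !e; ring.
Qed.

(** A quadratic polynomial in l is determined by its values at 0, 1 and -1, so each of
the three forms is a fixed combination of the values of dQ ^ dtau there. *)
Definition sigma_combination (b : tensor2 R k) := exists c0 c1 c2 : C,
  forall x v w, MC a x -> quadrics x v -> quadrics x w ->
  b x v w = c0 * beta 0 x v w + c1 * beta 1 x v w + c2 * beta (-1) x v w.

Lemma sigma_combinationP S00 S01 S11 : sigma_forms a S00 S01 S11 ->
  [/\ sigma_combination S00, sigma_combination S01 & sigma_combination S11].
Proof.
move=> hS.
have E x v w l : MC a x -> quadrics x v -> quadrics x w ->
    beta l x v w = S11 x v w - 2 * l * S01 x v w + l ^+ 2 * S00 x v w.
  move=> mx bv bw.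
  have := hS x v w _ _ _ _ (deformation_ex hk mx bv) (deformation_ex hk mx bw) l.
  by rewrite /deform !row2E.
split.
- exists (-1), 2^-1, 2^-1 => x v w mx bv bw; rewrite !E//; field.
  by [].
- exists 0, (- 4^-1), 4^-1 => x v w mx bv bw; rewrite !E//; field.
  by [].
- exists 1, 0, 0 => x v w mx bv bw; rewrite !E//; ring.
Qed.

Lemma second_derivatives U (phi : 'rV[C]_4 -> V) u : param a U phi -> U u ->
  exists HH : 'I_4 -> 'I_4 -> V, (forall i l, HH i l = HH l i) /\
    forall i l p, is_derive u (delta_mx 0 l) (fun w => jacobian phi w i p) (HH i l 0 p).
Proof.
move=> [oU hU rU _] Uu.
have ex i l p : exists A, is_derive u (delta_mx 0 l) (fun w => jacobian phi w i p) A /\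
    is_derive u (delta_mx 0 i) (fun w => jacobian phi w l p) A.
  have [A [A1 A2]] := @derive_comm R 4 U (fun w => phi w 0 p) u (delta_mx 0 i) (delta_mx 0 l)
    oU (fun w Uw => differentiable_entry 0 p (hU w Uw)) Uu.
  have nU : \forall w \near u, U w by exact: open_nbhs_nbhs.
  have J w j : U w -> 'D_(delta_mx 0 j) (fun w => phi w 0 p) w = jacobian phi w j p.
    by move=> Uw; have [_ ->] := jacobian_entry j p (hU w Uw).
  exists A; split; [apply: near_eq_is_derive A1|apply: near_eq_is_derive A2];
    by apply: filterS nU => w Uw; exact: J.
exists (fun i l => \row_p sval (cid (ex i l p))); split=> [i l|i l p].
  apply/rowP => p; rewrite !mxE.
  case: cid => A /= [A1 A2]; case: cid => B /= [B1 B2].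
  exact: is_derive_unique A1 B2.
by rewrite mxE; case: cid => A /= [].
Qed.

Lemma lie_term (h x y z p q d e : C) :
  h * (x + y + z) + p * d + q * e = h * x + (h * y + d * p) + (h * z + e * q).
Proof. by ring. Qed.

(** Since kappa pushes forward to the constant field ek, differentiating this relation
expresses the derivatives of kappa by second derivatives of the chart. These
are symmetric, and cancel the terms in which the Lie derivative differentiates
the rows of the Jacobian; what remains is the derivative in the base point,
which beta_ek says is zero. *)
Lemma lie_sigma b : sigma_combination b -> lie_invariant a (fun=> ek R k) b.
Proof.
move=> [c0 [c1 [c2 hb]]] U phi kappa pU hkap kapE u Uu i j.
pose T x v w := c0 * beta 0 x v w + c1 * beta 1 x v w + c2 * beta (-1) x v w.
have tT : trilinear T.
  have [p1 p2 p3] := beta_trilinear 0; have [q1 q2 q3] := beta_trilinear 1.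
  have [r1 r2 r3] := beta_trilinear (-1).
  by split=> *; rewrite /T ?p1 ?q1 ?r1 ?p2 ?q2 ?r2 ?p3 ?q3 ?r3; ring.
have Tek v w : T (ek R k) v w = 0 by rewrite /T !beta_ek !mulr0 !addr0.
have [oU hU rU _] := pU.
have nU : \forall w \near u, U w by exact: open_nbhs_nbhs.
have mcU w : U w -> MC a (phi w).
  by move=> /rU[s [st [cu _]]]; exists s, st.
have bE w i' j' : U w -> pullback b phi w i' j' =
    T (phi w) (row i' (jacobian phi w)) (row j' (jacobian phi w)).
  by move=> Uw; rewrite mxE hb//; [exact: mcU|exact: rows_quadrics pU Uw|exact: rows_quadrics pU Uw].
clearbody T; have [HH [HHC dJ]] := second_derivatives pU Uu.
pose r i' := row i' (jacobian phi u).
pose dk i' l := pd i' (fun w => kappa w 0 l) u.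
have pdb l : pd l (fun w => pullback b phi w i j) u =
    T (r l) (r i) (r j) + T (phi u) (HH i l) (r j) + T (phi u) (r i) (HH j l).
  have nE : \forall w \near u, T (phi w) (row i (jacobian phi w)) (row j (jacobian phi w))
      = pullback b phi w i j by apply: filterS nU => w Uw; rewrite bE.
  have rowJ i' p : is_derive u (delta_mx 0 l) (fun w => row i' (jacobian phi w) 0 p) (HH i' l 0 p).
    rewrite (_ : (fun w => _) = (fun w => jacobian phi w i' p)); first exact: dJ.
    by apply/funext => w; rewrite mxE.
  have phiJ p : is_derive u (delta_mx 0 l) (fun w => phi w 0 p) (r l 0 p).
    by rewrite mxE; apply: jacobian_entry; exact: hU.
  have dT := is_derive_trilinear tT phiJ (rowJ i) (rowJ j).
  by have [_ <-] := near_eq_is_derive nE dT.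
have ekE : ek R k = \sum_l kappa u 0 l *: r l by rewrite -(kapE u Uu) mulmx_sum_row.
have kd i' l : is_derive u (delta_mx 0 i') (fun w => kappa w 0 l) (dk i' l).
  by split=> //; apply: diff_derivable; apply: differentiable_entry; exact: hkap.
(* The derivative of the relation between kappa, the Jacobian and ek. *)
have cancel i' : \sum_l kappa u 0 l *: HH i' l = - \sum_l dk i' l *: r l.
  apply/eqP; rewrite -addr_eq0 addrC -big_split /=; apply/eqP/rowP => p; rewrite summxE mxE.
  have d1 := is_derive_sum_pt (fun l => is_deriveM_pt (kd i' l) (dJ l i' p)).
  have d0 : is_derive u (delta_mx 0 i') (fun w => \sum_l kappa w 0 l * jacobian phi w l p) 0.
    apply: (near_eq_is_derive (f := cst (ek R k 0 p))).
    by apply: filterS nU => w Uw; rewrite /cst -(kapE w Uw) mxE.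
  rewrite -[RHS](is_derive_unique d1 d0); apply: eq_bigr => l _.
  by rewrite !mxE HHC.
have [T1 _ _] := tT.
rewrite /lie_derivative.
under eq_bigr => l _ do rewrite pdb !bE// -/(r _) -/(r _) -/(dk _ _) -/(dk _ _).
rewrite (eq_bigr (fun l => (kappa u 0 l * T (r l) (r i) (r j)) + (kappa u 0 l * T (phi u) (HH i l) (r j)
  + dk i l * T (phi u) (r l) (r j)) + (kappa u 0 l * T (phi u) (r i) (HH j l)
  + dk j l * T (phi u) (r i) (r l)))); last by move=> l _; exact: lie_term.
rewrite !big_split /=.
have [_ T2 T3] := tT.
have addT2 y : T (phi u) (- y) (r j) + T (phi u) y (r j) = 0.
  have := T2 (-1) (phi u) y y (r j); rewrite scaleN1r addNr mulN1r addNr => e.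
  by have := T2 (-1) (phi u) y 0 (r j); rewrite scaleN1r addr0 e addr0 mulN1r => ->; rewrite addNr.
have addT3 y : T (phi u) (r i) (- y) + T (phi u) (r i) y = 0.
  have := T3 (-1) (phi u) (r i) y y; rewrite scaleN1r addNr mulN1r addNr => e.
  by have := T3 (-1) (phi u) (r i) y 0; rewrite scaleN1r addr0 e addr0 mulN1r => ->; rewrite addNr.
have e1 (c : 'I_4 -> C) v : \sum_l c l * T (v l) (r i) (r j) = T (\sum_l c l *: v l) (r i) (r j).
  by rewrite (@lin_sum _ _ (fun x => T x (r i) (r j))).
have e2 (c : 'I_4 -> C) v : \sum_l c l * T (phi u) (v l) (r j) = T (phi u) (\sum_l c l *: v l) (r j).
  by rewrite (@lin_sum _ _ (fun x => T (phi u) x (r j))).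
have e3 (c : 'I_4 -> C) v : \sum_l c l * T (phi u) (r i) (v l) = T (phi u) (r i) (\sum_l c l *: v l).
  by rewrite (@lin_sum _ _ (fun x => T (phi u) (r i) x)).
by rewrite e1 !e2 !e3 -ekE Tek add0r !cancel addT2 addT3 addr0.
Qed.

End LieForms.

(** * The translation is a Killing field *)

Section Killing.
Variable R : realType.
Local Notation C := (Cx R).

(** The covariant derivative of the vector field kappa, as an endomorphism. *)
Definition nabla_field (h : 'rV[C]_4 -> 'M[C]_4) (kappa : 'rV[C]_4 -> 'rV[C]_4) u : 'M[C]_4 :=
  \matrix_(i, m) (pd i (fun w => kappa w 0 m) u + \sum_l kappa u 0 l * christoffel h m l i u).

Lemma connection_term (x c b c' b' : C) : x * (c * b + c' * b') = x * c * b + b' * (x * c').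
Proof. by ring. Qed.

(** For a torsion-free connection the Lie derivative of a parallel tensor is the
algebraic action of the covariant derivative of the field. *)
Lemma lie_parallel h kappa b u : (forall l i j, covd h b u l i j = 0) ->
  \matrix_(i, j) lie_derivative kappa b u i j =
  nabla_field h kappa u *m b u + b u *m (nabla_field h kappa u)^T.
Proof.
move=> cb; apply/matrixP => i j; rewrite [LHS]mxE /lie_derivative.
have pdb l : pd l (fun w => b w i j) u =
    \sum_m (christoffel h m l i u * b u m j + christoffel h m l j u * b u i m).
  by apply/eqP; rewrite -subr_eq0; apply/eqP; exact: cb.
rewrite (eq_bigr (fun l => kappa u 0 l * pd l (fun w => b w i j) u +
  (b u l j * pd i (fun w => kappa w 0 l) u + b u i l * pd j (fun w => kappa w 0 l) u)));
  last by move=> l _; rewrite addrA.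
rewrite big_split /=; under eq_bigr => l _ do rewrite pdb mulr_sumr.
rewrite exchange_big /= -big_split /= !mxE -big_split /=; apply: eq_bigr => m _.
rewrite !mxE mulrDl mulrDr mulr_suml mulr_sumr addrACA addrC; congr (_ + _).
  by rewrite mulrC.
rewrite -big_split; apply: eq_bigr => l _ /=.
exact: connection_term.
Qed.

Lemma compatibility_term (x y z : C) :
  x - (2^-1 * (x + y - z) + 2^-1 * (x + z - y)) = 0.
Proof. by field. Qed.

(** Lowering the index of a Christoffel symbol leaves a combination of three partial
derivatives of the metric; two such combinations add up to one derivative. *)
Lemma metric_compatible (h : 'rV[C]_4 -> 'M[C]_4) u l i j :
  (\forall w \near u, (h w)^T = h w) -> h u \in unitmx -> covd h h u l i j = 0.
Proof.
move=> hS hU; have hSu : (h u)^T = h u := nbhs_singleton hS.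
have hsym p q : h u p q = h u q p by rewrite -{1}hSu mxE.
have sym p q r : pd p (fun w => h w q r) u = pd p (fun w => h w r q) u.
  by apply: near_eq_derive; apply: filterS hS => w hw; rewrite -[in LHS]hw mxE.
have inv r n : \sum_m h u r m * invmx (h u) m n = (r == n)%:R.
  by have := congr1 (fun A : 'M[C]_4 => A r n) (mulmxV hU); rewrite mxE [RHS]mxE.
have low p q r : \sum_m christoffel h m p q u * h u m r =
    2^-1 * (pd p (fun w => h w r q) u + pd q (fun w => h w r p) u - pd r (fun w => h w p q) u).
  have : \sum_n (\sum_m h u r m * invmx (h u) m n) *
      (2^-1 * (pd p (fun w => h w n q) u + pd q (fun w => h w n p) u - pd n (fun w => h w p q) u)) =
    2^-1 * (pd p (fun w => h w r q) u + pd q (fun w => h w r p) u - pd r (fun w => h w p q) u).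
    under eq_bigr => n _ do rewrite inv; rewrite (bigD1 r)//= eqxx mul1r big1 ?addr0// => n.
    by rewrite eq_sym => /negbTE ->; rewrite mul0r.
  move=> <-; under [RHS]eq_bigr => n _ do rewrite mulr_suml.
  rewrite exchange_big /=; apply: eq_bigr => m _; rewrite /christoffel mulr_sumr mulr_suml.
  apply: eq_bigr => n _; rewrite (hsym m r).
  move: (_ + _ - _) => X; ring.
rewrite /covd big_split /= low.
have -> : \sum_m christoffel h m l j u * h u i m = \sum_m christoffel h m l j u * h u m i.
  by apply: eq_bigr => m _; rewrite (hsym i m).
rewrite low (sym l j i) (sym i j l) (sym j i l); exact: compatibility_term.
Qed.

Variables (k : nat) (a : C).
Hypothesis hk : (3 <= k)%N.
Hypothesis a0 : a != 0.
Local Notation V := 'rV[C]_k.+1.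
Variables (g S00 S01 S11 : tensor2 R k).
Hypothesis hg : twistor_metric a g S00 S01 S11.

Section Chart.
Variables (U : set 'rV[C]_4) (phi : 'rV[C]_4 -> V).
Hypothesis pU : param a U phi.

Lemma chart_MC u : U u -> MC a (phi u).
Proof. by case: pU => _ _ rU _ /rU[s [st [cu _]]]; exists s, st. Qed.

Lemma chart_row_TM u i : U u -> TM a (phi u) (row i (jacobian phi u)).
Proof.
move=> Uu; exists (deform a (phi u) (row i (jacobian phi u))), (deform_inf a (phi u) (row i (jacobian phi u))).
by apply: deformation_ex => //; [exact: chart_MC|exact: rows_quadrics pU Uu].
Qed.

Lemma pullback_sym u : U u -> (pullback g phi u)^T = pullback g phi u.
Proof.
move=> Uu; have [_ gS _ _] := tm_holo hg; have [_ _ rU _] := pU.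
apply/matrixP => i j; rewrite !mxE; apply: gS; [exact: rU|exact: chart_row_TM|exact: chart_row_TM].
Qed.

(** The metric is linear on tangent vectors only, so tangency of the partial sums is
carried along. *)
Lemma metric_sum u (y : 'rV[C]_4) w : U u -> TM a (phi u) w ->
  g (phi u) (y *m jacobian phi u) w = \sum_i y 0 i * g (phi u) (row i (jacobian phi u)) w.
Proof.
move=> Uu tw; have [gL _ _ _] := tm_holo hg; have [_ _ rU _] := pU.
have rx := rU u Uu.
have tb v : quadrics (phi u) v -> TM a (phi u) v.
  move=> bv; exists (deform a (phi u) v), (deform_inf a (phi u) v).
  by apply: deformation_ex => //; exact: chart_MC.
have g0 : g (phi u) 0 w = 0.
  have := gL (phi u) 0 0 w 1 rx (tb _ (quadrics0 _)) (tb _ (quadrics0 _)) tw.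
  by rewrite scale1r addr0 mul1r => /eqP; rewrite eq_sym -subr_eq0 addrK => /eqP.
rewrite mulmx_sum_row.
suff [] : quadrics (phi u) (\sum_i y 0 i *: row i (jacobian phi u)) /\
  g (phi u) (\sum_i y 0 i *: row i (jacobian phi u)) w =
  \sum_i y 0 i * g (phi u) (row i (jacobian phi u)) w by [].
elim/big_rec2 : _ => [|i s v _ [bv <-]]; first by split=> //; exact: quadrics0.
split; first by apply: quadricsD => //; exact: rows_quadrics pU Uu.
by apply: gL => //; [exact: chart_row_TM|exact: tb].
Qed.

(** The metric is nondegenerate on tangent vectors, and by TM_rowspace the partial
derivatives of a chart exhaust them. *)
Lemma pullback_unit u : U u -> pullback g phi u \in unitmx.
Proof.
move=> Uu; have [gL gS gN _] := tm_holo hg; have [_ _ rU fJ] := pU.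
rewrite unitmxE unitfE; apply/negP => /det0P[y y0 yh].
have tv : TM a (phi u) (y *m jacobian phi u).
  exists (deform a (phi u) (y *m jacobian phi u)), (deform_inf a (phi u) (y *m jacobian phi u)).
  apply: deformation_ex => //; first exact: chart_MC.
  by rewrite mulmx_sum_row; apply: quadrics_sum => i; exact: rows_quadrics pU Uu.
have : y *m jacobian phi u = 0.
  apply: (gN (phi u)) => [||w tw]; [exact: rU|exact: tv|].
  have [z wz] := TM_rowspace (rU u Uu) (fJ u Uu) (fun i => chart_row_TM i Uu) tw.
  rewrite gS//; last exact: rU.
  rewrite wz metric_sum// big1// => j _; rewrite gS; [|exact: rU|exact: chart_row_TM|exact: tv].
  rewrite metric_sum//; last exact: chart_row_TM.
  have /matrixP/(_ 0 j) := yh; rewrite !mxE; under eq_bigr => i _ do rewrite mxE.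
  by move=> ->; rewrite mulr0.
move/(congr1 (mulmx ^~ (pinvmx (jacobian phi u)))); rewrite mul0mx mulmxKp ?fJ// => e.
by move: y0; rewrite e eqxx.
Qed.

End Chart.

(** The translation preserves the three parallel forms, so by lie_parallel its
covariant derivative annihilates them. As they span the self-dual forms,
selfdual_annihilator makes the covariant derivative skew for the metric, which
is itself parallel: the field is Killing. *)
Lemma metric_killing : lie_invariant a (fun=> ek R k) g.
Proof.
move=> U phi kappa pU hkap kapE u Uu i j.
have [oU _ _ _] := pU.
have [s0 s1 s2] := sigma_combinationP hk (tm_sigma hg).
have [p0 p1 p2] := tm_parallel hg.
pose X := nabla_field (pullback g phi) kappa u.
have annih b : sigma_combination a b -> parallel a g b ->
    X *m pullback b phi u + pullback b phi u *m X^T = 0.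
  move=> sb pb; rewrite -(lie_parallel kappa (pb U phi pU u Uu)).
  by apply/matrixP => i' j'; rewrite !mxE; apply: (lie_sigma hk a0 sb pU hkap kapE).
have hS := pullback_sym pU Uu; have hU := pullback_unit pU Uu.
have := selfdual_annihilator hS hU (tm_spans hg pU Uu) (annih _ s0 p0) (annih _ s1 p1) (annih _ s2 p2).
rewrite -lie_parallel => [/matrixP/(_ i j)|l i' j']; first by rewrite !mxE.
apply: metric_compatible => //.
have : \forall w \near u, U w by exact: open_nbhs_nbhs.
by apply: filterS => w Uw; exact: (pullback_sym pU Uw).
Qed.

End Killing.

(** * Jumping curves preserved by a tri-holomorphic Killing field *)

Theorem theorem3p1 (R : realType) (k : nat) (a : Cx R)
    (hk : (3 <= k)%N) (ha : a != 0)
    (g S00 S01 S11 : tensor2 R k)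
    (hg : twistor_metric a g S00 S01 S11) :
  generically (@Mcoord R k a) (Mreg a) /\
  exists (gamma : set 'rV[Cx R]_k.+1) (K : 'rV[Cx R]_k.+1 -> 'rV[Cx R]_k.+1),
    [/\ holo_curve gamma,
        gamma `<=` MC a `&` closure (Mreg a),
        forall x, gamma x -> normal_type a x k%:Z (2 - k%:Z),
        triholomorphic_killing a g S00 S01 S11 K
      & preserved_by K gamma].
Proof.
split; first exact: generic_regular.
exists (@gamma R k), (fun=> ek R k); split.
- exact: gamma_holo_curve.
- by move=> x gx; split; [exact: gamma_MC|exact: gamma_closure].
- by move=> x gx; exact: gamma_normal_type.
- have [s0 s1 s2] := sigma_combinationP hk (tm_sigma hg).
  split.
  + exact: vector_field_ek.
  + exact: ek_regular.
  + exact: metric_killing hg.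
  + by split; exact: lie_sigma.
- exact: gamma_preserved.
Qed.
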